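(* Let $R$ be a left noetherian ring and let $e$ be an idempotent in $R$. Suppose that (1) the right $eRe$-module $Re$ has finite projective dimension, and (2) every finitely generated left $R$-module $M$ admits a projective resolution $P$ (by finitely generated projective left $R$-modules) such that $P^{-i}\in \operatorname{add} Re$ for every sufficiently large $i$. Then the functor $i_\lambda = Re\otimes_{eRe}-$ induces a singular equivalence between $eRe$ and $R$, i.e. the induced functor $\mathbf{D}_{\mathrm{sg}}(i_\lambda)\colon \mathbf{D}_{\mathrm{sg}}(eRe)\to\mathbf{D}_{\mathrm{sg}}(R)$ is a triangle equivalence.
   Context: For a left noetherian ring $R$, $\operatorname{mod} R$ is the category of finitely generated left $R$-modules and $\operatorname{proj} R$ its full subcategory of projective modules. $\mathbf{K}^{-,\mathrm{b}}(\operatorname{proj} R)$ is the homotopy category of bounded above (cochain) complexes in $\operatorname{proj} R$ with bounded cohomology. A complex is perfect if it is quasi-isomorphic to a bounded complex in $\operatorname{proj} R$; $\mathbf{K}^{\mathrm{b}}(\operatorname{proj} R)$ denotes the full subcategory of perfect complexes in $\mathbf{K}^{-,\mathrm{b}}(\operatorname{proj} R)$. The singularity category of $R$ is the Verdier quotient $\mathbf{D}_{\mathrm{sg}}(R)=\mathbf{K}^{-,\mathrm{b}}(\operatorname{proj} R)/\mathbf{K}^{\mathrm{b}}(\operatorname{proj} R)$ (equivalently, the quotient of the bounded derived category of $\operatorname{mod} R$ by the perfect complexes). A singular equivalence between two rings is a triangle equivalence between their singularity categories. For an idempotent $e\in R$, $i_\lambda\colon \operatorname{mod} eRe\to\operatorname{mod}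 R$ is the functor $N\mapsto Re\otimes_{eRe}N$, and $\operatorname{add} Re$ is the full subcategory of $\operatorname{mod} R$ of direct summands of finite direct sums of copies of $Re$. The functor $i_\lambda$ sends projectives to projectives and is applied termwise to complexes. When this termwise functor sends $\mathbf{K}^{-,\mathrm{b}}(\operatorname{proj} eRe)$ into $\mathbf{K}^{-,\mathrm{b}}(\operatorname{proj} R)$ (which is the case when the right $eRe$-module $Re$ has finite projective dimension), it also preserves perfect complexes, and $\mathbf{D}_{\mathrm{sg}}(i_\lambda)\colon \mathbf{D}_{\mathrm{sg}}(eRe)\to\mathbf{D}_{\mathrm{sg}}(R)$ denotes the induced triangle functor. Projective resolutions are written as cochain complexes with $P^{-i}$ ($i\ge 0$) the $i$-th term. *)

(* Defs.v *)
From HB Require Import structures.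
From mathcomp Require Import all_boot all_order all_algebra.
From mathcomp Require Import boolp.

Set Implicit Arguments.
Unset Strict Implicit.
Unset Printing Implicit Defensive.

Import Order.TTheory GRing.Theory Num.Theory.
Local Open Scope ring_scope.
Local Open Scope quotient_scope.

#[local] Obligation Tactic := idtac.

(** * Rings and modules

  Rings may be noncommutative and may be zero ([pzRingType]); left [R]-modules
  are [lmodType R], and right [R]-modules are left modules over the converse
  ring [R^c]. *)

Definition left_ideal (R : pzRingType) (I : R -> Prop) : Prop :=
  [/\ I 0, forall x y, I x -> I y -> I (x + y) & forall a x, I x -> I (a * x)].

Definition left_noetherian (R : pzRingType) : Prop :=
  forall I : R -> Prop, left_ideal I ->
  exists (n : nat) (v : 'I_n -> R), (forall i, I (v i)) /\
    forall x, I x -> exists c : 'I_n -> R, x = \sum_i c i * v i.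

Definition finitely_generated (R : pzRingType) (M : lmodType R) : Prop :=
  exists (n : nat) (v : 'I_n -> M),
    forall x, exists c : 'I_n -> R, x = \sum_i c i *: v i.

Definition projective (R : pzRingType) (P : lmodType R) : Prop :=
  forall (M N : lmodType R) (g : {linear M -> N}) (f : {linear P -> N}),
    (forall y, exists x, g x = y) ->
    exists h : {linear P -> M}, forall x, g (h x) = f x.

Definition zero_module (R : pzRingType) (M : lmodType R) : Prop :=
  forall x : M, x = 0.

(* [res_term i] is the term of cohomological degree [- i]. *)
Record resolution (R : pzRingType) (M : lmodType R) := Resolution {
  res_term :> nat -> lmodType R;
  res_diff : forall i, {linear res_term i.+1 -> res_term i};
  res_aug : {linear res_term 0%N -> M};
  res_projective : forall i, projective (res_term i);
  res_aug_surj : forall y, exists x, res_aug x = y;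
  res_exact0 : forall x, res_aug x = 0 <-> exists y, res_diff 0 y = x;
  res_exactS : forall i x,
    res_diff i x = 0 <-> exists y, res_diff i.+1 y = x
}.

Definition finite_projective_dimension (R : pzRingType) (M : lmodType R) :=
  exists (P : resolution M) (n : nat),
    forall i, (n < i)%N -> zero_module (P i).

(** * Complexes

  Complexes are cochain complexes indexed by [int].  The differential goes
  from degree [i] to degree [i + 1], and all conditions are written at degrees
  of the form [i + 1], which avoids transports along equalities of degrees;
  since every integer is of this form, nothing is lost. *)

Record complex (R : pzRingType) := Complex {
  cterm :> int -> lmodType R;
  cdiff : forall i, {linear cterm i -> cterm (i + 1)};
  cdiffK : forall i x, cdiff (i + 1) (cdiff i x) = 0
}.
Arguments cdiff {R} c i.

Record chain_map (R : pzRingType) (X Y : complex R) := ChainMap {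
  cmap :> forall i, {linear X i -> Y i};
  cmapC : forall i x, cmap (i + 1) (cdiff X i x) = cdiff Y i (cmap i x)
}.

Section Complexes.
Variable R : pzRingType.
Implicit Types X Y Z : complex R.

Definition homotopic X Y (f g : chain_map X Y) : Prop :=
  exists s : forall i, {linear X (i + 1) -> Y i}, forall i x,
    f (i + 1) x - g (i + 1) x
    = cdiff Y i (s i x) + s (i + 1) (cdiff X (i + 1) x).

Program Definition chain_id X : chain_map X X :=
  @ChainMap _ _ _ (fun i => idfun : {linear X i -> X i}) _.
Next Obligation. by []. Qed.

Program Definition chain_comp X Y Z (g : chain_map Y Z) (f : chain_map X Y) :
    chain_map X Z :=
  @ChainMap _ _ _ (fun i => g i \o f i : {linear X i -> Z i}) _.
Next Obligation. by move=> X Y Z g f i x /=; rewrite !cmapC. Qed.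

(* [H^(i + 1)(X) = 0] *)
Definition cohomology_vanishes X (i : int) : Prop :=
  forall x : X (i + 1), cdiff X (i + 1) x = 0 -> exists y, cdiff X i y = x.

Definition bounded_above X : Prop :=
  exists n : int, forall i, n < i -> zero_module (X i).

Definition bounded X : Prop :=
  exists m n : int, forall i, i < m \/ n < i -> zero_module (X i).

Definition bounded_cohomology X : Prop :=
  exists m n : int, forall i, i < m \/ n < i -> cohomology_vanishes X i.

Definition in_proj X : Prop :=
  forall i, finitely_generated (X i) /\ projective (X i).

(* The two clauses are injectivity and surjectivity of [H^(i + 1)(f)]. *)
Definition quasi_iso X Y (f : chain_map X Y) : Prop :=
  forall i : int,
  (forall x : X (i + 1), cdiff X (i + 1) x = 0 ->
     (exists y, f (i + 1) x = cdiff Y i y) -> exists w, x = cdiff X i w) /\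
  (forall y : Y (i + 1), cdiff Y (i + 1) y = 0 ->
     exists x w, cdiff X (i + 1) x = 0 /\ y = f (i + 1) x + cdiff Y i w).

Inductive quasi_isomorphic : complex R -> complex R -> Prop :=
| qis_step X Y (f : chain_map X Y) : quasi_iso f -> quasi_isomorphic X Y
| qis_sym X Y : quasi_isomorphic X Y -> quasi_isomorphic Y X
| qis_trans X Y Z :
    quasi_isomorphic X Y -> quasi_isomorphic Y Z -> quasi_isomorphic X Z.

Definition perfect X : Prop :=
  exists B, [/\ bounded B, in_proj B & quasi_isomorphic X B].

Program Definition shift X : complex R :=
  @Complex R (fun i => X (i + 1)) (fun i => \- cdiff X (i + 1)) _.
Next Obligation. by move=> X i x /=; rewrite linearN cdiffK !oppr0. Qed.

Program Definition shift_map X Y (f : chain_map X Y) :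
    chain_map (shift X) (shift Y) :=
  @ChainMap _ (shift X) (shift Y) (fun i => f (i + 1)) _.
Next Obligation. by move=> X Y f i x /=; rewrite linearN cmapC. Qed.

Definition cone_diff X Y (f : chain_map X Y) (i : int)
    (u : (X (i + 1)%R * Y i)%type) : (X (i + 1 + 1)%R * Y (i + 1)%R)%type :=
  (- cdiff X (i + 1) u.1, f (i + 1) u.1 + cdiff Y i u.2).

Fact cone_diff_linear X Y (f : chain_map X Y) i : linear (@cone_diff X Y f i).
Proof.
move=> a [x y] [x' y']; rewrite /cone_diff /=; congr (_, _).
- by rewrite linearP opprD -scalerN.
- by rewrite /= !linearP scalerDr addrACA.
Qed.

HB.instance Definition _ X Y (f : chain_map X Y) i :=
  GRing.isLinear.Build R (X (i + 1)%R * Y i)%type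
    (X (i + 1 + 1)%R * Y (i + 1)%R)%type *:%R
    (@cone_diff X Y f i) (@cone_diff_linear X Y f i).

Program Definition cone X Y (f : chain_map X Y) : complex R :=
  @Complex R (fun i => (X (i + 1)%R * Y i)%type : lmodType R)
    (fun i => @cone_diff X Y f i) _.
Next Obligation.
move=> X Y f i [x y] /=; rewrite /cone_diff /=; congr (_, _).
  by rewrite linearN cdiffK !oppr0.
by rewrite linearD linearN cdiffK addr0 cmapC addNr.
Qed.

Definition pair0l (M N : lmodType R) (x : M) : (M * N)%type := (x, 0).
Definition pair0r (M N : lmodType R) (y : N) : (M * N)%type := (0, y).

Fact pair0l_linear (M N : lmodType R) : linear (@pair0l M N).
Proof. by move=> a x y; congr (_, _); rewrite /= scaler0 addr0. Qed.
Fact pair0r_linear (M N : lmodType R) : linear (@pair0r M N).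
Proof. by move=> a x y; congr (_, _); rewrite /= scaler0 addr0. Qed.

HB.instance Definition _ (M N : lmodType R) :=
  GRing.isLinear.Build R M (M * N)%type *:%R (@pair0l M N) (@pair0l_linear M N).
HB.instance Definition _ (M N : lmodType R) :=
  GRing.isLinear.Build R N (M * N)%type *:%R (@pair0r M N) (@pair0r_linear M N).

Definition pair_map (P M N : lmodType R) (f : {linear P -> M})
  (g : {linear P -> N}) (x : P) : (M * N)%type := (f x, g x).

Fact pair_map_linear (P M N : lmodType R) (f : {linear P -> M})
  (g : {linear P -> N}) : linear (pair_map f g).
Proof. by move=> a x y; congr (_, _); rewrite linearP. Qed.

HB.instance Definition _ (P M N : lmodType R) (f : {linear P -> M})
    (g : {linear P -> N}) :=
  GRing.isLinear.Build R P (M * N)%type *:%R (pair_map f g)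
    (pair_map_linear f g).

Program Definition cone_in X Y (f : chain_map X Y) : chain_map Y (cone f) :=
  @ChainMap _ Y (cone f) (fun i => @pair0r (X (i + 1)) (Y i)) _.
Next Obligation.
by move=> X Y f i x /=; rewrite /cone_diff /pair0r /= !linear0 ?oppr0 add0r.
Qed.

Program Definition cone_out X Y (f : chain_map X Y) :
    chain_map (cone f) (shift X) :=
  @ChainMap _ (cone f) (shift X)
    (fun i => (@fst (X (i + 1)) (Y i)) : {linear _ -> _}) _.
Next Obligation. by []. Qed.

(* [X] is an object of [K^(-,b)(proj R)]. *)
Definition in_Kmb X : Prop :=
  [/\ in_proj X, bounded_above X & bounded_cohomology X].

Record kmb_obj := KmbObj { kmb_cx :> complex R; kmb_in : in_Kmb kmb_cx }.

End Complexes.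

(** * Categories

  Equality of morphisms is an equivalence relation [heq], so that quotients
  of sets of morphisms need not be formed. *)

Record category := Category {
  ob :> Type;
  mor : ob -> ob -> Type;
  heq : forall X Y, mor X Y -> mor X Y -> Prop;
  idm : forall X, mor X X;
  mcomp : forall X Y Z, mor Y Z -> mor X Y -> mor X Z;
  heq_refl : forall X Y (f : mor X Y), heq f f;
  heq_sym : forall X Y (f g : mor X Y), heq f g -> heq g f;
  heq_trans : forall X Y (f g h : mor X Y), heq f g -> heq g h -> heq f h;
  comp_heq : forall X Y Z (g g' : mor Y Z) (f f' : mor X Y),
    heq g g' -> heq f f' -> heq (mcomp g f) (mcomp g' f');
  comp1m : forall X Y (f : mor X Y), heq (mcomp (idm Y) f) f;
  compm1 : forall X Y (f : mor X Y), heq (mcomp f (idm X)) f;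
  compA : forall X Y Z W (h : mor Z W) (g : mor Y Z) (f : mor X Y),
    heq (mcomp h (mcomp g f)) (mcomp (mcomp h g) f)
}.
Arguments mor {c} _ _.
Arguments idm {c} _.

Local Notation "f =h g" := (heq f g) (at level 70).
Local Notation "g \oh f" := (mcomp g f) (at level 50).

Record functor (C D : category) := Functor {
  fob :> C -> D;
  fhom : forall X Y, mor X Y -> mor (fob X) (fob Y);
  fhom_heq : forall X Y (f g : mor X Y), f =h g -> fhom f =h fhom g;
  fhom_id : forall X, fhom (idm X) =h idm (fob X);
  fhom_comp : forall X Y Z (g : mor Y Z) (f : mor X Y),
    fhom (g \oh f) =h fhom g \oh fhom f
}.
Arguments fhom {C D} f {X Y} _ : rename.

Definition isomorphism (C : category) (X Y : C) (f : mor X Y) : Prop :=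
  exists g : mor Y X, g \oh f =h idm X /\ f \oh g =h idm Y.

Program Definition functor_id (C : category) : functor C C :=
  @Functor C C id (fun _ _ f => f) _ _ _.
Next Obligation. by []. Qed.
Next Obligation. by move=> *; apply: heq_refl. Qed.
Next Obligation. by move=> *; apply: heq_refl. Qed.

Program Definition functor_comp (C D E : category) (G : functor D E)
    (F : functor C D) : functor C E :=
  @Functor C E (fun X => G (F X)) (fun _ _ f => fhom G (fhom F f)) _ _ _.
Next Obligation. by move=> C D E G F X Y f g fg; do 2!apply: fhom_heq. Qed.
Next Obligation.
move=> C D E G F X; apply: heq_trans (fhom_id G _).
by apply: fhom_heq; apply: fhom_id.
Qed.
Next Obligation.
move=> C D E G F X Y Z g f; apply: heq_trans (fhom_comp G _ _).
by apply: fhom_heq; apply: fhom_comp.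
Qed.

Definition natural (C D : category) (F G : functor C D)
    (a : forall X, mor (F X) (G X)) : Prop :=
  forall X Y (f : mor X Y), a Y \oh fhom F f =h fhom G f \oh a X.

Definition natural_isomorphism (C D : category) (F G : functor C D)
    (a : forall X, mor (F X) (G X)) : Prop :=
  natural a /\ forall X, isomorphism (a X).

Definition naturally_isomorphic (C D : category) (F G : functor C D) : Prop :=
  exists a : forall X, mor (F X) (G X), natural_isomorphism a.

Definition equivalence (C D : category) (F : functor C D) : Prop :=
  exists G : functor D C,
    naturally_isomorphic (functor_comp G F) (functor_id C) /\
    naturally_isomorphic (functor_comp F G) (functor_id D).

(** ** Localization

  [localization S] is the category obtained from [C] by formally inverting
  the morphisms in [S]: morphisms are formal composites of morphisms of [C]
  and of inverses of morphisms in [S], modulo the least congruence making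
  [loc_mor] a functor that inverts [S].  For a triangulated category and a
  triangulated subcategory [N], the Verdier quotient by [N] is the
  localization at the morphisms whose cone lies in [N]. *)

Section Localization.
Variables (C : category) (S : forall X Y : C, mor X Y -> Prop).

Inductive loc_hom : C -> C -> Type :=
| loc_mor X Y : mor X Y -> loc_hom X Y
| loc_inv X Y (f : mor X Y) : S f -> loc_hom Y X
| loc_comp X Y Z : loc_hom Y Z -> loc_hom X Y -> loc_hom X Z.

Inductive loc_eq : forall X Y, loc_hom X Y -> loc_hom X Y -> Prop :=
| loc_refl X Y (f : loc_hom X Y) : loc_eq f f
| loc_sym X Y (f g : loc_hom X Y) : loc_eq f g -> loc_eq g f
| loc_trans X Y (f g h : loc_hom X Y) : loc_eq f g -> loc_eq g h -> loc_eq f h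
| loc_comp_eq X Y Z (g g' : loc_hom Y Z) (f f' : loc_hom X Y) :
    loc_eq g g' -> loc_eq f f' -> loc_eq (loc_comp g f) (loc_comp g' f')
| loc_assoc X Y Z W (h : loc_hom Z W) (g : loc_hom Y Z) (f : loc_hom X Y) :
    loc_eq (loc_comp h (loc_comp g f)) (loc_comp (loc_comp h g) f)
| loc_idl X Y (f : loc_hom X Y) : loc_eq (loc_comp (loc_mor (idm Y)) f) f
| loc_idr X Y (f : loc_hom X Y) : loc_eq (loc_comp f (loc_mor (idm X))) f
| loc_mor_eq X Y (f g : mor X Y) : f =h g -> loc_eq (loc_mor f) (loc_mor g)
| loc_mor_comp X Y Z (g : mor Y Z) (f : mor X Y) :
    loc_eq (loc_mor (g \oh f)) (loc_comp (loc_mor g) (loc_mor f))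
| loc_invl X Y (f : mor X Y) (Sf : S f) :
    loc_eq (loc_comp (loc_inv Sf) (loc_mor f)) (loc_mor (idm X))
| loc_invr X Y (f : mor X Y) (Sf : S f) :
    loc_eq (loc_comp (loc_mor f) (loc_inv Sf)) (loc_mor (idm Y)).

Definition localization : category :=
  @Category C loc_hom loc_eq (fun X => loc_mor (idm X)) loc_comp
    loc_refl loc_sym loc_trans loc_comp_eq loc_idl loc_idr loc_assoc.

End Localization.

Section LocalizationFunctor.
Variables (C D : category).
Variables (S : forall X Y : C, mor X Y -> Prop).
Variables (T : forall X Y : D, mor X Y -> Prop).
Variables (F : functor C D).
Hypothesis FST : forall X Y (f : mor X Y), S f -> T (fhom F f).

Fixpoint loc_fhom X Y (f : loc_hom S X Y) : loc_hom T (F X) (F Y) :=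
  match f with
  | loc_mor _ _ g => loc_mor T (fhom F g)
  | loc_inv _ _ _ Sg => loc_inv (FST Sg)
  | loc_comp _ _ _ g h => loc_comp (loc_fhom g) (loc_fhom h)
  end.

Program Definition loc_functor : functor (localization S) (localization T) :=
  @Functor (localization S) (localization T) F loc_fhom _ _ _.
Next Obligation.
move=> X Y f g; rewrite /=; elim=> {X Y f g} /=.
- by move=> *; apply: loc_refl.
- by move=> X Y f g _; apply: loc_sym.
- by move=> X Y f g h _ fg _; apply: loc_trans.
- by move=> X Y Z g g' f f' _ gg' _ ff'; apply: loc_comp_eq.
- by move=> *; apply: loc_assoc.
- move=> X Y f; apply: loc_trans (loc_idl _).
  by apply: loc_comp_eq (loc_refl _); apply: loc_mor_eq; apply: fhom_id.
- move=> X Y f; apply: loc_trans (loc_idr _).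
  by apply: loc_comp_eq (loc_refl _) _; apply: loc_mor_eq; apply: fhom_id.
- by move=> X Y f g fg; apply: loc_mor_eq; apply: fhom_heq.
- move=> X Y Z g f; apply: loc_trans (loc_mor_comp _ _ _).
  by apply: loc_mor_eq; apply: fhom_comp.
- move=> X Y f Sf; apply: loc_trans (loc_invl _) _.
  by apply: loc_mor_eq; apply: heq_sym; apply: fhom_id.
- move=> X Y f Sf; apply: loc_trans (loc_invr _) _.
  by apply: loc_mor_eq; apply: heq_sym; apply: fhom_id.
Qed.
Next Obligation. by move=> X /=; apply: loc_mor_eq; apply: fhom_id. Qed.
Next Obligation. by move=> X Y Z g f /=; apply: loc_refl. Qed.

End LocalizationFunctor.

Record triangle (C : category) (Sigma : functor C C) := Triangle {
  tri_X : C;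
  tri_Y : C;
  tri_Z : C;
  tri_f : mor tri_X tri_Y;
  tri_g : mor tri_Y tri_Z;
  tri_h : mor tri_Z (Sigma tri_X)
}.

Definition triangle_iso (C : category) (Sigma : functor C C)
    (t t' : triangle Sigma) : Prop :=
  exists (a : mor (tri_X t) (tri_X t')) (b : mor (tri_Y t) (tri_Y t'))
         (c : mor (tri_Z t) (tri_Z t')),
    [/\ isomorphism a, isomorphism b & isomorphism c] /\
    [/\ b \oh tri_f t =h tri_f t' \oh a,
        c \oh tri_g t =h tri_g t' \oh b &
        fhom Sigma a \oh tri_h t =h tri_h t' \oh c].

(* Only the data of a triangulated category; the axioms are not included. *)
Record triangulated := Triangulated {
  tri_cat :> category;
  susp : functor tri_cat tri_cat;
  distinguished : triangle susp -> Prop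
}.
Arguments susp : clear implicits.

(* The image of a triangle under a functor [F] equipped with a comparison
   [eta] of [F] after suspension with suspension after [F]. *)
Definition map_triangle (C D : triangulated) (F : functor C D)
    (eta : forall X, mor (F (susp C X)) (susp D (F X)))
    (t : triangle (susp C)) : triangle (susp D) :=
  @Triangle D (susp D) _ _ _ (fhom F (tri_f t)) (fhom F (tri_g t))
    (eta (tri_X t) \oh fhom F (tri_h t)).

(* Additivity is not listed: a functor that commutes with suspension and
   preserves distinguished triangles between triangulated categories preserves
   zero objects and biproducts. *)
Definition triangle_functor (C D : triangulated) (F : functor C D)
    (eta : forall X, mor (F (susp C X)) (susp D (F X))) : Prop :=
  @natural_isomorphism C D
    (functor_comp F (susp C)) (functor_comp (susp D) F) eta /\
  forall t, distinguished t -> distinguished (map_triangle eta t).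

Definition triangle_equivalence (C D : triangulated) (F : functor C D)
    (eta : forall X, mor (F (susp C X)) (susp D (F X))) : Prop :=
  triangle_functor eta /\ equivalence F.

Section Singularity.
Variable R : pzRingType.
Implicit Types X Y Z : complex R.

Lemma homotopic_ext X Y (f g : chain_map X Y) :
  (forall i x, f i x = g i x) -> homotopic f g.
Proof.
move=> fg; exists (fun i => \0 : {linear X (i + 1) -> Y i}) => i x /=.
by rewrite fg subrr linear0 addr0.
Qed.

Lemma homotopic_refl X Y (f : chain_map X Y) : homotopic f f.
Proof. exact: homotopic_ext. Qed.

Lemma homotopic_sym X Y (f g : chain_map X Y) : homotopic f g -> homotopic g f.
Proof.
case=> s Hs; exists (fun i => \- s i : {linear X (i + 1) -> Y i}) => i x /=.
by rewrite linearN -opprD -Hs opprB.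
Qed.

Lemma homotopic_trans X Y (f g h : chain_map X Y) :
  homotopic f g -> homotopic g h -> homotopic f h.
Proof.
move=> [s Hs] [t Ht].
exists (fun i => s i \+ t i : {linear X (i + 1) -> Y i}) => i x /=.
by rewrite linearD addrACA -Hs -Ht addrA subrK.
Qed.

Lemma homotopic_comp X Y Z (g g' : chain_map Y Z) (f f' : chain_map X Y) :
  homotopic g g' -> homotopic f f' ->
  homotopic (chain_comp g f) (chain_comp g' f').
Proof.
move=> [t Ht] [s Hs].
exists (fun i => (g i \o s i) \+ (t i \o f' (i + 1)) :
          {linear X (i + 1) -> Z i}) => i x /=.
rewrite linearD -!cmapC addrACA -(linearD (g (i + 1))) -Hs cmapC -Ht.
by rewrite linearB addrA subrK.
Qed.

(* [K^(-,b)(proj R)] *)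
Program Definition Kmb : category :=
  @Category (kmb_obj R) (fun A B => chain_map A B)
    (fun A B f g => homotopic f g) (fun A => chain_id A)
    (fun A B C g f => chain_comp g f) _ _ _ _ _ _ _.
Next Obligation. by move=> X Y f; apply: homotopic_refl. Qed.
Next Obligation. by move=> X Y f g; apply: homotopic_sym. Qed.
Next Obligation. by move=> X Y f g h; apply: homotopic_trans. Qed.
Next Obligation. by move=> X Y Z g g' f f'; apply: homotopic_comp. Qed.
Next Obligation. by move=> X Y f; apply: homotopic_ext. Qed.
Next Obligation. by move=> X Y f; apply: homotopic_ext. Qed.
Next Obligation. by move=> *; apply: homotopic_ext. Qed.

Program Definition kmb_shift (X : kmb_obj R) : kmb_obj R :=
  @KmbObj R (shift X) _.
Next Obligation.
case=> X [pX [k Hk] [m [n Hmn]]]; split=> [i||]; first exact: pX.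
  by exists k => i ki; apply: Hk; apply: lt_trans ki _; rewrite ltrDl.
exists (m - 1), n => i Hi x /= dx0.
have Hi1 : i + 1 < m \/ n < i + 1.
  case: Hi => [|ni]; first by rewrite ltrBrDr; left.
  by right; apply: lt_trans ni _; rewrite ltrDl.
have [|y <-] := Hmn _ Hi1 x; first by move/eqP: dx0; rewrite oppr_eq0 => /eqP.
by exists (- y); rewrite /= linearN opprK.
Qed.

Program Definition Kmb_shift : functor Kmb Kmb :=
  @Functor Kmb Kmb kmb_shift (fun A B f => shift_map f) _ _ _.
Next Obligation.
move=> X Y f g [s Hs].
exists (fun i => \- s (i + 1) : {linear X (i + 1 + 1) -> Y (i + 1)}) => i x /=.
by rewrite Hs !linearN !opprK.
Qed.
Next Obligation. by move=> X; apply: homotopic_ext. Qed.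
Next Obligation. by move=> *; apply: homotopic_ext. Qed.

Lemma fg_prod (M N : lmodType R) :
  finitely_generated M -> finitely_generated N ->
  finitely_generated (M * N)%type.
Proof.
move=> [m [v Hv]] [n [w Hw]]; exists (m + n)%N.
exists (fun i => match split i with inl j => (v j, 0) | inr k => (0, w k) end).
move=> [x y]; have [c ->] := Hv x; have [d ->] := Hw y.
exists (fun i => match split i with inl j => c j | inr k => d k end).
rewrite big_split_ord /=.
rewrite (eq_bigr (fun i => (c i *: v i, 0))) => [|i _]; last first.
  by rewrite (unsplitK (inl i)); congr (_, _); rewrite /= scaler0.
rewrite [X in _ + X](eq_bigr (fun i => (0, d i *: w i))) => [|i _]; last first.
  by rewrite (unsplitK (inr i)); congr (_, _); rewrite /= scaler0.
apply/eqP; rewrite xpair_eqE /= !raddf_sum /=.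
rewrite [X in _ == _ + X]big1 // [X in _ && (_ == X + _)]big1 //.
by rewrite addr0 add0r !eqxx.
Qed.

Lemma projective_prod (M N : lmodType R) :
  projective M -> projective N -> projective (M * N)%type.
Proof.
move=> pM pN A B g f gs.
have [h Hh] := pM A B g (f \o @pair0l _ M N) gs.
have [k Hk] := pN A B g (f \o @pair0r _ M N) gs.
exists ((h \o fst) \+ (k \o snd) : {linear (M * N)%type -> A}) => -[x y] /=.
rewrite linearD Hh Hk /= -linearD; congr (f _).
by apply/eqP; rewrite xpair_eqE /= addr0 add0r !eqxx.
Qed.

Program Definition kmb_cone (X Y : kmb_obj R) (f : chain_map X Y) : kmb_obj R :=
  @KmbObj R (cone f) _.
Next Obligation.
move=> [X [pX [a Ha] [m [n HX]]]] [Y [pY [b Hb] [m' [n' HY]]]] /= f; split.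
- move=> i; have [fX prX] := pX (i + 1); have [fY prY] := pY i.
  by split; [exact: fg_prod|exact: projective_prod].
- exists (Num.max a b) => i; rewrite gt_max => /andP[ai bi] [x y].
  congr (_, _); last exact: Hb.
  by apply: Ha; apply: lt_trans ai _; rewrite ltrDl.
exists (Num.min (m - 1) m'), (Num.max n n') => i Hi [x y].
have HXi : cohomology_vanishes X (i + 1).
  apply: HX; case: Hi; first by rewrite lt_min ltrBrDr => /andP[? _]; left.
  rewrite gt_max => /andP[ni _]; right; apply: lt_trans ni _.
  by rewrite ltrDl.
have {Hi HX} HYi : cohomology_vanishes Y i.
  apply: HY; case: Hi; first by rewrite lt_min => /andP[_ ?]; left.
  by rewrite gt_max => /andP[_ ?]; right.
rewrite /= /cone_diff => -[/= /eqP]; rewrite oppr_eq0 => /eqP dx0 fxdy.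
have [x0 ex] := HXi _ dx0.
have [|y0 ey] := HYi (f (i + 1) x0 + y).
  by rewrite linearD -cmapC ex.
exists (- x0, y0); rewrite /cone_diff /= !linearN ex ey opprK.
by rewrite addKr.
Qed.

(* Morphisms of [K^(-,b)(proj R)] whose cone lies in [K^b(proj R)]. *)
Definition perfect_cone (X Y : Kmb) (f : mor X Y) : Prop := perfect (cone f).

Lemma quasi_iso_inverse X Y (f : chain_map X Y) (g : forall i, Y i -> X i) :
  (forall i x, g i (f i x) = x) -> (forall i y, f i (g i y) = y) -> quasi_iso f.
Proof.
move=> gf fg i; split=> [x _ [y Hy]|y dy0].
  by exists (g i y); apply: (can_inj (gf _)); rewrite cmapC fg.
exists (g (i + 1) y), 0; split; last by rewrite fg linear0 addr0.
by apply: (can_inj (gf _)); rewrite cmapC fg dy0 linear0.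
Qed.

Lemma quasi_iso_shift X Y (f : chain_map X Y) :
  quasi_iso f -> quasi_iso (shift_map f).
Proof.
move=> qf i; have [qi qs] := qf (i + 1); split=> [x /= dx0 [y Hy]|y /= dy0].
  have [||w ->] := qi x; first by move/eqP: dx0; rewrite oppr_eq0 => /eqP.
    by exists (- y); rewrite linearN.
  by exists (- w); rewrite linearN opprK.
have [|x [w [dx0 ->]]] := qs y.
  by move/eqP: dy0; rewrite oppr_eq0 => /eqP.
by exists x, (- w); rewrite dx0 oppr0 linearN opprK.
Qed.

Lemma quasi_isomorphic_shift X Y :
  quasi_isomorphic X Y -> quasi_isomorphic (shift X) (shift Y).
Proof.
elim=> {X Y} [X Y f qf|X Y _|X Y Z _ + _]; last exact: qis_trans.
- exact: qis_step (quasi_iso_shift qf).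
- exact: qis_sym.
Qed.

Lemma perfect_shift X : perfect X -> perfect (shift X).
Proof.
case=> B [[m [n bB]] pB qXB]; exists (shift B); split.
- exists (m - 1), n => i Hi; apply: bB; case: Hi.
    by rewrite ltrBrDr; left.
  by move=> ni; right; apply: lt_trans ni _; rewrite ltrDl.
- by move=> i; apply: pB.
- exact: quasi_isomorphic_shift.
Qed.

Definition oppl (M N : lmodType R) (u : (M * N)%type) : (M * N)%type :=
  (- u.1, u.2).

Fact oppl_linear (M N : lmodType R) : linear (@oppl M N).
Proof. by move=> a [x y] [x' y']; congr (_, _); rewrite /= opprD -scalerN. Qed.

HB.instance Definition _ (M N : lmodType R) :=
  GRing.isLinear.Build R (M * N)%type (M * N)%type *:%R (@oppl M N)
    (@oppl_linear M N).

Section ConeShift.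
Variables (X Y : complex R) (f : chain_map X Y).

Program Definition cone_shift_map :
    chain_map (cone (shift_map f)) (shift (cone f)) :=
  @ChainMap _ (cone (shift_map f)) (shift (cone f))
    (fun i => @oppl (X (i + 1 + 1)) (Y (i + 1))) _.
Next Obligation.
move=> i [x y]; rewrite /= /cone_diff /oppl /= !opprK (linearN (cdiff X _)).
by congr (_, _); rewrite /= ?opprK // (linearN (f (i + 1 + 1))) opprD opprK.
Qed.

Lemma quasi_isomorphic_cone_shift :
  quasi_isomorphic (cone (shift_map f)) (shift (cone f)).
Proof.
apply: (@qis_step _ _ _ cone_shift_map).
apply: (@quasi_iso_inverse (cone (shift_map f)) (shift (cone f)) cone_shift_map
    (fun i => @oppl (X (i + 1 + 1)) (Y (i + 1)))) => i [x y];
  by rewrite /= /oppl /= opprK.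
Qed.

End ConeShift.

Lemma perfect_cone_shift (X Y : Kmb) (f : mor X Y) :
  perfect_cone f -> perfect_cone (fhom Kmb_shift f).
Proof.
move=> /perfect_shift [B [bB pB qB]]; exists B; split => //.
by apply: qis_trans qB; apply: quasi_isomorphic_cone_shift.
Qed.

(* [D_sg(R)] is the Verdier quotient of [K^(-,b)(proj R)] by the perfect
   complexes. *)
Definition Dsg_cat : category := localization perfect_cone.

Definition Dsg_shift : functor Dsg_cat Dsg_cat :=
  loc_functor perfect_cone_shift.

Definition standard_triangle (X Y : kmb_obj R) (f : chain_map X Y) :
    triangle Dsg_shift :=
  @Triangle Dsg_cat Dsg_shift X Y (kmb_cone f)
    (@loc_mor Kmb perfect_cone X Y f)
    (@loc_mor Kmb perfect_cone Y (kmb_cone f) (cone_in f))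
    (@loc_mor Kmb perfect_cone (kmb_cone f) (kmb_shift X) (cone_out f)).

Definition Dsg : triangulated :=
  @Triangulated Dsg_cat Dsg_shift (fun t =>
    exists (X Y : kmb_obj R) (f : chain_map X Y),
      triangle_iso t (standard_triangle f)).

End Singularity.

(* The corner ring [eRe], whose unit is [e]; its ring structure depends on the
   proof [he], which is therefore a parameter of the type. *)
Record corner (R : pzRingType) (e : R) (he : e * e = e) := Corner {
  corner_val : R;
  corner_valP : e * corner_val * e == corner_val
}.

Record left_corner (R : pzRingType) (e : R) (he : e * e = e) := LeftCorner {
  left_corner_val : R;
  left_corner_valP : left_corner_val * e == left_corner_val
}.

(* Alias carrying the right [eRe]-module structure of [Re]; [left_corner]
   carries the left [R]-module structure. *)
Definition left_corner_right (R : pzRingType) (e : R) (he : e * e = e) :=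
  left_corner he.

Section Corner.
Variables (R : pzRingType) (e : R) (he : e * e = e).

HB.instance Definition _ := [isSub for @corner_val R e he].
HB.instance Definition _ := [Choice of corner he by <:].

Local Notation S := (corner he).

Fact corner_e (x : S) : (e * val x = val x) * (val x * e = val x).
Proof.
have /eqP ex : e * val x * e == val x := corner_valP x.
split; rewrite -ex.
  by rewrite !mulrA he.
by rewrite -[in LHS]mulrA he.
Qed.

Program Definition corner0 : S := @Corner R e he 0 _.
Next Obligation. by rewrite mulr0 mul0r. Qed.
Program Definition corner1 : S := @Corner R e he e _.
Next Obligation. by rewrite !he. Qed.
Program Definition corner_opp (x : S) : S := @Corner R e he (- val x) _.
Next Obligation. by move=> x; rewrite mulrN mulNr !corner_e. Qed.
Program Definition corner_add (x y : S) : S := @Corner R e he (val x + val y) _.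
Next Obligation. by move=> x y; rewrite mulrDr mulrDl !corner_e. Qed.
Program Definition corner_mul (x y : S) : S := @Corner R e he (val x * val y) _.
Next Obligation. by move=> x y; rewrite mulrA corner_e -mulrA corner_e. Qed.

Fact corner_addA : associative corner_add.
Proof. by move=> x y z; apply: val_inj; apply: addrA. Qed.
Fact corner_addC : commutative corner_add.
Proof. by move=> x y; apply: val_inj; apply: addrC. Qed.
Fact corner_add0 : left_id corner0 corner_add.
Proof. by move=> x; apply: val_inj; apply: add0r. Qed.
Fact corner_addN : left_inverse corner0 corner_opp corner_add.
Proof. by move=> x; apply: val_inj; apply: addNr. Qed.
HB.instance Definition _ := GRing.isZmodule.Build S
  corner_addA corner_addC corner_add0 corner_addN.

Fact corner_mulA : associative corner_mul.
Proof. by move=> x y z; apply: val_inj; apply: mulrA. Qed.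
Fact corner_mul1x : left_id corner1 corner_mul.
Proof. by move=> x; apply: val_inj; rewrite /= corner_e. Qed.
Fact corner_mulx1 : right_id corner1 corner_mul.
Proof. by move=> x; apply: val_inj; rewrite /= corner_e. Qed.
Fact corner_mulDl : left_distributive corner_mul corner_add.
Proof. by move=> x y z; apply: val_inj; apply: mulrDl. Qed.
Fact corner_mulDr : right_distributive corner_mul corner_add.
Proof. by move=> x y z; apply: val_inj; apply: mulrDr. Qed.
HB.instance Definition _ := GRing.Zmodule_isPzRing.Build S
  corner_mulA corner_mul1x corner_mulx1 corner_mulDl corner_mulDr.

HB.instance Definition _ := [isSub for @left_corner_val R e he].
HB.instance Definition _ := [Choice of left_corner he by <:].

Local Notation Re := (left_corner he).

Fact left_corner_e (x : Re) : val x * e = val x.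
Proof. exact/eqP/left_corner_valP. Qed.

Program Definition Re0 : Re := @LeftCorner R e he 0 _.
Next Obligation. by rewrite mul0r. Qed.
Program Definition Re_opp (x : Re) : Re := @LeftCorner R e he (- val x) _.
Next Obligation. by move=> x; rewrite mulNr left_corner_e. Qed.
Program Definition Re_add (x y : Re) : Re :=
  @LeftCorner R e he (val x + val y) _.
Next Obligation. by move=> x y; rewrite mulrDl !left_corner_e. Qed.
Program Definition Re_scale (a : R) (x : Re) : Re :=
  @LeftCorner R e he (a * val x) _.
Next Obligation. by move=> a x; rewrite -mulrA left_corner_e. Qed.
Program Definition Re_rscale (x : Re) (s : S) : Re :=
  @LeftCorner R e he (val x * val s) _.
Next Obligation. by move=> x s; rewrite -mulrA corner_e. Qed.

Fact Re_addA : associative Re_add.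
Proof. by move=> x y z; apply: val_inj; apply: addrA. Qed.
Fact Re_addC : commutative Re_add.
Proof. by move=> x y; apply: val_inj; apply: addrC. Qed.
Fact Re_add0 : left_id Re0 Re_add.
Proof. by move=> x; apply: val_inj; apply: add0r. Qed.
Fact Re_addN : left_inverse Re0 Re_opp Re_add.
Proof. by move=> x; apply: val_inj; apply: addNr. Qed.
HB.instance Definition _ := GRing.isZmodule.Build Re
  Re_addA Re_addC Re_add0 Re_addN.

Fact Re_scaleA a b (x : Re) : Re_scale a (Re_scale b x) = Re_scale (a * b) x.
Proof. by apply: val_inj; apply: mulrA. Qed.
Fact Re_scale1 : left_id 1 Re_scale.
Proof. by move=> x; apply: val_inj; apply: mul1r. Qed.
Fact Re_scaleDr : right_distributive Re_scale +%R.
Proof. by move=> a x y; apply: val_inj; apply: mulrDr. Qed.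
Fact Re_scaleDl (x : Re) : {morph Re_scale^~ x : a b / a + b}.
Proof. by move=> a b; apply: val_inj; apply: mulrDl. Qed.
HB.instance Definition _ := GRing.Zmodule_isLmodule.Build R Re
  Re_scaleA Re_scale1 Re_scaleDr Re_scaleDl.

HB.instance Definition _ := GRing.Zmodule.on (left_corner_right he).

Definition Re_cscale (s : S^c) (x : left_corner_right he) :
  left_corner_right he := Re_rscale x s.
Fact Re_cscaleA a b x : Re_cscale a (Re_cscale b x) = Re_cscale (a * b) x.
Proof. by apply: val_inj; rewrite /= -mulrA. Qed.
Fact Re_cscale1 : left_id 1 Re_cscale.
Proof. by move=> x; apply: val_inj; apply: left_corner_e. Qed.
Fact Re_cscaleDr : right_distributive Re_cscale +%R.
Proof. by move=> a x y; apply: val_inj; apply: mulrDl. Qed.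
Fact Re_cscaleDl x : {morph Re_cscale^~ x : a b / a + b}.
Proof. by move=> a b; apply: val_inj; apply: mulrDr. Qed.
HB.instance Definition _ := GRing.Zmodule_isLmodule.Build S^c
  (left_corner_right he) Re_cscaleA Re_cscale1 Re_cscaleDr Re_cscaleDl.

Definition in_add_Re (M : lmodType R) : Prop :=
  exists (n : nat) (M' : lmodType R)
         (phi : {linear (M * M')%type -> {ffun 'I_n -> Re}}), bijective phi.

(* The tensor product over [eRe] of [Re] and [N].  A sequence
   [[:: (a1, x1); ...; (an, xn)]] stands for the sum of the pure tensors of the
   [ai] and [xi]; no formal opposites are needed, since the opposite of the
   tensor of [a] and [x] is the tensor of [-a] and [x]. *)

Section Tensor.
Variable N : lmodType S.

Inductive tensor_rel : seq (Re * N) -> seq (Re * N) -> Prop :=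
| tr_refl s : tensor_rel s s
| tr_sym s t : tensor_rel s t -> tensor_rel t s
| tr_trans s t u : tensor_rel s t -> tensor_rel t u -> tensor_rel s u
| tr_cat s s' t t' :
    tensor_rel s s' -> tensor_rel t t' -> tensor_rel (s ++ t) (s' ++ t')
| tr_catC s t : tensor_rel (s ++ t) (t ++ s)
| tr_0 x : tensor_rel [:: (0, x)] [::]
| tr_Dl a b x : tensor_rel [:: (a + b, x)] [:: (a, x); (b, x)]
| tr_Dr a x y : tensor_rel [:: (a, x + y)] [:: (a, x); (a, y)]
| tr_balanced a s x :
    tensor_rel [:: (Re_rscale a s, x)] [:: (a, s *: x)].

Definition tensor_relb (s t : seq (Re * N)) : bool := `[< tensor_rel s t >].

Fact tensor_relb_refl : reflexive tensor_relb.
Proof. by move=> s; apply/asboolP; apply: tr_refl. Qed.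
Fact tensor_relb_sym : symmetric tensor_relb.
Proof. by move=> s t; apply/asboolP/asboolP; apply: tr_sym. Qed.
Fact tensor_relb_trans : transitive tensor_relb.
Proof.
by move=> t s u /asboolP st /asboolP tu; apply/asboolP; apply: tr_trans tu.
Qed.
Canonical tensor_equiv :=
  EquivRel tensor_relb tensor_relb_refl tensor_relb_sym tensor_relb_trans.

Definition tensor := {eq_quot tensor_equiv}.
HB.instance Definition _ := Choice.on tensor.
HB.instance Definition _ := EqQuotient.on tensor.

Lemma tensor_eq (s t : seq (Re * N)) :
  \pi_tensor s = \pi_tensor t <-> tensor_rel s t.
Proof. by split=> [/eqmodP/asboolP|st]; last apply/eqmodP/asboolP. Qed.

Lemma tensor_ind (P : tensor -> Prop) :
  (forall s, P (\pi_tensor s)) -> forall t, P t.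
Proof. by move=> H t; rewrite -[t]reprK. Qed.


Definition tensor_scale_seq (a : R) (s : seq (Re * N)) : seq (Re * N) :=
  [seq (a *: p.1, p.2) | p <- s].

Fact tensor_scale_rel a s t :
  tensor_rel s t -> tensor_rel (tensor_scale_seq a s) (tensor_scale_seq a t).
Proof.
elim=> {s t}.
- by move=> *; apply: tr_refl.
- by move=> s t _; apply: tr_sym.
- by move=> s t u _ st _; apply: tr_trans.
- by move=> s s' t t' _ ss' _ tt'; rewrite /tensor_scale_seq !map_cat;
    apply: tr_cat.
- by move=> s t; rewrite /tensor_scale_seq !map_cat; apply: tr_catC.
- by move=> x; rewrite /tensor_scale_seq /= scaler0; apply: tr_0.
- by move=> b c x; rewrite /tensor_scale_seq /= scalerDr; apply: tr_Dl.
- by move=> b x y; apply: tr_Dr.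
- move=> b c x; rewrite /tensor_scale_seq /=.
  suff -> : a *: Re_rscale b c = Re_rscale (a *: b) c by apply: tr_balanced.
  by apply: val_inj; apply: mulrA.
Qed.

Definition tensor0 : tensor := \pi_tensor [::].
Definition tensor_add (t u : tensor) : tensor := \pi_tensor (repr t ++ repr u).
Definition tensor_scale (a : R) (t : tensor) : tensor :=
  \pi_tensor (tensor_scale_seq a (repr t)).
Definition tensor_opp (t : tensor) : tensor := tensor_scale (-1) t.

Fact repr_tensor s : tensor_rel (repr (\pi_tensor s)) s.
Proof. by apply/tensor_eq; rewrite reprK. Qed.

Fact tensor_addE s t :
  tensor_add (\pi_tensor s) (\pi_tensor t) = \pi_tensor (s ++ t).
Proof. by apply/tensor_eq; apply: tr_cat; apply: repr_tensor. Qed.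

Fact tensor_scaleE a s :
  tensor_scale a (\pi_tensor s) = \pi_tensor (tensor_scale_seq a s).
Proof. by apply/tensor_eq; apply: tensor_scale_rel; apply: repr_tensor. Qed.

Fact tensor_addA : associative tensor_add.
Proof.
elim/tensor_ind=> s; elim/tensor_ind=> t; elim/tensor_ind=> u.
by rewrite !tensor_addE catA.
Qed.

Fact tensor_addC : commutative tensor_add.
Proof.
elim/tensor_ind=> s; elim/tensor_ind=> t.
by rewrite !tensor_addE; apply/tensor_eq; apply: tr_catC.
Qed.

Fact tensor_add0 : left_id tensor0 tensor_add.
Proof. by elim/tensor_ind=> s; rewrite tensor_addE. Qed.

Fact tensor_scaleDl t :
  {morph tensor_scale^~ t : a b / a + b >-> tensor_add a b}.
Proof.
move=> a b; elim/tensor_ind: t => s; rewrite !tensor_scaleE tensor_addE.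
apply/tensor_eq; elim: s => [|[c x] s IHs] /=; first exact: tr_refl.
rewrite /tensor_scale_seq /= scalerDl.
apply: tr_trans (tr_cat (tr_Dl _ _ _) IHs) _.
rewrite -[X in tensor_rel _ X]/([:: (a *: c, x)]
                                  ++ (_ ++ ([:: (b *: c, x)] ++ _))).
rewrite -[X in tensor_rel X _]/([:: (a *: c, x)]
                                  ++ ([:: (b *: c, x)] ++ (_ ++ _))).
apply: tr_cat (tr_refl _) _; rewrite !catA; apply: tr_cat (tr_refl _).
exact: tr_catC.
Qed.

Fact tensor_scale0 t : tensor_scale 0 t = tensor0.
Proof.
elim/tensor_ind: t => s; rewrite tensor_scaleE; apply/tensor_eq.
elim: s => [|[c x] s IHs] /=; first exact: tr_refl.
rewrite /tensor_scale_seq /= scale0r.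
exact: tr_trans (tr_cat (tr_0 _) IHs) (tr_refl _).
Qed.

Fact tensor_scale1 : left_id 1 tensor_scale.
Proof.
elim/tensor_ind=> s; rewrite tensor_scaleE; congr (\pi_tensor _).
by rewrite -[RHS]map_id; apply: eq_map => -[c x] /=; rewrite scale1r.
Qed.

Fact tensor_addN : left_inverse tensor0 tensor_opp tensor_add.
Proof.
move=> t; rewrite -{2}[t]tensor_scale1 -tensor_scaleDl addNr.
exact: tensor_scale0.
Qed.

HB.instance Definition _ := GRing.isZmodule.Build tensor
  tensor_addA tensor_addC tensor_add0 tensor_addN.

Fact tensor_scaleA a b t :
  tensor_scale a (tensor_scale b t) = tensor_scale (a * b) t.
Proof.
elim/tensor_ind: t => s; rewrite !tensor_scaleE; congr (\pi_tensor _).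
rewrite /tensor_scale_seq -map_comp.
by apply: eq_map => -[c x] /=; rewrite scalerA.
Qed.

Fact tensor_scaleDr : right_distributive tensor_scale +%R.
Proof.
move=> a; elim/tensor_ind=> s; elim/tensor_ind=> t.
rewrite [\pi_tensor s + _]tensor_addE !tensor_scaleE [RHS]tensor_addE.
by rewrite /tensor_scale_seq map_cat.
Qed.

HB.instance Definition _ := GRing.Zmodule_isLmodule.Build R tensor
  tensor_scaleA tensor_scale1 tensor_scaleDr tensor_scaleDl.

End Tensor.

Section TensorMap.
Variables (M N : lmodType S) (f : {linear M -> N}).

Definition tensor_map_seq (s : seq (Re * M)) : seq (Re * N) :=
  [seq (p.1, f p.2) | p <- s].

Fact tensor_map_rel s t :
  tensor_rel s t -> tensor_rel (tensor_map_seq s) (tensor_map_seq t).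
Proof.
elim=> {s t}.
- by move=> *; apply: tr_refl.
- by move=> s t _; apply: tr_sym.
- by move=> s t u _ st _; apply: tr_trans.
- by move=> s s' t t' _ ss' _ tt'; rewrite /tensor_map_seq !map_cat;
    apply: tr_cat.
- by move=> s t; rewrite /tensor_map_seq !map_cat; apply: tr_catC.
- by move=> x; apply: tr_0.
- by move=> b c x; apply: tr_Dl.
- by move=> b x y; rewrite /tensor_map_seq /= linearD; apply: tr_Dr.
- by move=> b c x; rewrite /tensor_map_seq /= linearZ; apply: tr_balanced.
Qed.

Definition tensor_map (t : tensor M) : tensor N :=
  \pi_(tensor N) (tensor_map_seq (repr t)).

Fact tensor_mapE s :
  tensor_map (\pi_(tensor M) s) = \pi_(tensor N) (tensor_map_seq s).
Proof. by apply/tensor_eq; apply: tensor_map_rel; apply: repr_tensor. Qed.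

Fact tensor_map_linear : linear tensor_map.
Proof.
move=> a; elim/tensor_ind=> s; elim/tensor_ind=> t.
rewrite [a *: _]tensor_scaleE [X in tensor_map X]tensor_addE !tensor_mapE.
rewrite [a *: _]tensor_scaleE [RHS]tensor_addE.
by rewrite /tensor_map_seq /tensor_scale_seq map_cat -!map_comp.
Qed.

HB.instance Definition _ :=
  GRing.isLinear.Build R (tensor M) (tensor N) *:%R tensor_map tensor_map_linear.

End TensorMap.

Lemma tensor_map_ext (M N : lmodType S) (f g : {linear M -> N}) :
  (forall x, f x = g x) -> forall t, tensor_map f t = tensor_map g t.
Proof.
move=> fg; elim/tensor_ind=> s; rewrite !tensor_mapE; congr (\pi_(tensor N) _).
by apply: eq_map => -[c x] /=; rewrite fg.
Qed.

Lemma tensor_map_id (M : lmodType S) (f : {linear M -> M}) :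
  (forall x, f x = x) -> forall t, tensor_map f t = t.
Proof.
move=> f1; elim/tensor_ind=> s; rewrite tensor_mapE; congr (\pi_(tensor M) _).
by rewrite -[RHS]map_id; apply: eq_map => -[c x] /=; rewrite f1.
Qed.

Lemma tensor_map_comp (M N P : lmodType S) (g : {linear N -> P})
    (f : {linear M -> N}) (h : {linear M -> P}) :
  (forall x, g (f x) = h x) ->
  forall t, tensor_map g (tensor_map f t) = tensor_map h t.
Proof.
move=> gf; elim/tensor_ind=> s; rewrite !tensor_mapE; congr (\pi_(tensor P) _).
by rewrite /tensor_map_seq -map_comp; apply: eq_map => -[c x] /=; rewrite gf.
Qed.

Lemma tensor_map_add (M N : lmodType S) (f g h : {linear M -> N}) :
  (forall x, f x + g x = h x) ->
  forall t, tensor_map f t + tensor_map g t = tensor_map h t.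
Proof.
move=> fg; elim/tensor_ind=> s; rewrite !tensor_mapE [LHS]tensor_addE.
apply/tensor_eq; elim: s => [|[c x] s IHs] /=; first exact: tr_refl.
rewrite -fg; apply: tr_sym.
apply: tr_trans (tr_cat (tr_Dr _ _ _) (tr_sym IHs)) _.
set F := tensor_map_seq f s; set G := tensor_map_seq g s.
have -> : (c, f x) :: F ++ (c, g x) :: G
    = [:: (c, f x)] ++ (F ++ [:: (c, g x)]) ++ G by rewrite -catA.
apply: (@tr_cat _ [:: (c, f x)] _ (([:: (c, g x)] ++ F) ++ G)).
  exact: tr_refl.
by apply: tr_cat (tr_refl _); apply: tr_catC.
Qed.

Lemma tensor_map_zero (M N : lmodType S) (f : {linear M -> N}) :
  (forall x, f x = 0) -> forall t, tensor_map f t = 0.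
Proof.
move=> f0 t; apply: (addrI (tensor_map f t)); rewrite addr0.
by apply: tensor_map_add => x; rewrite f0 addr0.
Qed.

Lemma tensor_map_opp (M N : lmodType S) (f g : {linear M -> N}) :
  (forall x, f x = - g x) -> forall t, tensor_map f t = - tensor_map g t.
Proof.
move=> fg t; apply/eqP; rewrite -addr_eq0; apply/eqP.
have H : forall x, f x + g x = (\0 : {linear M -> N}) x.
  by move=> x; rewrite fg addNr.
by rewrite (tensor_map_add H) tensor_map_zero.
Qed.

Program Definition ilam (X : complex S) : complex R :=
  @Complex R (fun i => tensor (X i)) (fun i => tensor_map (cdiff X i)) _.
Next Obligation.
move=> X i x /=.
rewrite (@tensor_map_comp _ _ _ _ _ (\0 : {linear X i -> X (i + 1 + 1)})).
  exact: tensor_map_zero.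
by move=> y; rewrite cdiffK.
Qed.

Program Definition ilam_map (X Y : complex S) (f : chain_map X Y) :
    chain_map (ilam X) (ilam Y) :=
  @ChainMap R (ilam X) (ilam Y) (fun i => tensor_map (f i)) _.
Next Obligation.
move=> X Y f i x /=.
rewrite (@tensor_map_comp _ _ _ _ _ (f (i + 1) \o cdiff X i)) //.
by rewrite (@tensor_map_comp _ _ _ _ _ (f (i + 1) \o cdiff X i)) // => y /=;
  rewrite cmapC.
Qed.

Section InducedFunctor.
(* [i_lambda] preserves neither [K^(-,b)(proj _)] nor perfect complexes
   without assumptions on [Re]; the induced functor depends on proofs that it
   does. *)
Hypothesis ilamK : forall X, in_Kmb X -> in_Kmb (ilam X).
Hypothesis ilamP : forall X, in_Kmb X -> perfect X -> perfect (ilam X).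

Definition kmb_ilam (X : kmb_obj S) : kmb_obj R :=
  @KmbObj R (ilam X) (ilamK (kmb_in X)).

Program Definition Kmb_ilam : functor (Kmb S) (Kmb R) :=
  @Functor (Kmb S) (Kmb R) kmb_ilam (fun X Y f => ilam_map f) _ _ _.
Next Obligation.
move=> X Y f g [s Hs].
exists (fun i => tensor_map (s i) : {linear tensor (X (i + 1)) -> tensor (Y i)}).
move=> i x /=.
rewrite (@tensor_map_comp _ _ _ _ _ (cdiff Y i \o s i)) //.
rewrite (@tensor_map_comp _ _ _ _ _ (s (i + 1) \o cdiff X (i + 1))) //.
rewrite (@tensor_map_add _ _ _ _ (f (i + 1) \- g (i + 1))) => [|y].
  apply/eqP; rewrite subr_eq; apply/eqP; apply/esym.
  by apply: tensor_map_add => y /=; rewrite subrK.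
by rewrite /= Hs.
Qed.
Next Obligation.
by move=> X; apply: homotopic_ext => i x /=; apply: tensor_map_id.
Qed.
Next Obligation.
move=> X Y Z g f; apply: homotopic_ext => i x /=.
by apply/esym; apply: tensor_map_comp.
Qed.

Section ConeIlam.
Variables (X Y : complex S) (f : chain_map X Y).

Program Definition cone_ilam_map :
    chain_map (ilam (cone f)) (cone (ilam_map f)) :=
  @ChainMap R (ilam (cone f)) (cone (ilam_map f))
    (fun i => pair_map (tensor_map (@fst (X (i + 1)) (Y i)))
                       (tensor_map (@snd (X (i + 1)) (Y i)))) _.
Next Obligation.
move=> i t; rewrite /= /pair_map /cone_diff /=; congr (_, _).
  rewrite (@tensor_map_comp _ _ _ _ _
    (\- (cdiff X (i + 1) \o @fst (X (i + 1)) (Y i)))) //.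
  rewrite (@tensor_map_comp _ _ _ _ _
    (cdiff X (i + 1) \o @fst (X (i + 1)) (Y i))) //.
  exact: tensor_map_opp.
rewrite (@tensor_map_comp _ _ _ _ _
  ((f (i + 1) \o @fst (X (i + 1)) (Y i))
     \+ (cdiff Y i \o @snd (X (i + 1)) (Y i)))) //.
rewrite (@tensor_map_comp _ _ _ _ _ (f (i + 1) \o @fst (X (i + 1)) (Y i))) //.
rewrite (@tensor_map_comp _ _ _ _ _ (cdiff Y i \o @snd (X (i + 1)) (Y i))) //.
by apply/esym; apply: tensor_map_add.
Qed.

Lemma quasi_isomorphic_cone_ilam :
  quasi_isomorphic (ilam (cone f)) (cone (ilam_map f)).
Proof.
apply: (@qis_step _ _ _ cone_ilam_map).
apply: (@quasi_iso_inverse R (ilam (cone f)) (cone (ilam_map f)) cone_ilam_map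
  (fun i u =>
  tensor_map (@pair0l _ (X (i + 1)) (Y i)) u.1
  + tensor_map (@pair0r _ (X (i + 1)) (Y i)) u.2)) => [i t|i [t u]] /=.
- rewrite (@tensor_map_comp _ _ _ _ _ (@pair0l _ (X (i + 1)) (Y i) \o fst)) //.
  rewrite (@tensor_map_comp _ _ _ _ _ (@pair0r _ (X (i + 1)) (Y i) \o snd)) //.
  rewrite (@tensor_map_add _ _ _ _ idfun) ?tensor_map_id // => -[x y] /=.
  by congr (_, _); rewrite /= ?addr0 ?add0r.
- rewrite /pair_map !linearD; congr (_, _).
    transitivity (tensor_map (idfun : {linear X (i + 1) -> X (i + 1)}) t
                  + tensor_map (\0 : {linear Y i -> X (i + 1)}) u).
      by congr (_ + _); apply: tensor_map_comp.
    by rewrite tensor_map_id // tensor_map_zero // addr0.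
  transitivity (tensor_map (\0 : {linear X (i + 1) -> Y i}) t
                + tensor_map (idfun : {linear Y i -> Y i}) u).
    by congr (_ + _); apply: tensor_map_comp.
  by rewrite tensor_map_id // tensor_map_zero // add0r.
Qed.

End ConeIlam.

Lemma perfect_cone_ilam (X Y : Kmb S) (f : mor X Y) :
  perfect_cone f -> perfect_cone (fhom Kmb_ilam f).
Proof.
move=> pf; have [B [bB pB qB]] := ilamP (kmb_in (kmb_cone f)) pf.
exists B; split=> //; apply: qis_trans qB; apply: qis_sym.
exact: quasi_isomorphic_cone_ilam.
Qed.

Definition Dsg_ilam : functor (Dsg S) (Dsg R) := loc_functor perfect_cone_ilam.

(* The comparison of [i_lambda (X[1])] with [(i_lambda X)[1]]: the identity in
   each degree. *)
Program Definition ilam_shift (X : complex S) :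
    chain_map (ilam (shift X)) (shift (ilam X)) :=
  @ChainMap R (ilam (shift X)) (shift (ilam X)) (fun i => idfun) _.
Next Obligation. by move=> X i t /=; apply: tensor_map_opp. Qed.

Definition Dsg_ilam_shift (X : Dsg S) :
    mor (Dsg_ilam (susp (Dsg S) X)) (susp (Dsg R) (Dsg_ilam X)) :=
  @loc_mor (Kmb R) (@perfect_cone R) (kmb_ilam (kmb_shift X))
    (kmb_shift (kmb_ilam X)) (ilam_shift X).

End InducedFunctor.
End Corner.

(* Main.v *)
(* Working modulo perfect complexes only sees a complex far to the left: for
   [X] in [K^(-,b)(proj R)], perfection means that [X] is contractible in all
   sufficiently small degrees, and [D_sg(R)] is equivalent, by the identity on
   objects, to the category of germs at [-oo] of chain maps modulo germs of
   homotopies.  A germ [X -> Y] that commutes with the differentials below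
   degree [n] gives a chain map from [X] to the truncation of [Y] in degrees
   [<= n], and [Y] is isomorphic to this truncation in [D_sg(R)].

   On germs, full faithfulness of [i_lambda] is that of [Re (x) -] on modules,
   which follows from [e(Re (x) N) = N].  For density, a complex [Z] is, far to
   the left, a resolution of one of its modules of coboundaries, hence
   homotopy equivalent there to a resolution [P] with terms in [add Re]; and
   [P = Re (x) eP] in these degrees.

   The finite projective dimension of [Re] is only needed for [i_lambda] to
   preserve bounded cohomology.  This follows by dimension shifting along a
   projective resolution of [Re], where elements of [M (x) X^i] are encoded as
   row vectors over [M] fixed by an idempotent matrix over [eRe]. *)

Require Import Defs.
From HB Require Import structures.
From mathcomp Require Import all_boot all_order all_algebra.
From mathcomp Require Import boolp functions zify.

Set Implicit Arguments.
Unset Strict Implicit.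
Unset Printing Implicit Defensive.

Import Order.TTheory GRing.Theory Num.Theory.
Local Open Scope ring_scope.
Local Open Scope quotient_scope.

#[local] Obligation Tactic := idtac.

(** * Modules *)

(** Morphisms of [localization] are formal words in morphisms and formal inverses, with no calculus
    of fractions at hand, so equality of two words cannot be tested directly. The substitute is
    [trunc_loc_hom]: followed by a truncation of its target sufficiently far to the left, any word
    equals the single chain map read off from its germ. Hence germs detect equality in [Dsg], and
    isomorphisms, faithfulness and density are all settled on families of linear maps in low
    degrees. The row vectors over a right module replace a second tensor product: [tensor] is built
    for [Re] only, whereas the dimension shift runs through the terms of a resolution of [Re], which
    are mere right modules and may be infinitely generated. *)

Lemma subr_from_expansion (V : zmodType) (a b c x : V) :
  x = - a - b + c -> c - x = a + b.
Proof. by move=> ->; rewrite -opprD opprD opprK addrC subrK. Qed.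

Lemma subr_from_sum (V : zmodType) (a b c x : V) :
  x = a + b + c -> a - x = - b - c.
Proof. by move=> ->; rewrite !opprD addrA addrA subrr add0r. Qed.

Lemma subr_moveL (V : zmodType) (a b c : V) : a - b = c -> a = b + c.
Proof. by move=> <-; rewrite addrC subrK. Qed.

Definition submodule (R : pzRingType) (V : lmodType R) (U : V -> Prop) :=
  U 0 /\ forall a x y, U x -> U y -> U (a *: x + y).

(** Membership is stored as the boolean [[< U x >]], which makes [val] injective and gives access to
    the subtype structures. *)
Record submod (R : pzRingType) (V : lmodType R) (U : V -> Prop)
    (hU : submodule U) := Submod {
  submod_val : V;
  submod_valP : `[< U submod_val >]
}.

Section Submod.
Variables (R : pzRingType) (V : lmodType R) (U : V -> Prop).
Hypothesis hU : submodule U.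

HB.instance Definition _ := [isSub for @submod_val R V U hU].
HB.instance Definition _ := [Choice of submod hU by <:].

Fact submod_closedP : GRing.submod_closed [pred x | `[< U x >]].
Proof.
case: hU => U0 UD; split=> [|a x y]; rewrite !inE; first exact/asboolP.
by move=> /asboolP Ux /asboolP Uy; apply/asboolP; apply: UD.
Qed.

HB.instance Definition _ :=
  GRing.SubChoice_isSubLmodule.Build R V _ (submod hU) submod_closedP.

Lemma submodP (x : submod hU) : U (val x).
Proof. exact/asboolP/submod_valP. Qed.

Definition to_submod (x : V) (Ux : U x) : submod hU :=
  @Submod R V U hU x (asboolT Ux).

Definition corestrict (M : lmodType R) (f : {linear M -> V})
  (Hf : forall x, U (f x)) (x : M) : submod hU := to_submod (Hf x).

Fact corestrict_linear (M : lmodType R) (f : {linear M -> V}) Hf :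
  linear (@corestrict M f Hf).
Proof. by move=> a x y; apply: val_inj; rewrite /= linearP. Qed.

HB.instance Definition _ (M : lmodType R) (f : {linear M -> V}) Hf :=
  GRing.isLinear.Build R M (submod hU) *:%R (@corestrict M f Hf)
    (@corestrict_linear M f Hf).

End Submod.

Section ModuleLemmas.
Variable R : pzRingType.

Definition val_lin (V : lmodType R) (U : V -> Prop) (hU : submodule U) :
  {linear submod hU -> V} := (val : submod hU -> V).

Definition mk_linear (M N : lmodType R) (f : M -> N) (fl : linear f) :
    {linear M -> N} :=
  HB.pack_for {linear M -> N} f (GRing.isLinear.Build R M N *:%R f fl).

(** The fibre product of [f] and [g] maps onto [P], hence has a section, whose second component is
    [h]. Surjectivity of [g] is weakened to containment of images, the form in which exactness of a
    complex provides lifts. *)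
Lemma proj_lift (P A B : lmodType R) (g : {linear A -> B})
    (f : {linear P -> B}) :
  projective P -> (forall x, exists y, g y = f x) ->
  exists h : {linear P -> A}, forall x, g (h x) = f x.
Proof.
move=> pP gf.
have hU : @submodule R (P * A)%type (fun u => f u.1 = g u.2).
  split=> [|a x y /= ex ey]; first by rewrite /= !linear0.
  by rewrite !linearP ex ey.
have [|h Hh] := pP (submod hU) P (fst \o val_lin hU) idfun.
  move=> x; have [y e] := gf x.
  by exists (@to_submod R (P * A)%type _ hU (x, y) (esym e)).
exists (snd \o (val_lin hU \o h)) => x /=.
by rewrite -(submodP (h x)); have /= -> := Hh x.
Qed.

Lemma bijective_linear_inverse (M N : lmodType R) (f : {linear M -> N}) :
  bijective f -> exists g : {linear N -> M}, cancel f g /\ cancel g f.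
Proof.
case=> g fg gf.
have gl : linear g by move=> a x y; apply: (can_inj fg); rewrite linearP !gf.
by exists (mk_linear gl).
Qed.

(** Finitely generated projective modules are handled through such coordinates, because these can be
    tensored and can be written as matrices. *)
Definition dual_basis (M : lmodType R) n (v : 'I_n -> M)
    (c : 'I_n -> {linear M -> R^o}) : Prop :=
  forall x, x = \sum_i (c i x : R) *: v i.

Lemma row_sum_linear (M : lmodType R) n (v : 'I_n -> M) :
  linear (fun u : 'rV[R]_n => \sum_i u 0 i *: v i).
Proof.
move=> a u w; rewrite scaler_sumr -big_split /=; apply: eq_bigr => i _.
by rewrite !mxE scalerDl scalerA.
Qed.

Definition row_sum (M : lmodType R) n (v : 'I_n -> M) :
    {linear 'rV[R]_n -> M} :=
  mk_linear (row_sum_linear v).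

Lemma coord_linear n (i : 'I_n) :
  linear (fun u : 'rV[R]_n => (u 0 i : R^o)).
Proof. by move=> a u w; rewrite !mxE. Qed.

Definition coord_row n (i : 'I_n) : {linear 'rV[R]_n -> R^o} :=
  mk_linear (@coord_linear n i).

Lemma dual_basis_exists (M : lmodType R) :
  finitely_generated M -> projective M ->
  exists n (v : 'I_n -> M) c, @dual_basis M n v c.
Proof.
move=> [n [v Hv]] pM.
have [|h Hh] := @proj_lift M _ _ (row_sum v) idfun pM.
  move=> x; have [c ->] := Hv x; exists (\row_i c i) => /=.
  by apply: eq_bigr => i _; rewrite mxE.
exists n, v, (fun i => coord_row i \o h) => x.
by rewrite -[LHS]Hh.
Qed.

Lemma dual_basis_fg (M : lmodType R) n (v : 'I_n -> M) c :
  dual_basis v c -> finitely_generated M.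
Proof. by move=> H; exists n, v => x; exists (fun i => c i x). Qed.

Lemma dual_basis_projective (M : lmodType R) n (v : 'I_n -> M) c :
  dual_basis v c -> projective M.
Proof.
move=> H A B g f gs.
have /choice [w Hw] : forall i, exists y, g y = f (v i) by move=> i; apply: gs.
have hl : linear (fun x => \sum_i (c i x : R) *: w i).
  move=> a x y; rewrite scaler_sumr -big_split /=; apply: eq_bigr => i _.
  by rewrite linearP /= scalerDl scalerA.
exists (mk_linear hl).
move=> x /=; rewrite linear_sum [in RHS](H x) linear_sum.
by apply: eq_bigr => i _; rewrite !linearZ /= Hw.
Qed.

Lemma retract_fg (M N : lmodType R) (f : {linear M -> N})
    (g : {linear N -> M}) :
  cancel g f -> finitely_generated M -> finitely_generated N.
Proof.
move=> gf [n [v Hv]]; exists n, (fun i => f (v i)) => x.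
have [c Hc] := Hv (g x); exists c; rewrite -[LHS]gf Hc linear_sum.
by apply: eq_bigr => i _; rewrite linearZ.
Qed.

Lemma retract_projective (M N : lmodType R) (f : {linear M -> N})
    (g : {linear N -> M}) :
  cancel g f -> projective M -> projective N.
Proof.
move=> gf pM A B k h ks; have [l Hl] := pM A B k (h \o f) ks.
by exists (l \o g) => x /=; rewrite Hl /= gf.
Qed.

Lemma zero_fg (M : lmodType R) : zero_module M -> finitely_generated M.
Proof.
move=> M0; exists 0%N, (fun _ => 0) => x; exists (fun _ => 0).
by rewrite big_ord0; apply: M0.
Qed.

Lemma zero_projective (M : lmodType R) : zero_module M -> projective M.
Proof.
move=> M0 A B g f _; exists (\0 : {linear M -> A}) => x.
by rewrite /= linear0 [x]M0 linear0.
Qed.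

Definition fixed (V : lmodType R) (p : {linear V -> V}) (x : V) : Prop :=
  p x = x.

Lemma fixed_submodule (V : lmodType R) (p : {linear V -> V}) :
  submodule (fixed p).
Proof.
split=> [|a x y px py]; first exact: linear0.
by rewrite /fixed linearP px py.
Qed.

(** For idempotent [p] this is the image of [p], a direct summand of [V]. *)
Definition fix_mod (V : lmodType R) (p : {linear V -> V}) : lmodType R :=
  submod (fixed_submodule p).

Lemma fix_modP (V : lmodType R) (p : {linear V -> V}) (x : fix_mod p) :
  p (val x) = val x.
Proof. exact: (submodP x). Qed.

Definition idempotent_map (V : lmodType R) (p : {linear V -> V}) : Prop :=
  forall x, p (p x) = p x.

End ModuleLemmas.

(** * Recursion down the integers *)

Section Down.
Variables (T : int -> Type) (s0 : forall i, T i).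
Variables (Rel : forall i, T i -> T (i + 1) -> Prop).
Variables (Inv : forall i, T i -> Prop) (N : int).
Hypothesis Inv0 : Inv (s0 N).
Hypothesis step : forall (i : int) (b : T (i + 1)), i < N -> Inv b ->
  exists a : T i, Rel a b /\ Inv a.

(* The [k]-th approximation is correct in degrees at least [N - k].  Since the
   recursion is on [k], uniformly in the degree, no transport is needed. *)
Lemma down_rec : exists s : forall i, T i,
  s N = s0 N /\ forall i, i < N -> Rel (s i) (s (i + 1)).
Proof.
(* The default [s0 i] makes the step total, so that choice yields one function on all pairs of a
   degree and a value above it. *)
have ex_next : forall ib : {i : int & T (i + 1)}, exists a : T (tag ib),
      tag ib < N -> Inv (tagged ib) -> Rel a (tagged ib) /\ Inv a.
  move=> [i b] /=.
  have [[iN bI]|nH] := pselect (i < N /\ Inv b).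
    by have [a Ha] := step iN bI; exists a.
  by exists (s0 i) => iN bI; case: nH.
pose next ib := sval (cid (ex_next ib)).
have Hnext ib : tag ib < N -> Inv (tagged ib) ->
  Rel (next ib) (tagged ib) /\ Inv (next ib) := svalP (cid (ex_next ib)).
pose fix U (k : nat) : forall i, T i :=
  if k is k'.+1 then fun i =>
    if i < N then next (Tagged (fun i => T (i + 1)) (U k' (i + 1))) else s0 i
  else s0.
have UN k (i : int) : N <= i -> U k i = s0 i.
  by case: k => //= k Ni; rewrite ltNge Ni.
have stab k l (i : int) : (N - i <= k%:Z) -> (N - i <= l%:Z) -> U k i = U l i.
  elim: k l i => [|k IHk] [|l] i Hk Hl; rewrite //.
  - by rewrite !UN //; lia.
  - by rewrite !UN //; lia.
  - by rewrite /=; case: ifP => // iN; rewrite (IHk l) //; lia.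
pose s i := U (absz (N - i)%R) i.
have sE (i : int) : i < N -> s i = next (Tagged (fun i => T (i + 1)) (s (i +
  1))).
  move=> iN; rewrite /s (stab _ (absz (N - (i + 1))%R).+1) ?[LHS]/=; try lia.
  by rewrite iN.
have Invs k (i : int) : i <= N -> N - i <= k%:Z -> Inv (s i).
  elim: k i => [|k IHk] i iN Hk.
    have -> : i = N by lia.
    by rewrite /s UN.
  have [->|iN'] := eqVneq i N; first by rewrite /s UN.
  have lt_iN : i < N by lia.
  rewrite sE //; have [||_ //] := Hnext (Tagged (fun i => T (i + 1)) (s (i +
    1))).
    exact: lt_iN.
  by apply: IHk => /=; lia.
exists s; split=> [|i iN]; first by rewrite /s UN.
rewrite (sE i iN).
have [||//] := Hnext (Tagged (fun i => T (i + 1)) (s (i + 1))).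
  exact: iN.
by apply: (Invs (absz (N - (i + 1))%R)) => /=; lia.
Qed.

End Down.

(** A homotopy into a cone yields maps in degrees of the form [i + 1] only; this turns them into a
    family over all degrees, and is the place where the transport is paid for. *)
Lemma int_reindex (T : int -> Type) (h : forall i, T (i + 1)) :
  exists g : forall i, T i, forall i, g (i + 1) = h i.
Proof.
exists (fun i => ecast j (T j) (subrK 1 i) (h (i - 1))) => i.
have e := addrK 1 i.
move: (subrK 1 (i + 1)); rewrite e => e'.
by rewrite (eq_irrelevance e' erefl).
Qed.

Lemma int_succ (P : int -> Prop) : (forall i, P (i + 1)) -> forall i, P i.
Proof. by move=> H i; rewrite -[i](subrK 1). Qed.

(** * Homotopies and perfect complexes *)

Section Homotopies.
Variable R : pzRingType.
Implicit Types X Y Z : complex R.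

(** Comparison theorem for chain maps. The invariant is that the last component sends cocycles to
    cocycles: composed with the differential of [X] it then lands in cocycles of [Y], which are
    coboundaries. The hypothesis on [Y] at [i < N] is exactness in degrees at most [N]. *)
Lemma extend_down X Y (N : int) (f : {linear X N -> Y N}) :
    (forall i, i < N -> projective (X i)) ->
    (forall i, i < N -> cohomology_vanishes Y i) ->
    (forall x, cdiff X N x = 0 -> cdiff Y N (f x) = 0) ->
  exists phi : forall i, {linear X i -> Y i}, phi N = f /\
    forall i x, i < N -> phi (i + 1) (cdiff X i x) = cdiff Y i (phi i x).
Proof.
move=> pX Y0 Hf.
pose s0 i : {linear X i -> Y i} :=
  if i =P N is ReflectT e then ecast j ({linear X j -> Y j}) (esym e) f
  else \0.
have s0N : s0 N = f.
  by rewrite /s0; case: eqP => // e; rewrite (eq_irrelevance e erefl).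
have [||phi [phiN Hphi]] := @down_rec (fun i => {linear X i -> Y i}) s0
   (fun i a b => forall x, b (cdiff X i x) = cdiff Y i (a x))
   (fun i a => forall x, cdiff X i x = 0 -> cdiff Y i (a x) = 0) N.
- by rewrite s0N.
- move=> i b iN Hb.
  have [||a Ha] := @proj_lift R _ _ _ (cdiff Y i) (b \o cdiff X i).
  + exact: pX.
  + by move=> x; apply: Y0 iN _ _; apply: Hb; apply: cdiffK.
  by exists a; split=> x; [rewrite Ha|rewrite Ha /= => ->; rewrite linear0].
by exists phi; split=> [|i x iN]; [rewrite phiN s0N|apply: Hphi].
Qed.

(** Comparison theorem for homotopies. The recursion may start from the zero map because [chi N]
    takes values in cocycles; the invariant is that [chi i - s i d] takes values in cocycles. *)
Lemma homotopy_down X Y (N : int) (chi : forall i, {linear X i -> Y i}) :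
    (forall i, i <= N -> projective (X i)) ->
    (forall i, i < N -> cohomology_vanishes Y i) ->
    (forall i x, i < N -> chi (i + 1) (cdiff X i x) = cdiff Y i (chi i x)) ->
    (forall x, cdiff Y N (chi N x) = 0) ->
  exists s : forall i, {linear X (i + 1) -> Y i}, forall i x, i < N ->
    chi (i + 1) x = cdiff Y i (s i x) + s (i + 1) (cdiff X (i + 1) x).
Proof.
move=> pX Y0 chiC chiN.
have [||s [_ Hs]] := @down_rec (fun i => {linear X (i + 1) -> Y i}) (fun i =>
  \0)
   (fun i a b => forall x,
      chi (i + 1) x = cdiff Y i (a x) + b (cdiff X (i + 1) x))
   (fun i a => forall x : X i, cdiff Y i (chi i x - a (cdiff X i x)) = 0) N.
- by move=> x; rewrite /= subr0 chiN.
- move=> i b iN Hb.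
  have [||a Ha] := @proj_lift R _ _ _ (cdiff Y i)
      (chi (i + 1) \- (b \o cdiff X (i + 1))).
  + by apply: pX; lia.
  + by move=> x; apply: Y0 iN _ _; apply: Hb.
  exists a; split=> x; first by rewrite Ha /= subrK.
  by rewrite linearB Ha /= cdiffK linear0 subr0 chiC // subrr.
by exists s => i x iN; apply: Hs.
Qed.

Definition acyclic X := forall i, cohomology_vanishes X i.

Lemma null_homotopic X Y (g : chain_map X Y) :
    (forall i, projective (X i)) -> bounded_above X -> acyclic Y ->
  exists s : forall i, {linear X (i + 1) -> Y i}, forall i x,
    g (i + 1) x = cdiff Y i (s i x) + s (i + 1) (cdiff X (i + 1) x).
Proof.
move=> pX [N X0] Y0.
have [||||s Hs] := @homotopy_down X Y (N + 1) g.
- by move=> i _; apply: pX.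
- by move=> i _; apply: Y0.
- by move=> i x _; apply: cmapC.
- by move=> x; rewrite [x]X0 ?linear0 //; lia.
exists s => i x; have [iN|Ni] := ltP i (N + 1); first exact: Hs.
by rewrite [x]X0 ?linear0 ?addr0 //; lia.
Qed.

Lemma quasi_iso_cone_acyclic X Y (f : chain_map X Y) :
  quasi_iso f -> acyclic (cone f).
Proof.
move=> qf i [x y]; rewrite /= /cone_diff /= => -[/eqP].
rewrite oppr_eq0 => /eqP dx0 fxdy.
have [|w ew] := (qf (i + 1)).1 x dx0.
  by exists (- y); rewrite linearN; apply/eqP; rewrite -addr_eq0 fxdy.
have [|x' [z [dx' ez]]] := (qf i).2 (f (i + 1) w + y).
  by rewrite linearD -cmapC -ew fxdy.
exists (x' - w, z); rewrite /cone_diff /= (linearB (cdiff X _)) dx' sub0r opprK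
  -ew (linearB (f _)).
by congr (_, _); rewrite addrAC -ez addrAC subrr add0r.
Qed.

(** The composite of [g] with the inclusion of [Z] into the acyclic cone of [f] is null homotopic.
    The [Y]-component of the null homotopy is the lift, and its [Z]-component is, up to sign, the
    homotopy. *)
Lemma lift_quasi_iso X Y Z (f : chain_map Y Z) (g : chain_map X Z) :
    (forall i, projective (X i)) -> bounded_above X -> quasi_iso f ->
  exists h : chain_map X Y, homotopic (chain_comp f h) g.
Proof.
move=> pX bX /quasi_iso_cone_acyclic /(null_homotopic (chain_comp (cone_in f)
  g) pX bX).
case=> s Hs.
have Hs1 i x : cdiff Y (i + 1) (s i x).1 = (s (i + 1) (cdiff X (i + 1) x)).1.
  have /(congr1 fst) /= e := Hs i x.
  by apply/esym/subr0_eq; rewrite [LHS]addrC -e.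
have Hs2 i x : g (i + 1) x = f (i + 1) (s i x).1 + cdiff Z i (s i x).2
    + (s (i + 1) (cdiff X (i + 1) x)).2.
  by have /(congr1 snd) := Hs i x.
have [h Hh] := @int_reindex (fun i => {linear X i -> Y i})
  (fun i => fst \o s i).
have hC : forall i x, h (i + 1) (cdiff X i x) = cdiff Y i (h i x).
  by elim/int_succ=> i x; rewrite !Hh /= Hs1.
exists (ChainMap hC).
exists (fun i => \- (snd \o s i)) => i x /=.
by rewrite Hs2 Hh /= linearN -addrA opprD addNKr opprD.
Qed.

Lemma quasi_iso_lift X Y Z (f : chain_map Y Z) (g : chain_map X Z)
    (h : chain_map X Y) :
  homotopic (chain_comp f h) g -> quasi_iso f -> quasi_iso g -> quasi_iso h.
Proof.
move=> [s Hs] qf qg i.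
have Hs' x : cdiff X (i + 1) x = 0 ->
    f (i + 1) (h (i + 1) x) = g (i + 1) x + cdiff Z i (s i x).
  move=> dx; apply: subr_moveL.
  by have /= -> := Hs i x; rewrite dx linear0 addr0.
split=> [x dx [y hy]|y dy].
  apply: (qg i).1 => //; exists (f i y - s i x).
  by rewrite linearB -cmapC -hy Hs' // addrK.
have [|x [w [dx e]]] := (qg i).2 (f (i + 1) y).
  by rewrite -cmapC dy linear0.
have [||w' e'] := (qf i).1 (y - h (i + 1) x).
- by rewrite linearB dy -cmapC dx linear0 subr0.
- exists (w - s i x); rewrite !linearB Hs' // e opprD addrACA subrr add0r.
  by [].
by exists x, w'; split=> //; apply: subr_moveL.
Qed.

(** Replaces a zigzag of quasi-isomorphisms by a single chain map out of [X], one step of the zigzag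
    at a time. *)
Lemma quasi_isomorphic_lift Y Z : quasi_isomorphic Y Z ->
  forall X, (forall i, projective (X i)) -> bounded_above X ->
  (exists f : chain_map X Y, quasi_iso f) <->
  (exists g : chain_map X Z, quasi_iso g).
Proof.
elim=> {Y Z} [Y Z f qf|Y Z _ IH|Y Z W _ IH1 _ IH2] X pX bX.
- split=> [[g qg]|[g qg]].
    exists (chain_comp f g) => i; split=> [x dx [y /= hy]|y dy].
      apply: (qg i).1 => //; apply: (qf i).1;
        first by rewrite -cmapC dx linear0.
      by exists y.
    have [x [w [dx ->]]] := (qf i).2 y dy.
    have [x' [w' [dx' ->]]] := (qg i).2 x dx.
    by exists x', (f i w' + w); rewrite /= !linearD addrA cmapC.
  have [h Hh] := lift_quasi_iso g pX bX qf.
  by exists h; apply: quasi_iso_lift Hh qf qg.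
- by split=> [/(IH X pX bX)|/(IH X pX bX)].
- by split=> [/(IH1 X pX bX)/(IH2 X pX bX)|/(IH2 X pX bX)/(IH1 X pX bX)].
Qed.

Definition left_contractible X : Prop :=
  exists (s : forall i, {linear X (i + 1) -> X i}) (n : int),
    forall i x, i < n -> x = cdiff X i (s i x) + s (i + 1) (cdiff X (i + 1) x).

(** A quasi-isomorphism [f] from [X] to a bounded [B] has an acyclic cone that is projective and
    bounded above, hence contractible. Where [B] vanishes, the cone is a shift of [X], so its
    contraction restricts to one of [X]; the bound [m - 1] ensures that [B] vanishes in the degree
    one higher as well. *)
Lemma perfect_left_contractible X :
  in_Kmb X -> perfect X -> left_contractible X.
Proof.
move=> [pX bX _] [B [[m [n B0]] pB /quasi_isomorphic_lift qXB]].
have prX i : projective (X i) by have [] := pX i.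
have [|f qf] := (qXB X prX bX).1.
  by exists (chain_id X) => i; split=> [x _ [y]|y dy];
    [exists y|exists y, 0; rewrite linear0 addr0].
have pC i : projective (cone f i).
  by apply: projective_prod; [exact: prX|have [] := pB i].
have bC : bounded_above (cone f).
  case: bX => k X0; exists (Num.max k n) => i; rewrite gt_max => /andP[ki ni].
  move=> [x y]; congr (_, _); first by apply: X0; lia.
  by apply: B0; right.
have [s Hs] := null_homotopic (chain_id (cone f)) pC bC (quasi_iso_cone_acyclic
  qf).
(* The sign cancels that of the differential of [X] inside the cone. *)
have [r Hr] := @int_reindex (fun i => {linear X (i + 1) -> X i})
  (fun i => \- (fst \o (s i \o @pair0l R (X (i + 1 + 1)) (B (i + 1))))).
exists r, (m - 1); elim/int_succ=> i x im.
have /(congr1 fst) := Hs i (x, 0); rewrite /= /cone_diff /= linear0 addr0.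
have -> : f (i + 1 + 1) x = 0 by apply: B0; left; lia.
move=> {1}->; rewrite !Hr /= linearN; congr (_ + _).
have -> : (- cdiff X (i + 1 + 1) x, 0) =
    - @pair0l R (X (i + 1 + 1 + 1)) (B (i + 1 + 1)) (cdiff X (i + 1 + 1) x).
  by congr (_, _); rewrite /= oppr0.
by rewrite linearN.
Qed.

End Homotopies.

(** * Complexes of images of idempotents *)

Definition fix_proj (R : pzRingType) (V : lmodType R) (p : {linear V -> V})
    (Hp : idempotent_map p) : {linear V -> fix_mod p} :=
  corestrict (fixed_submodule p) Hp.

Section ImageComplex.
Variables (R : pzRingType) (X : complex R) (p : forall i, {linear X i -> X i}).
Hypothesis pp : forall i, idempotent_map (p i).
Hypothesis pdpd : forall i x, p (i + 1 + 1)
  (cdiff X (i + 1) (p (i + 1) (cdiff X i (p i x)))) = 0.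

(** The idempotents need not commute with the differential; [pdpd] is exactly what makes the
    compressed differential square to zero. Brutal truncations and bounded replacements of left
    contractible complexes are both of this form. *)
Program Definition im_complex : complex R :=
  @Complex R (fun i => fix_mod (p i))
    (fun i => fix_proj (@pp (i + 1)) \o (cdiff X i \o val_lin _)) _.
Next Obligation.
move=> i x; apply: val_inj => /=.
by rewrite -[submod_val x]fix_modP; apply: pdpd.
Qed.

Lemma im_complex_in_proj : in_proj X -> in_proj im_complex.
Proof.
move=> pX i; have [fX prX] := pX i.
have e : cancel (@val_lin R (X i) _ (fixed_submodule (p i))) (fix_proj (@pp i)).
  by move=> x; apply: val_inj; apply: fix_modP.
by split; [apply: retract_fg e fX|apply: retract_projective e prX].
Qed.

End ImageComplex.

(** [B] is a smart truncation: zero below [n], equal to [X] above [n], and in degree [n] the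
    quotient of [X n] by the coboundaries. The contraction makes [s n d] an idempotent whose kernel
    is these coboundaries, so the quotient is realized as a summand and stays projective. *)
Lemma left_contractible_perfect (R : pzRingType) (X : complex R) :
  in_proj X -> bounded_above X -> left_contractible X -> perfect X.
Proof.
move=> pX [k X0] [s [n Hs]].
pose p i : {linear X i -> X i} :=
  if i < n then (\0 : {linear X i -> X i})
  else if i == n then (s i \o cdiff X i : {linear X i -> X i})
  else (idfun : {linear X i -> X i}).
have p0 i x : i < n -> p i x = 0 by rewrite /p => ->.
have p1 i x : n < i -> p i x = x.
  by rewrite /p => ni; rewrite ltNge ltW //= gt_eqF.
have pn x : p n x = s n (cdiff X n x) by rewrite /p ltxx eqxx.
have dpn x : cdiff X n (p n x) = cdiff X n x.
  rewrite pn; have [m em] : exists m, n = m + 1 by exists (n - 1);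
    rewrite subrK.
  move: (Hs m) => Hm; rewrite em in x *.
  rewrite {2}[x]Hm; last by rewrite em ltrDl.
  by rewrite linearD cdiffK add0r.
have pp i : idempotent_map (p i).
  move=> x; case: (ltgtP i n) => [lt_in|lt_ni|e].
  - by rewrite !(p0 i).
  - by rewrite !(p1 i).
  by rewrite e in x *; rewrite pn dpn pn.
have pd i x : n <= i -> cdiff X i (p i x) = cdiff X i x.
  rewrite le_eqVlt => /predU1P [e|ni]; last by rewrite p1.
  by rewrite -e in x *.
have pdpd i x : p (i + 1 + 1)
  (cdiff X (i + 1) (p (i + 1) (cdiff X i (p i x)))) = 0.
  have [lt_in|le_ni] := ltP i n; first by rewrite (p0 i) // !linear0.
  by rewrite pd; [rewrite cdiffK linear0|lia].
pose B := im_complex pp pdpd.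
exists B; split.
- exists n, k => i [lt_in|lt_ki] x; apply: val_inj => /=.
    by have <- : p i (val x) = val x; [exact: fix_modP|rewrite p0].
  exact: X0.
- exact: im_complex_in_proj.
have piC i x : fix_proj (@pp (i + 1)) (cdiff X i x)
    = cdiff B i (fix_proj (@pp i) x).
  apply: val_inj => /=; have [lt_in|le_ni] := ltP i n; last by rewrite pd.
  rewrite (p0 i) // linear0 linear0.
  have [|le] := ltP (i + 1) n; first exact: p0.
  have e : i + 1 = n by lia.
  by move: (pn); rewrite -e => ->; rewrite cdiffK linear0.
apply: (qis_step (f := @ChainMap R X B (fun i => fix_proj (@pp i)) piC)) => i.
split=> [x dx [y]|y dy].
  have [lt_in _|le_ni] := ltP i n.
    by exists (s i x); rewrite {1}[x]Hs // dx linear0 addr0.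
  move/(congr1 val) => /=; rewrite !p1; try lia.
  by move=> ->; exists (val y).
have dy' : cdiff X (i + 1) (val y) = 0.
  have [lt_in|le_ni] := ltP (i + 1) n.
    by have <- : p (i + 1) (val y) = val y;
      [exact: fix_modP|rewrite p0 // linear0].
  by move/(congr1 val): dy => /=; rewrite p1 //; lia.
exists (val y), 0; split=> //; rewrite linear0 addr0; apply: val_inj => /=.
by symmetry; apply: fix_modP.
Qed.

(** * Truncations *)

Section Truncation.
Variables (R : pzRingType) (X : complex R) (n : int).

Definition trunc_proj i : {linear X i -> X i} :=
  if i <= n then (idfun : {linear X i -> X i}) else (\0 : {linear X i -> X i}).

Lemma trunc_proj_id i x : i <= n -> trunc_proj i x = x.
Proof. by rewrite /trunc_proj => ->. Qed.

Lemma trunc_proj0 i x : n < i -> trunc_proj i x = 0.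
Proof. by rewrite /trunc_proj leNgt => ->. Qed.

Fact trunc_projK i : idempotent_map (trunc_proj i).
Proof. by move=> x; rewrite /trunc_proj; case: ifP => //= _;
  rewrite linear0. Qed.

Fact trunc_dd i x : trunc_proj (i + 1 + 1)
  (cdiff X (i + 1) (trunc_proj (i + 1) (cdiff X i (trunc_proj i x)))) = 0.
Proof.
have [le_in|lt_ni] := leP (i + 1 + 1) n; last by rewrite trunc_proj0.
by rewrite !trunc_proj_id ?cdiffK //; lia.
Qed.

(** Brutal truncation, a quotient complex of [X]. Its terms up to degree [n] are only isomorphic to
    those of [X], hence the maps [to_trunc] and [of_trunc]; the latter commutes with the
    differentials only below degree [n]. *)
Definition truncation : complex R := im_complex trunc_projK trunc_dd.

Lemma truncation0 i : n < i -> zero_module (truncation i).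
Proof.
move=> ni x; apply: val_inj.
by have <- : trunc_proj i (val x) = val x;
  [exact: fix_modP|rewrite trunc_proj0].
Qed.

Lemma trunc_diffE i (x : truncation i) : i < n ->
  val (cdiff truncation i x) = cdiff X i (val x).
Proof. by move=> lt_in; rewrite /= trunc_proj_id //; lia. Qed.

Definition to_trunc i : {linear X i -> truncation i} := fix_proj (@trunc_projK
  i).

Lemma to_truncE i x : i <= n -> val (to_trunc i x) = x.
Proof. exact: trunc_proj_id. Qed.

Definition of_trunc i : {linear truncation i -> X i} := val_lin _.

Lemma of_truncK i : cancel (of_trunc i) (to_trunc i).
Proof. by move=> x; apply: val_inj; apply: fix_modP. Qed.

Lemma trunc_vanishes i :
  i + 1 < n -> cohomology_vanishes X i -> cohomology_vanishes truncation i.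
Proof.
move=> lt_in vX x dx; have [|y ey] := vX (val x).
  by rewrite -trunc_diffE // dx.
exists (to_trunc i y); apply: val_inj; rewrite trunc_diffE; last by lia.
by rewrite to_truncE //; lia.
Qed.

Lemma in_Kmb_trunc : in_proj truncation ->
  (exists m, forall i, i < m -> cohomology_vanishes X i) -> in_Kmb truncation.
Proof.
move=> pT [m vX]; split=> //; first by exists n; apply: truncation0.
exists (Num.min m (n - 1)), n => i [lt_im|lt_ni].
  by apply: trunc_vanishes; [lia|apply: vX; lia].
move=> x _; exists 0; rewrite linear0; apply/esym/truncation0; lia.
Qed.

Section IntoTruncation.
Variables (Y : complex R) (phi : forall i, {linear Y i -> X i}).
Hypothesis phiC : forall i x, i < n ->
  phi (i + 1) (cdiff Y i x) = cdiff X i (phi i x).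

(** Commutation below [n] is enough: from degree [n] on, both sides lie in degree at least [n + 1],
    where the truncation is zero. *)
Fact into_truncC i x : to_trunc (i + 1) (phi (i + 1) (cdiff Y i x))
  = cdiff truncation i (to_trunc i (phi i x)).
Proof.
have [lt_in|le_ni] := ltP i n; last first.
  by rewrite [LHS]truncation0 ?[RHS]truncation0 //; lia.
apply: val_inj; rewrite to_truncE; last by lia.
by rewrite trunc_diffE // to_truncE ?phiC // ltW.
Qed.

Definition into_trunc : chain_map Y truncation :=
  @ChainMap R Y truncation (fun i => to_trunc i \o phi i) into_truncC.

End IntoTruncation.

Definition trunc_map : chain_map X truncation :=
  into_trunc (phi := fun i => idfun : {linear X i -> X i})
    (fun i x _ => erefl (cdiff X i x)).

End Truncation.

Local Notation "f =h g" := (heq f g) (at level 70).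
Local Notation "g \oh f" := (mcomp g f) (at level 50).

(** * Germs of chain maps at [-oo] *)

Section Germs.
Variable R : pzRingType.
Implicit Types X Y Z : complex R.

(** Components exist in every degree, but those outside some left half-line are arbitrary and are
    ignored by [germ_eq]. *)
Record germ X Y := Germ {
  gmap :> forall i, {linear X i -> Y i};
  gmapC : exists n, forall i x, i < n ->
    gmap (i + 1) (cdiff X i x) = cdiff Y i (gmap i x)
}.

Definition germ_eq X Y (f g : germ X Y) : Prop :=
  exists (s : forall i, {linear X (i + 1) -> Y i}) (n : int),
    forall i x, i < n -> f (i + 1) x - g (i + 1) x
      = cdiff Y i (s i x) + s (i + 1) (cdiff X (i + 1) x).

Program Definition germ_id X : germ X X :=
  @Germ X X (fun i => idfun : {linear X i -> X i}) _.
Next Obligation. by move=> X; exists 0. Qed.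

Program Definition germ_comp X Y Z (g : germ Y Z) (f : germ X Y) : germ X Z :=
  @Germ X Z (fun i => g i \o f i : {linear X i -> Z i}) _.
Next Obligation.
move=> X Y Z [g [m gC]] [f [n fC]]; exists (Num.min m n) => i x /=.
by rewrite lt_min => /andP[im lt_in]; rewrite fC // gC.
Qed.

Lemma germ_eq_ext X Y (f g : germ X Y) n :
  (forall i x, i < n -> f i x = g i x) -> germ_eq f g.
Proof.
move=> fg; exists (fun i => \0 : {linear X (i + 1) -> Y i}), (n - 1) => i x
  lt_in.
by rewrite /= fg ?subrr ?linear0 ?addr0 //; lia.
Qed.

Lemma germ_eq_refl X Y (f : germ X Y) : germ_eq f f.
Proof. exact: (@germ_eq_ext _ _ _ _ 0). Qed.

Lemma germ_eq_sym X Y (f g : germ X Y) : germ_eq f g -> germ_eq g f.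
Proof.
case=> s [n Hs]; exists (fun i => \- s i : {linear X (i + 1) -> Y i}), n.
by move=> i x lt_in /=; rewrite linearN -opprD -Hs // opprB.
Qed.

Lemma germ_eq_trans X Y (f g h : germ X Y) :
  germ_eq f g -> germ_eq g h -> germ_eq f h.
Proof.
move=> [s [m Hs]] [t [n Ht]].
exists (fun i => s i \+ t i : {linear X (i + 1) -> Y i}), (Num.min m n) => i x.
rewrite lt_min => /andP[im lt_in] /=.
by rewrite linearD addrACA -Hs // -Ht // addrA subrK.
Qed.

Lemma germ_comp_eq X Y Z (g g' : germ Y Z) (f f' : germ X Y) :
  germ_eq g g' -> germ_eq f f' ->
  germ_eq (germ_comp g f) (germ_comp g' f').
Proof.
case: (gmapC g) (gmapC f') => a gC [b fC] [t [m Ht]] [s [n Hs]].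
exists (fun i => (g i \o s i) \+ (t i \o f' (i + 1)) :
          {linear X (i + 1) -> Z i}).
exists (Num.min (Num.min a (b - 1)) (Num.min m n)) => i x Hi.
have ? : i < a by lia.
have ? : i + 1 < b by lia.
have ? : i < m by lia.
have ? : i < n by lia.
rewrite /= linearD -gC // addrACA -(linearD (g (i + 1))) -Hs // fC // -Ht //.
by rewrite linearB addrA subrK.
Qed.

Program Definition Germs : category :=
  @Category (complex R) germ germ_eq germ_id germ_comp
    germ_eq_refl germ_eq_sym germ_eq_trans germ_comp_eq _ _ _.
Next Obligation. by move=> X Y f; apply: (@germ_eq_ext _ _ _ _ 0). Qed.
Next Obligation. by move=> X Y f; apply: (@germ_eq_ext _ _ _ _ 0). Qed.
Next Obligation. by move=> *; apply: (@germ_eq_ext _ _ _ _ 0). Qed.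

Program Definition germ_of X Y (f : chain_map X Y) : germ X Y :=
  @Germ X Y f _.
Next Obligation. by move=> X Y f; exists 0 => i x _; apply: cmapC. Qed.

Program Definition germ_functor : functor (Kmb R) Germs :=
  @Functor (Kmb R) Germs (@kmb_cx R)
    (fun (X Y : kmb_obj R) (f : chain_map X Y) => germ_of f) _ _ _.
Next Obligation.
by move=> X Y f g [s Hs]; exists s, 0 => i x _; apply: Hs.
Qed.
Next Obligation. by move=> X; apply: (@germ_eq_ext _ _ _ _ 0). Qed.
Next Obligation. by move=> *; apply: (@germ_eq_ext _ _ _ _ 0). Qed.

(** A contraction of the cone is a two by two matrix. The entry from [Y] to [X] is the inverse [g],
    and the two diagonal entries are, up to sign, the homotopies from the two composites to the
    identities. *)
Lemma left_contractible_cone_germ X Y (f : chain_map X Y) :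
  left_contractible (cone f) ->
  exists g : germ Y X, germ_eq (germ_comp g (germ_of f)) (germ_id X) /\
    germ_eq (germ_comp (germ_of f) g) (germ_id Y).
Proof.
case=> s [n Hs].
pose inY i : {linear Y i -> cone f i} := @pair0r R (X (i + 1)) (Y i).
pose inX i : {linear X (i + 1) -> cone f i} := @pair0l R (X (i + 1)) (Y i).
have HY i y : i < n ->
    (s (i + 1) (inY (i + 1 + 1) (cdiff Y (i + 1) y))).1
      = cdiff X (i + 1) (s i (inY (i + 1) y)).1 /\
    y = f (i + 1) (s i (inY (i + 1) y)).1 + cdiff Y i (s i (inY (i + 1) y)).2
      + (s (i + 1) (inY (i + 1 + 1) (cdiff Y (i + 1) y))).2.
  move=> lt_in; have := Hs i (inY (i + 1) y) lt_in.
  have -> : cdiff (cone f) (i + 1) (inY (i + 1) y)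
      = inY (i + 1 + 1) (cdiff Y (i + 1) y).
    by congr (_, _); rewrite /= !linear0 // add0r.
  move=> e; split; last by have := congr1 snd e.
  have /= e' := congr1 fst e.
  by apply: subr0_eq; rewrite [LHS]addrC -e'.
have HX i x : i < n ->
    x = - cdiff X (i + 1) (s i (inX (i + 1) x)).1
      - (s (i + 1) (inX (i + 1 + 1) (cdiff X (i + 1 + 1) x))).1
      + (s (i + 1) (inY (i + 1 + 1) (f (i + 1 + 1) x))).1.
  move=> lt_in; have := Hs i (inX (i + 1) x) lt_in.
  have -> : cdiff (cone f) (i + 1) (inX (i + 1) x)
      = - inX (i + 1 + 1) (cdiff X (i + 1 + 1) x)
        + inY (i + 1 + 1) (f (i + 1 + 1) x).
    by congr (_, _); rewrite /= ?linear0 ?oppr0 ?addr0 ?add0r.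
  rewrite (linearD (s (i + 1))) (linearN (s (i + 1))) => /(congr1 fst) /= e.
  by apply: (etrans e); apply: addrA.
have [g Hg] := @int_reindex (fun i => {linear Y i -> X i})
  (fun i => fst \o (s i \o inY (i + 1))).
have [r Hr] := @int_reindex (fun i => {linear X (i + 1) -> X i})
  (fun i => fst \o (s i \o inX (i + 1))).
have gC : exists n, forall i x, i < n ->
    g (i + 1) (cdiff Y i x) = cdiff X i (g i x).
  exists n; elim/int_succ=> i y lt_in; rewrite !Hg /=.
  by apply: (HY i y _).1; lia.
exists (Germ gC); split.
  exists r, n; elim/int_succ=> i x lt_in.
  rewrite /= Hg !Hr; have lt_in' : i < n by lia.
  exact: subr_from_expansion (HX i x lt_in').
exists (fun i => \- (snd \o (s i \o inY (i + 1)))), n => i y lt_in.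
rewrite /= Hg (linearN (cdiff Y i)).
exact: subr_from_sum (HY i y lt_in).2.
Qed.

End Germs.

(** * Functors out of a localization *)

Section Categories.
Variable C : category.

Lemma inverse_unique (X Y : C) (f : mor X Y) (g h : mor Y X) :
  g \oh f =h idm X -> f \oh h =h idm Y -> g =h h.
Proof.
move=> gf fh; apply: heq_trans (heq_sym (compm1 g)) _.
apply: heq_trans (comp_heq (heq_refl g) (heq_sym fh)) _.
apply: heq_trans (Defs.compA _ _ _) _.
exact: heq_trans (comp_heq gf (heq_refl h)) (comp1m h).
Qed.

Lemma iso_cancel (X Y Z : C) (f : mor Y Z) (g h : mor X Y) :
  isomorphism f -> f \oh g =h f \oh h -> g =h h.
Proof.
case=> k [kf _] fgh.
apply: heq_trans (heq_sym (comp1m g)) _.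
apply: heq_trans (comp_heq (heq_sym kf) (heq_refl g)) _.
apply: heq_trans (heq_sym (Defs.compA _ _ _)) _.
apply: heq_trans (comp_heq (heq_refl k) fgh) _.
apply: heq_trans (Defs.compA _ _ _) _.
exact: heq_trans (comp_heq kf (heq_refl h)) (comp1m h).
Qed.

Lemma iso_cancel_r (X Y Z : C) (f : mor X Y) (g h : mor Y Z) :
  isomorphism f -> g \oh f =h h \oh f -> g =h h.
Proof.
case=> k [_ fk] fgh.
apply: heq_trans (heq_sym (compm1 g)) _.
apply: heq_trans (comp_heq (heq_refl g) (heq_sym fk)) _.
apply: heq_trans (Defs.compA _ _ _) _.
apply: heq_trans (comp_heq fgh (heq_refl k)) _.
apply: heq_trans (heq_sym (Defs.compA _ _ _)) _.
exact: heq_trans (comp_heq (heq_refl h) fk) (compm1 h).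
Qed.

Lemma iso_comp (X Y Z : C) (f : mor Y Z) (g : mor X Y) :
  isomorphism f -> isomorphism g -> isomorphism (f \oh g).
Proof.
move=> [f' [f'f ff']] [g' [g'g gg']]; exists (g' \oh f'); split.
  apply: heq_trans (heq_sym (Defs.compA _ _ _)) _.
  apply: heq_trans (comp_heq (heq_refl _) (Defs.compA _ _ _)) _.
  apply: heq_trans (comp_heq (heq_refl _) (comp_heq f'f (heq_refl _))) _.
  exact: heq_trans (comp_heq (heq_refl _) (comp1m _)) g'g.
apply: heq_trans (heq_sym (Defs.compA _ _ _)) _.
apply: heq_trans (comp_heq (heq_refl _) (Defs.compA _ _ _)) _.
apply: heq_trans (comp_heq (heq_refl _) (comp_heq gg' (heq_refl _))) _.
exact: heq_trans (comp_heq (heq_refl _) (comp1m _)) ff'.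
Qed.

End Categories.

Lemma functor_iso (C D : category) (F : functor C D) (X Y : C) (f : mor X Y) :
  isomorphism f -> isomorphism (fhom F f).
Proof.
case=> g [gf fg]; exists (fhom F g).
split; apply: heq_trans (heq_sym (fhom_comp F _ _)) _.
  exact: heq_trans (fhom_heq F gf) (fhom_id F X).
exact: heq_trans (fhom_heq F fg) (fhom_id F Y).
Qed.

Section LocalizationLift.
Variables (C D : category) (S : forall X Y : C, mor X Y -> Prop).
Variable F : functor C D.
Hypothesis FS : forall X Y (f : mor X Y), S f -> isomorphism (fhom F f).

Lemma loc_mor_iso X Y (f : mor X Y) :
  S f -> @isomorphism (localization S) X Y (loc_mor S f).
Proof.
by move=> Sf; exists (loc_inv Sf); split; [apply: loc_invl|apply: loc_invr].
Qed.

Lemma loc_comp_mor (X Y Z : C) (g : mor Y Z) (f : mor X Y) :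
  @mcomp (localization S) X Y Z (loc_mor S g) (loc_mor S f)
    =h (loc_mor S (g \oh f) : @mor (localization S) X Z).
Proof. exact/loc_sym/loc_mor_comp. Qed.

Lemma loc_mor_heq (X Y : C) (f g : mor X Y) : f =h g ->
  (loc_mor S f : @mor (localization S) X Y) =h loc_mor S g.
Proof. exact: loc_mor_eq. Qed.

Lemma loc_inv_mor (X Y : C) (f : mor X Y) (Sf : S f) :
  @mcomp (localization S) X Y X (loc_inv Sf) (loc_mor S f)
    =h @idm (localization S) X.
Proof. exact: loc_invl. Qed.

Lemma loc_mor_inv (X Y : C) (f : mor X Y) (Sf : S f) :
  @mcomp (localization S) Y X Y (loc_mor S f) (loc_inv Sf)
    =h @idm (localization S) Y.
Proof. exact: loc_invr. Qed.

Fixpoint lift_hom X Y (f : loc_hom S X Y) : mor (F X) (F Y) :=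
  match f with
  | loc_mor _ _ g => fhom F g
  | loc_inv _ _ _ Sg => sval (cid (FS Sg))
  | loc_comp _ _ _ g h => lift_hom g \oh lift_hom h
  end.

Program Definition loc_lift : functor (localization S) D :=
  @Functor (localization S) D F lift_hom _ _ _.
Next Obligation.
move=> X Y f g; rewrite /=; elim=> {X Y f g} /=.
- by move=> *; apply: heq_refl.
- by move=> X Y f g _; apply: heq_sym.
- by move=> X Y f g h _ fg _; apply: heq_trans.
- by move=> X Y Z g g' f f' _ gg' _ ff'; apply: comp_heq.
- by move=> *; apply: Defs.compA.
- move=> X Y f; apply: heq_trans (comp1m _).
  exact: comp_heq (fhom_id F _) (heq_refl _).
- move=> X Y f; apply: heq_trans (compm1 _).
  exact: comp_heq (heq_refl _) (fhom_id F _).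
- by move=> X Y f g fg; apply: fhom_heq.
- by move=> X Y Z g f; apply: fhom_comp.
- move=> X Y f Sf; case: cid => g [gf fg] /=.
  exact: heq_trans gf (heq_sym (fhom_id F _)).
- move=> X Y f Sf; case: cid => g [gf fg] /=.
  exact: heq_trans fg (heq_sym (fhom_id F _)).
Qed.
Next Obligation. by move=> X /=; apply: fhom_id. Qed.
Next Obligation. by move=> X Y Z g f /=; apply: heq_refl. Qed.

End LocalizationLift.

(** * The singularity category as a category of germs *)

Section DsgGerms.
Variable R : pzRingType.

Lemma perfect_cone_germ (X Y : Kmb R) (f : mor X Y) :
  perfect_cone f -> isomorphism (fhom (germ_functor R) f).
Proof.
move=> pf; apply: left_contractible_cone_germ.
exact: perfect_left_contractible (kmb_in (kmb_cone f)) pf.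
Qed.

Definition Dsg_germ : functor (Dsg R) (Germs R) :=
  loc_lift perfect_cone_germ.

Lemma perfect_cone_left_contractible (X Y : Kmb R) (f : mor X Y) :
  left_contractible (cone f) -> perfect_cone f.
Proof.
by case: (kmb_in (kmb_cone f)) => pC bC _; apply: left_contractible_perfect.
Qed.

Program Definition kmb_trunc (X : kmb_obj R) (n : int) : kmb_obj R :=
  @KmbObj R (truncation X n) _.
Next Obligation.
move=> [X [pX bX [m [k HX]]]] n; apply: in_Kmb_trunc.
  exact: im_complex_in_proj.
by exists m => i im; apply: HX; left.
Qed.

(** The map is bijective in degrees at most [n], and its inverse [of_trunc], as an off-diagonal
    entry, contracts the cone far to the left. *)
Lemma perfect_cone_trunc (X : kmb_obj R) (n : int) :
  @perfect_cone R X (kmb_trunc X n) (trunc_map X n).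
Proof.
apply: perfect_cone_left_contractible.
exists (fun i => @pair0l R (X (i + 1)) (truncation X n i)
  \o (@of_trunc R X n (i + 1) \o snd)), (n - 1) => i [x y] lt_in.
congr (_, _); rewrite /= ?linear0 ?addr0.
- rewrite trunc_proj_id; last by lia.
  rewrite trunc_proj_id; last by lia.
  by rewrite addrCA addNr addr0.
- by apply: val_inj; rewrite /= trunc_proj_id //; lia.
Qed.

End DsgGerms.

Section DsgGermFullyFaithful.
Variable R : pzRingType.

Local Notation L := (Dsg_germ R).

Definition chain_below (X Y : complex R) (phi : forall i, {linear X i -> Y i})
    (n : int) : Prop :=
  forall i x, i < n -> phi (i + 1) (cdiff X i x) = cdiff Y i (phi i x).

Lemma into_trunc_homotopic (X Y : complex R) (phi psi : germ X Y) :
  germ_eq phi psi -> exists N, forall n, n <= N ->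
    forall (Hphi : chain_below phi n) (Hpsi : chain_below psi n),
    homotopic (into_trunc Hphi) (into_trunc Hpsi).
Proof.
case=> s [N Hs]; exists N => n le_nN Hphi Hpsi.
exists (fun i => @to_trunc R Y n i \o s i) => i x.
have [lt_in|le_ni] := ltP i n; last first.
  by rewrite [LHS](@truncation0 _ Y n) ?[RHS](@truncation0 _ Y n) //; lia.
apply: val_inj; rewrite /= !trunc_proj_id; try lia.
by apply: Hs; lia.
Qed.

Definition dmor (X Y : kmb_obj R) (f : chain_map X Y) : @mor (Dsg R) X Y :=
  @loc_mor (Kmb R) (@perfect_cone R) X Y f.

Lemma dmor_comp (X Y Z : kmb_obj R) (g : chain_map Y Z) (f : chain_map X Y) :
  dmor g \oh dmor f =h dmor (chain_comp g f).
Proof. exact: (@loc_comp_mor (Kmb R)). Qed.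

Lemma dmor_homotopic (X Y : kmb_obj R) (f g : chain_map X Y) :
  homotopic f g -> dmor f =h dmor g.
Proof. exact: (@loc_mor_heq (Kmb R)). Qed.

Lemma dmor_iso (X Y : kmb_obj R) (f : chain_map X Y) :
  perfect_cone (f : @mor (Kmb R) X Y) -> isomorphism (dmor f).
Proof. exact: (@loc_mor_iso (Kmb R)). Qed.

Definition loc_trunc (Z : kmb_obj R) (m : int) :
    @mor (Dsg R) Z (kmb_trunc Z m) :=
  dmor (trunc_map Z m : chain_map Z (kmb_trunc Z m)).

Definition loc_into (X Y : kmb_obj R) (n : int)
    (phi : forall i, {linear X i -> Y i})
    (H : chain_below phi n) : @mor (Dsg R) X (kmb_trunc Y n) :=
  dmor (into_trunc H : chain_map X (kmb_trunc Y n)).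

Lemma loc_trunc_iso (X : kmb_obj R) n : isomorphism (loc_trunc X n).
Proof. exact/dmor_iso/perfect_cone_trunc. Qed.

(** Induction on the word. For the inverse of [g], composing with the isomorphism [g] reduces the
    claim to the homotopy between the germ of the composite and the identity. For a composite, the
    truncation is moved past each factor in turn; the claim is made for all [n] below a bound so
    that both factors can use the same [n]. *)
Lemma trunc_loc_hom (X Y : kmb_obj R) (f : @mor (Dsg R) X Y) :
  exists N, forall n, n <= N -> forall (H : chain_below (fhom L f) n),
    loc_trunc Y n \oh f =h loc_into H.
Proof.
elim: f => {X Y} [X Y g|X Y g Sg|X Y Z g [M IHg] f [N IHf]].
- exists 0 => n _ H; apply: heq_trans (dmor_comp _ g) _.
  by apply: dmor_homotopic; apply: homotopic_ext => i x.
- have giso : isomorphism (dmor g) by exact: dmor_iso.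
  set c : germ Y X := fhom L (loc_inv Sg : @mor (Dsg R) Y X).
  have [cg _] : germ_eq (germ_comp c (germ_of g)) (germ_id X) /\
    germ_eq (germ_comp (germ_of g) c) (germ_id Y).
    by rewrite /c /=; case: cid.
  have [N HN] := into_trunc_homotopic cg.
  exists N => n le_nN H; apply: (iso_cancel_r giso).
  have e : (loc_inv Sg : @mor (Dsg R) Y X) \oh dmor g =h idm (X : Dsg R).
    exact: (@loc_inv_mor (Kmb R)).
  apply: heq_trans (heq_sym (Defs.compA _ _ _)) _.
  apply: heq_trans (comp_heq (heq_refl _) e) _.
  apply: heq_trans (compm1 _) _.
  apply: heq_trans _ (heq_sym (dmor_comp _ g)); apply: dmor_homotopic.
  have H1 : chain_below (germ_comp c (germ_of g)) n.
    by move=> i x lt_in; rewrite /= cmapC H.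
  have H2 : chain_below (germ_id X) n by [].
  apply: (@homotopic_trans R _ _ _ (into_trunc H2)).
    by apply: homotopic_ext.
  apply: homotopic_trans (homotopic_sym (HN n le_nN H1 H2)) _.
  by apply: homotopic_ext.
have [fn fC] := gmapC (fhom L (f : @mor (Dsg R) X Y)).
have [gn gC] := gmapC (fhom L (g : @mor (Dsg R) Y Z)).
exists (Num.min (Num.min M N) (Num.min fn gn)) => n le_n H.
have Hg : chain_below (fhom L (g : @mor (Dsg R) Y Z)) n.
  by move=> i x lt_in; apply: gC; lia.
have Hf : chain_below (fhom L (f : @mor (Dsg R) X Y)) n.
  by move=> i x lt_in; apply: fC; lia.
set psi := fhom L (g : @mor (Dsg R) Y Z) in Hg.
(* Below [n] the germ of [g] factors through the truncation of [Y], so that the truncation of [Y]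
   can next absorb [f]. *)
have Hg' : chain_below (fun i => psi i \o @of_trunc R Y n i) n.
  by move=> i x lt_in; rewrite /= trunc_proj_id ?Hg //; lia.
apply: heq_trans (Defs.compA _ _ _) _.
apply: heq_trans (comp_heq (IHg n _ Hg) (heq_refl _)) _; first by lia.
apply: (@heq_trans (Dsg R) _ _ _
  ((@loc_into (kmb_trunc Y n) Z n _ Hg' \oh loc_trunc Y n) \oh f)).
  apply: comp_heq _ (heq_refl _).
  apply: heq_trans _ (heq_sym (dmor_comp _ _)); apply: dmor_homotopic.
  apply: homotopic_ext => i x; have [le_in|lt_ni] := leP i n.
    by apply: val_inj; rewrite /= (@trunc_proj_id _ Y).
  by rewrite [LHS](@truncation0 _ Z n) ?[RHS](@truncation0 _ Z n).
apply: heq_trans (heq_sym (Defs.compA _ _ _)) _.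
apply: heq_trans (comp_heq (heq_refl _) (IHf n _ Hf)) _; first by lia.
apply: heq_trans (dmor_comp _ _) _; apply: dmor_homotopic.
apply: homotopic_ext => i x; have [le_in|lt_ni] := leP i n.
  by apply: val_inj; rewrite /= (@trunc_proj_id _ Y).
by rewrite [LHS](@truncation0 _ Z n) ?[RHS](@truncation0 _ Z n).
Qed.

Lemma Dsg_germ_faithful (X Y : Dsg R) (f g : mor X Y) :
  fhom L f =h fhom L g -> f =h g.
Proof.
move=> fg; have [M HM] := trunc_loc_hom f; have [N HN] := trunc_loc_hom g.
have [fn fC] := gmapC (fhom L f); have [gn gC] := gmapC (fhom L g).
have [K HK] := into_trunc_homotopic fg.
pose n := Num.min (Num.min M N) (Num.min K (Num.min fn gn)).
have Hf : chain_below (fhom L f) n by move=> i x lt_in; apply: fC; lia.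
have Hg : chain_below (fhom L g) n by move=> i x lt_in; apply: gC; lia.
apply: (iso_cancel (loc_trunc_iso Y n)).
apply: heq_trans (HM n _ Hf) _; first by lia.
apply: heq_trans _ (heq_sym (HN n _ Hg)); last by lia.
by apply: dmor_homotopic; apply: HK; lia.
Qed.

Lemma Dsg_germ_full (X Y : Dsg R) (phi : mor (L X) (L Y)) :
  exists f : mor X Y, fhom L f =h phi.
Proof.
have [n H] := gmapC phi.
pose t := loc_inv (perfect_cone_trunc Y n) : @mor (Dsg R) (kmb_trunc Y n) Y.
exists (t \oh loc_into H).
apply: (iso_cancel (C := Germs R) (functor_iso L (loc_trunc_iso Y n))).
apply: heq_trans (heq_sym (fhom_comp L _ _)) _.
apply: (@heq_trans (Germs R) _ _ _ (fhom L (loc_into H))).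
  apply: (fhom_heq L); apply: heq_trans (Defs.compA _ _ _) _.
  apply: heq_trans (comp1m _).
  by apply: comp_heq (loc_mor_inv _) (heq_refl _).
exact: (@germ_eq_ext R _ _ _ _ 0).
Qed.

End DsgGermFullyFaithful.

(** * The functor [Re (x) -] and its right adjoint *)

Section CornerTensor.
Variables (R : pzRingType) (e : R) (he : e * e = e).

Local Notation S := (corner he).
Local Notation Re := (left_corner he).

Definition ptens (N : lmodType S) (a : Re) (x : N) : tensor N :=
  \pi_(tensor N) [:: (a, x)].

Section Pure.
Variable N : lmodType S.

Lemma ptensDl a b (x : N) : ptens (a + b) x = ptens a x + ptens b x.
Proof. by rewrite [RHS]tensor_addE; apply/tensor_eq; apply: tr_Dl. Qed.

Lemma ptensDr a (x y : N) : ptens a (x + y) = ptens a x + ptens a y.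
Proof. by rewrite [RHS]tensor_addE; apply/tensor_eq; apply: tr_Dr. Qed.

Lemma ptens_balanced a s (x : N) : ptens (Re_rscale a s) x = ptens a (s *: x).
Proof. by apply/tensor_eq; apply: tr_balanced. Qed.

Lemma ptensZ r a (x : N) : ptens (r *: a) x = r *: ptens a x.
Proof. by rewrite [RHS]tensor_scaleE. Qed.

Lemma ptens_ind (P : tensor N -> Prop) :
  P 0 -> (forall a x t, P t -> P (ptens a x + t)) -> forall t, P t.
Proof.
move=> P0 PD; elim/tensor_ind; elim=> [|[a x] s IHs]; first exact: P0.
suff -> : \pi_(tensor N) ((a, x) :: s) = ptens a x + \pi_(tensor N) s.
  exact: PD.
by rewrite [RHS]tensor_addE.
Qed.

Lemma tensor_linear_ext (V : lmodType R) (f g : {linear tensor N -> V}) :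
  (forall a x, f (ptens a x) = g (ptens a x)) -> forall t, f t = g t.
Proof.
move=> fg; elim/ptens_ind=> [|a x t IH]; first by rewrite !linear0.
by rewrite !linearD fg IH.
Qed.

Section Lift.
Variables (V : zmodType) (b : Re -> N -> V).
Hypothesis bDl : forall a a' x, b (a + a') x = b a x + b a' x.
Hypothesis bDr : forall a x x', b a (x + x') = b a x + b a x'.
Hypothesis bbal : forall a s x, b (Re_rscale a s) x = b a (s *: x).

(** The target is a mere abelian group, so that one construction serves both [R]-linear maps and
    [corner_part], whose values lie in an [eRe]-module. *)
Definition tensor_fold (t : tensor N) : V := \sum_(p <- repr t) b p.1 p.2.

Lemma tensor_foldE s :
  tensor_fold (\pi_(tensor N) s) = \sum_(p <- s) b p.1 p.2.
Proof.
have rel s1 s2 : tensor_rel s1 s2 ->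
    \sum_(p <- s1) b p.1 p.2 = \sum_(p <- s2) b p.1 p.2.
  elim=> {s1 s2} //.
  - by move=> s1 s2 s3 _ -> _ ->.
  - by move=> s1 s2 t1 t2 _ e1 _ e2; rewrite !big_cat /= e1 e2.
  - by move=> s1 s2; rewrite !big_cat /= addrC.
  - move=> x; rewrite big_seq1 big_nil /=.
    by apply: (addrI (b 0 x)); rewrite -bDl !addr0.
  - by move=> a a' x; rewrite !big_cons !big_nil /= bDl !addr0.
  - by move=> a x x'; rewrite !big_cons !big_nil /= bDr !addr0.
  - by move=> a c x; rewrite !big_seq1 /= bbal.
by apply: rel; apply: repr_tensor.
Qed.

Lemma tensor_fold_pure a x : tensor_fold (ptens a x) = b a x.
Proof. by rewrite tensor_foldE big_seq1. Qed.

Lemma tensor_foldD t u : tensor_fold (t + u) = tensor_fold t + tensor_fold u.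
Proof.
elim/tensor_ind: t => s; elim/tensor_ind: u => s'.
by rewrite [_ + _]tensor_addE !tensor_foldE big_cat.
Qed.

Lemma tensor_fold0 : tensor_fold 0 = 0.
Proof. by apply: (addrI (tensor_fold 0)); rewrite -tensor_foldD !addr0. Qed.

End Lift.

Lemma tensor_lift (V : lmodType R) (b : Re -> N -> V) :
    (forall a a' x, b (a + a') x = b a x + b a' x) ->
    (forall a x x', b a (x + x') = b a x + b a x') ->
    (forall a s x, b (Re_rscale a s) x = b a (s *: x)) ->
    (forall r a x, b (r *: a) x = r *: b a x) ->
  exists f : {linear tensor N -> V}, forall a x, f (ptens a x) = b a x.
Proof.
move=> bDl bDr bbal bZ.
have fl : linear (tensor_fold b).
  move=> r t u; rewrite (tensor_foldD bDl bDr bbal); congr (_ + _).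
  elim/ptens_ind: t => [|a x t IH].
    by rewrite scaler0 (tensor_fold0 bDl bDr bbal) scaler0.
  rewrite scalerDr !(tensor_foldD bDl bDr bbal) IH -ptensZ.
  by rewrite !(tensor_fold_pure bDl bDr bbal) bZ scalerDr.
by exists (mk_linear fl) => a x; apply: (tensor_fold_pure bDl bDr bbal).
Qed.

End Pure.

Lemma tensor_map_pure (M N : lmodType S) (f : {linear M -> N}) a x :
  tensor_map f (ptens a x) = ptens a (f x).
Proof. by rewrite tensor_mapE. Qed.

Program Definition Re_e : Re := @LeftCorner R e he e _.
Next Obligation. exact/eqP. Qed.

Program Definition Re_corner (a : Re) : S := @Corner R e he (e * val a) _.
Next Obligation. by move=> a; rewrite mulrA he -mulrA left_corner_e. Qed.

Lemma Re_scale_e (a : Re) : (val a : R) *: Re_e = a.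
Proof. by apply: val_inj; apply: left_corner_e. Qed.

Lemma Re_rscale_e (s : S) : Re_rscale Re_e s = (val s : R) *: Re_e.
Proof. by apply: val_inj; rewrite /= !corner_e. Qed.

Lemma Re_rscale_corner (a : Re) : Re_rscale Re_e (Re_corner a) = e *: a.
Proof. by apply: val_inj; rewrite /= mulrA he. Qed.

Lemma Re_corner_e : Re_corner Re_e = 1.
Proof. by apply: val_inj; rewrite /= he. Qed.

Lemma ptens_scale_e (N : lmodType S) a (x : N) :
  ptens a x = (val a : R) *: ptens Re_e x.
Proof. by rewrite -ptensZ Re_scale_e. Qed.

Lemma ptens_e_scale (N : lmodType S) s (x : N) :
  ptens Re_e (s *: x) = (val s : R) *: ptens Re_e x.
Proof. by rewrite -ptens_balanced Re_rscale_e ptensZ. Qed.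

Section Component.
Variable N : lmodType S.

(* The isomorphism of [e(Re (x) N)] with [N], precomposed with the
   multiplication by [e]. *)
Definition corner_part : tensor N -> N :=
  tensor_fold (fun a x => Re_corner a *: x).

Fact corner_part_Dl (a a' : Re) (x : N) :
  Re_corner (a + a') *: x = Re_corner a *: x + Re_corner a' *: x.
Proof.
by rewrite -scalerDl; congr (_ *: _); apply: val_inj; rewrite /= mulrDr.
Qed.

Fact corner_part_bal (a : Re) s (x : N) :
  Re_corner (Re_rscale a s) *: x = Re_corner a *: (s *: x).
Proof. by rewrite scalerA; congr (_ *: _); apply: val_inj;
  rewrite /= mulrA. Qed.

Lemma corner_part_pure a x : corner_part (ptens a x) = Re_corner a *: x.
Proof.
apply: tensor_fold_pure; first exact: corner_part_Dl.
  by move=> *; apply: scalerDr.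
exact: corner_part_bal.
Qed.

Lemma corner_partD t u : corner_part (t + u) = corner_part t + corner_part u.
Proof.
apply: tensor_foldD; first exact: corner_part_Dl.
  by move=> *; apply: scalerDr.
exact: corner_part_bal.
Qed.

Lemma corner_part0 : corner_part 0 = 0.
Proof.
apply: tensor_fold0; first exact: corner_part_Dl.
  by move=> *; apply: scalerDr.
exact: corner_part_bal.
Qed.

Lemma corner_partZ (s : S) t : corner_part ((val s : R) *: t) = s *:
  corner_part t.
Proof.
elim/ptens_ind: t => [|a x t IH]; first by rewrite scaler0 corner_part0 scaler0.
rewrite scalerDr !corner_partD IH -ptensZ !corner_part_pure scalerDr scalerA.
congr (_ *: _ + _); apply: val_inj => /=.
by rewrite !mulrA !corner_e.
Qed.

Lemma ptens_corner_part t : ptens Re_e (corner_part t) = e *: t.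
Proof.
elim/ptens_ind: t => [|a x t IH].
  rewrite corner_part0 scaler0; apply: (addrI (ptens Re_e 0)).
  by rewrite -ptensDr !addr0.
rewrite corner_partD ptensDr IH scalerDr corner_part_pure -ptens_balanced.
by rewrite Re_rscale_corner ptensZ.
Qed.

End Component.

Lemma tensor_map_inj (M N : lmodType S) (f g : {linear M -> N}) :
  (forall t, tensor_map f t = tensor_map g t) -> forall x, f x = g x.
Proof.
move=> fg x; have := congr1 (@corner_part N) (fg (ptens Re_e x)).
by rewrite !tensor_map_pure !corner_part_pure Re_corner_e !scale1r.
Qed.

(** An [R]-linear map out of [tensor M] is determined by its values on the elements [ptens Re_e x].
    These are fixed by [e], so their images are too, and by [ptens_corner_part] they have the form
    [ptens Re_e y]. *)
Lemma tensor_map_full (M N : lmodType S) (f : {linear tensor M -> tensor N}) :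
  exists g : {linear M -> N}, forall t, tensor_map g t = f t.
Proof.
have gl : linear (fun x => corner_part (f (ptens Re_e x))).
  move=> s x y; rewrite ptensDr linearD corner_partD ptens_e_scale linearZ.
  by rewrite corner_partZ.
exists (mk_linear gl); apply: tensor_linear_ext => a x.
rewrite [LHS]tensor_map_pure /= ptens_scale_e ptens_corner_part -linearZ
  -ptensZ.
rewrite -linearZ -ptensZ; congr (f (ptens _ _)).
by apply: val_inj; rewrite /= he left_corner_e.
Qed.

Lemma ptens_suml (N : lmodType S) (I : Type) (r : seq I) (F : I -> Re) (x : N) :
  ptens (\sum_(i <- r) F i) x = \sum_(i <- r) ptens (F i) x.
Proof.
elim: r => [|i r IH]; last by rewrite !big_cons ptensDl IH.
rewrite !big_nil; apply: (addrI (ptens 0 x)).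
by rewrite -ptensDl !addr0.
Qed.

Lemma ptens_sumr (N : lmodType S) (I : Type) (r : seq I) a (F : I -> N) :
  ptens a (\sum_(i <- r) F i) = \sum_(i <- r) ptens a (F i).
Proof.
elim: r => [|i r IH]; last by rewrite !big_cons ptensDr IH.
rewrite !big_nil; apply: (addrI (ptens a 0)).
by rewrite -ptensDr !addr0.
Qed.

Lemma tensor_coord_exists (N : lmodType S) (c : {linear N -> S^o}) :
  exists f : {linear tensor N -> Re}, forall a x,
    f (ptens a x) = Re_rscale a (c x).
Proof.
apply: tensor_lift => [a a' x|a x x'|a s x|r a x]; apply: val_inj => /=.
- exact: mulrDl.
- by rewrite linearD /= mulrDr.
- by rewrite linearZ /= mulrA.
- by rewrite mulrA.
Qed.

Definition Re_incl (a : Re) : R^o := val a.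

Fact Re_incl_linear : linear Re_incl.
Proof. by []. Qed.

Lemma tensor_dual_basis (N : lmodType S) n (v : 'I_n -> N) c :
  dual_basis v c -> exists f, dual_basis (fun i => ptens Re_e (v i)) f.
Proof.
move=> H; have f_ex i := tensor_coord_exists (c i).
pose f i := sval (cid (f_ex i)).
have fE i a x : f i (ptens a x) = Re_rscale a (c i x) := svalP (cid (f_ex i)) a
  x.
exists (fun i => mk_linear Re_incl_linear \o f i).
elim/ptens_ind=> [|a x t IH].
  by rewrite big1 // => i _; rewrite linear0 scale0r.
rewrite {1}IH {1}(H x) ptens_sumr -big_split /=; apply: eq_bigr => i _.
rewrite linearD /= -ptens_balanced -fE [in RHS]/Re_incl /= scalerDl.
by congr (_ + _); rewrite ptens_scale_e.
Qed.

Lemma tensor_fg_projective (N : lmodType S) :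
  finitely_generated N -> projective N ->
  finitely_generated (tensor N) /\ projective (tensor N).
Proof.
move=> fN pN; have [n [v [c /tensor_dual_basis [f H]]]] := dual_basis_exists fN
  pN.
by split; [apply: dual_basis_fg H|apply: dual_basis_projective H].
Qed.

End CornerTensor.

Record corner_mod (R : pzRingType) (e : R) (he : e * e = e)
    (M : lmodType R) := CornerMod {
  corner_mod_val : M;
  corner_mod_valP : e *: corner_mod_val == corner_mod_val
}.

Section CornerModule.
Variables (R : pzRingType) (e : R) (he : e * e = e).

Local Notation S := (corner he).
Local Notation Re := (left_corner he).

Section Structure.
Variable M : lmodType R.

HB.instance Definition _ := [isSub for @corner_mod_val R e he M].
HB.instance Definition _ := [Choice of corner_mod he M by <:].

Local Notation eM := (corner_mod he M).

Fact corner_mod_closed : zmod_closed [pred x : M | e *: x == x].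
Proof.
split=> [|x y]; rewrite !inE; first by rewrite scaler0.
by move=> /eqP ex /eqP ey; rewrite scalerBr ex ey.
Qed.

HB.instance Definition _ :=
  GRing.SubChoice_isSubZmodule.Build M _ eM corner_mod_closed.

Lemma corner_modP (x : eM) : e *: val x = val x.
Proof. exact/eqP/corner_mod_valP. Qed.

Program Definition corner_scale (s : S) (x : eM) : eM :=
  @CornerMod R e he M (val s *: val x) _.
Next Obligation. by move=> s x; rewrite scalerA corner_e. Qed.

Fact corner_scaleA a b x :
  corner_scale a (corner_scale b x) = corner_scale (a * b) x.
Proof. by apply: val_inj; rewrite /= scalerA. Qed.
Fact corner_scale1 : left_id 1 corner_scale.
Proof. by move=> x; apply: val_inj; apply: corner_modP. Qed.
Fact corner_scaleDr : right_distributive corner_scale +%R.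
Proof. by move=> a x y; apply: val_inj; apply: scalerDr. Qed.
Fact corner_scaleDl x : {morph corner_scale^~ x : a b / a + b}.
Proof. by move=> a b; apply: val_inj; rewrite /= scalerDl. Qed.

HB.instance Definition _ := GRing.Zmodule_isLmodule.Build S eM
  corner_scaleA corner_scale1 corner_scaleDr corner_scaleDl.

Program Definition to_corner_mod (x : M) : eM := @CornerMod R e he M (e *: x) _.
Next Obligation. by move=> x; rewrite scalerA he. Qed.

Lemma counit_exists : exists f : {linear tensor eM -> M},
  forall a x, f (ptens a x) = (val a : R) *: val x.
Proof.
apply: tensor_lift => [a a' x|a x x'|a s x|r a x] /=.
- exact: scalerDl.
- exact: scalerDr.
- by rewrite scalerA.
- by rewrite scalerA.
Qed.

Definition counit : {linear tensor eM -> M} := sval (cid counit_exists).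

Lemma counit_pure a x : counit (ptens a x) = (val a : R) *: val x.
Proof. exact: svalP (cid counit_exists) a x. Qed.

End Structure.

Section Map.
Variables (M N : lmodType R) (f : {linear M -> N}).

Program Definition corner_map (x : corner_mod he M) : corner_mod he N :=
  @CornerMod R e he N (f (val x)) _.
Next Obligation. by move=> x; rewrite -linearZ corner_modP. Qed.

Fact corner_map_linear : linear corner_map.
Proof. by move=> s x y; apply: val_inj; rewrite /= linearP. Qed.

HB.instance Definition _ :=
  GRing.isLinear.Build S (corner_mod he M) (corner_mod he N) *:%R corner_map
    corner_map_linear.

Lemma counit_natural t : counit N (tensor_map corner_map t) = f (counit M t).
Proof.
elim/ptens_ind: t => [|a x t IH]; first by rewrite !linear0.
by rewrite !linearD IH /= tensor_map_pure !counit_pure linearZ.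
Qed.

End Map.

Program Definition corner_complex (X : complex R) : complex S :=
  @Complex S (fun i => corner_mod he (X i)) (fun i => corner_map (cdiff X i)) _.
Next Obligation. by move=> X i x; apply: val_inj; apply: cdiffK. Qed.

Lemma corner_complex_vanishes (X : complex R) i :
  cohomology_vanishes X i -> cohomology_vanishes (corner_complex X) i.
Proof.
move=> vX x /(congr1 val) /= /vX [y ey].
by exists (to_corner_mod y); apply: val_inj; rewrite /= linearZ ey;
  apply: corner_modP.
Qed.

(** A map from [Re] to [M] amounts to an element of [eM], the image of [e]. A summand of a power of
    [Re] thus has a dual basis with coordinates in [Re] and vectors in [eM]; it provides both the
    inverse of the counit and coordinates on [eM]. *)
Lemma add_Re_dual_basis (M : lmodType R) : in_add_Re he M ->
  exists n (c : 'I_n -> {linear M -> Re}) (v : 'I_n -> corner_mod he M),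
    forall x, x = \sum_i (val (c i x) : R) *: val (v i).
Proof.
move=> [n [M' [phi /bijective_linear_inverse [psi [phiK psiK]]]]].
pose delta (i : 'I_n) : {ffun 'I_n -> Re} :=
  [ffun j => if j == i then Re_e he else 0].
have dE i : e *: delta i = delta i.
  apply/ffunP=> j; rewrite !ffunE; case: eqP => _; last exact: scaler0.
  by apply: val_inj; apply: he.
have vP i : e *: (psi (delta i)).1 == (psi (delta i)).1.
  by rewrite -{2}(dE i) linearZ.
have cl i : linear (fun x : M => phi (x, 0) i).
  move=> a x y; have -> : (a *: x + y, 0) = a *: (x, 0) + (y, 0) :> (M *
    M')%type.
    by congr (_, _); rewrite /= scaler0 addr0.
  by rewrite linearP !ffunE.
exists n, (fun i => mk_linear (cl i)), (fun i => @CornerMod R e he M _ (vP i))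
  => x /=.
have e1 : phi (x, 0) = \sum_i (val (phi (x, 0) i) : R) *: delta i.
  apply/ffunP=> j; rewrite sum_ffunE (bigD1 j) //= big1 => [|i ne_ij].
    by rewrite !ffunE eqxx addr0 Re_scale_e.
  by rewrite !ffunE eq_sym (negPf ne_ij) scaler0.
have e2 : (psi (phi (x, 0))).1 = x by rewrite phiK.
rewrite -[LHS]e2 [in LHS]e1 linear_sum raddf_sum; apply: eq_bigr => i _.
by rewrite linearZ.
Qed.

Lemma add_Re_counit_bijective (M : lmodType R) :
  in_add_Re he M -> bijective (counit M).
Proof.
move=> /add_Re_dual_basis [n [c [v H]]].
exists (fun x => \sum_i ptens (c i x) (v i)) => [|x]; last first.
  by rewrite linear_sum [RHS]H; apply: eq_bigr => i _; rewrite counit_pure.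
elim/ptens_ind=> [|a x t IH].
  rewrite big1 // => i _; rewrite !linear0.
  by apply: (addrI (ptens 0 (v i))); rewrite -ptensDl !addr0.
(* The element [x] of [eM] is expanded over [eRe], so that its coefficients can be moved across the
   tensor sign. *)
rewrite -{2}IH -[in RHS]/(ptens a x); have {2}-> :
    x = \sum_i Re_corner (c i (val x)) *: v i.
  apply: val_inj; rewrite {1}[val x]H raddf_sum; apply: eq_bigr => i _ /=.
  by rewrite -[in RHS](corner_modP x) linearZ /= mulrA he -{1}(corner_modP x)
    linearZ.
rewrite ptens_sumr -big_split; apply: eq_bigr => i _ /=.
rewrite linearD linearD ptensDl; congr (_ + _).
rewrite counit_pure linearZ -ptens_balanced; congr (ptens _ _); apply: val_inj.
rewrite /= mulrA left_corner_e; congr (_ * _).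
Qed.

Lemma add_Re_corner_projective (M : lmodType R) : in_add_Re he M ->
  finitely_generated (corner_mod he M) /\ projective (corner_mod he M).
Proof.
move=> /add_Re_dual_basis [n [c [v H]]].
have cl i : linear (fun x : corner_mod he M => (Re_corner (c i (val x)) : S^o)).
  move=> s x y; apply: val_inj => /=.
  by rewrite linearD linearZ /= mulrDr !mulrA !corner_e.
have D : dual_basis v (fun i => mk_linear (cl i)).
  move=> x; apply: val_inj; rewrite {1}[val x]H raddf_sum;
    apply: eq_bigr => i _.
  by rewrite /= -{1}(corner_modP x) linearZ.
by split; [apply: dual_basis_fg D|apply: dual_basis_projective D].
Qed.

End CornerModule.

(** * Tensoring with a right module of finite projective dimension *)

Section FreeModule.
Variables (R : pzRingType) (Q : lmodType R).

(** The terms of a projective resolution of [Re] need not be finitely generated, so free modules of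
    arbitrary rank are required. *)
Definition fin_supp (f : Q -> R^o) : Prop :=
  exists s : seq Q, forall q, q \notin s -> f q = 0.

Fact fin_supp_submodule : @submodule R (Q -> R^o) fin_supp.
Proof.
split; first by exists [::].
move=> a f g [s Hs] [t Ht]; exists (s ++ t) => q.
rewrite mem_cat => /norP [qs qt].
by rewrite -[LHS]/(a *: f q + g q) Hs // Ht // scaler0 addr0.
Qed.

Definition free_mod : lmodType R := submod fin_supp_submodule.

Definition free_eval (q : Q) : {linear free_mod -> R^o} :=
  mk_linear (fun a (f g : free_mod) =>
    erefl ((val (a *: f + g) : Q -> R^o) q) :
      val (a *: f + g) q = a *: val f q + val g q).

Lemma free_sum_indep (f : Q -> R^o) (s t : seq Q) :
    uniq s -> uniq t -> (forall q, q \notin s -> f q = 0) ->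
    (forall q, q \notin t -> f q = 0) ->
  \sum_(q <- s) (f q : R) *: q = \sum_(q <- t) (f q : R) *: q.
Proof.
have E r : \sum_(q <- r) (f q : R) *: q
    = \sum_(q <- [seq q <- r | f q != 0]) (f q : R) *: q.
  rewrite big_filter (bigID (fun q => f q != 0)) /= [X in _ + X]big1 ?addr0 //.
  by move=> q /negPn /eqP ->; rewrite scale0r.
move=> us ut Hs Ht; rewrite E [RHS]E; apply: perm_big; apply: uniq_perm.
- exact: filter_uniq.
- exact: filter_uniq.
move=> q; rewrite !mem_filter; have [//|fq] := eqVneq (f q) 0.
have [qs|/Hs e] := boolP (q \in s); last by rewrite e eqxx in fq.
by have [//|/Ht e] := boolP (q \in t); rewrite e eqxx in fq.
Qed.

Lemma free_mod_cover : exists g : {linear free_mod -> Q}, forall q, exists f, g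
  f = q.
Proof.
(* Supports are chosen separately for each element; linearity of [g] is therefore checked over a
   list containing all three of them. *)
pose supp (f : free_mod) := undup (sval (cid (submodP f))).
have suppP f q : q \notin supp f -> (val f : Q -> R^o) q = 0.
  by rewrite mem_undup => /(svalP (cid (submodP f))).
pose g f := \sum_(q <- supp f) ((val f : Q -> R^o) q : R) *: q.
have gl : linear g.
  move=> a f h; pose s := undup (supp (a *: f + h) ++ supp f ++ supp h).
  have us : uniq s by exact: undup_uniq.
  have gE (k : free_mod) : {subset supp k <= s} ->
      g k = \sum_(q <- s) ((val k : Q -> R^o) q : R) *: q.
    move=> ks; apply: free_sum_indep => // [||q].
    - exact: undup_uniq.
    - exact: suppP.
    by move=> qs; apply: suppP; apply: contra qs; apply: ks.
  rewrite !gE; first last.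
  - by move=> q qk; rewrite mem_undup !mem_cat qk.
  - by move=> q qk; rewrite mem_undup !mem_cat qk orbT.
  - by move=> q qk; rewrite mem_undup !mem_cat qk !orbT.
  rewrite scaler_sumr -big_split; apply: eq_bigr => q _ /=.
  by rewrite scalerA -scalerDl.
exists (mk_linear gl) => q /=.
pose d : Q -> R^o := fun q' => if q' == q then 1 else 0.
have fd : fin_supp d.
  by exists [:: q] => q'; rewrite mem_seq1 /d => /negPf ->.
exists (@to_submod R (Q -> R^o) _ fin_supp_submodule d fd); rewrite /g /=.
rewrite (@free_sum_indep d _ [:: q]) ?undup_uniq //.
- by rewrite big_seq1 /d eqxx scale1r.
- exact: (suppP (@to_submod R (Q -> R^o) _ fin_supp_submodule d fd)).
- by move=> q'; rewrite mem_seq1 /d => /negPf ->.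
Qed.

End FreeModule.

Section MatrixAction.
Variable S : pzRingType.

(* The product [m A] of a row vector over a right module and a matrix. *)
Definition mact (M : lmodType S^c) n p (A : 'M[S]_(n, p)) (m : 'I_n -> M)
  (l : 'I_p) : M := \sum_k (A k l : S^c) *: m k.

Lemma mactA (M : lmodType S^c) n p q (A : 'M[S]_(n, p)) (B : 'M[S]_(p, q))
    (m : 'I_n -> M) : mact B (mact A m) =1 mact (A *m B) m.
Proof.
move=> l; rewrite /mact.
under eq_bigr do rewrite scaler_sumr.
rewrite exchange_big /=; apply: eq_bigr => j _; rewrite mxE scaler_suml.
by apply: eq_bigr => k _; rewrite scalerA.
Qed.

Lemma eq_mact (M : lmodType S^c) n p (A : 'M[S]_(n, p)) (m m' : 'I_n -> M) :
  m =1 m' -> mact A m =1 mact A m'.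
Proof. by move=> e l; apply: eq_bigr => k _; rewrite e. Qed.

Lemma mact_linear (M N : lmodType S^c) (f : {linear M -> N}) n p
    (A : 'M[S]_(n, p)) (m : 'I_n -> M) l :
  f (mact A m l) = mact A (f \o m) l.
Proof. by rewrite linear_sum; apply: eq_bigr => k _; rewrite linearZ. Qed.

Lemma mactB (M : lmodType S^c) n p (A : 'M[S]_(n, p)) (m m' : 'I_n -> M) l :
  mact A (fun k => m k - m' k) l = mact A m l - mact A m' l.
Proof. by rewrite -sumrB; apply: eq_bigr => k _; rewrite scalerBr. Qed.

Lemma mact0 (M : lmodType S^c) n p (A : 'M[S]_(n, p)) (m : 'I_n -> M) l :
  (forall k, m k = 0) -> mact A m l = 0.
Proof. by move=> m0; apply: big1 => k _; rewrite m0 scaler0. Qed.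

Lemma mactm0 (M : lmodType S^c) n p (m : 'I_n -> M) (l : 'I_p) :
  mact (0 : 'M[S]_(n, p)) m l = 0.
Proof. by apply: big1 => k _; rewrite mxE scale0r. Qed.

Lemma mact_submodule (M : lmodType S^c) (U : M -> Prop) n p
    (A : 'M[S]_(n, p)) (m : 'I_n -> M) l :
  submodule U -> (forall k, U (m k)) -> U (mact A m l).
Proof.
move=> [U0 UD] Um; apply: big_ind => // [x y Ux Uy|k _].
  by rewrite -[x]scale1r; apply: UD.
by rewrite -[_ *: _]addr0; apply: UD.
Qed.

Variables (X : complex S) (r : int -> nat) (v : forall i, 'I_(r i) -> X i).
Variable c : forall i, 'I_(r i) -> {linear X i -> S^o}.
Hypothesis vc : forall i, dual_basis (@v i) (@c i).

Definition idem_mx i : 'M[S]_(r i) := \matrix_(k, l) c l (v k).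
Definition diff_mx i : 'M[S]_(r i, r (i + 1)) :=
  \matrix_(k, l) c l (cdiff X i (v k)).

Lemma c_sum i (M : lmodType S) (f : {linear X i -> M}) x :
  f x = \sum_k (c k x : S) *: f (v k).
Proof. by rewrite {1}[x]vc linear_sum; apply: eq_bigr => k _;
  rewrite linearZ. Qed.

Lemma idem_diff_mx i : idem_mx i *m diff_mx i = diff_mx i.
Proof.
apply/matrixP=> j l; rewrite !mxE [RHS](c_sum (c l \o cdiff X i)).
by apply: eq_bigr => k _; rewrite !mxE.
Qed.

Lemma diff_idem_mx i : diff_mx i *m idem_mx (i + 1) = diff_mx i.
Proof.
apply/matrixP=> j l; rewrite !mxE [RHS](c_sum (c l)).
by apply: eq_bigr => k _; rewrite !mxE.
Qed.

Lemma diff_diff_mx i : diff_mx i *m diff_mx (i + 1) = 0.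
Proof.
apply/matrixP=> j l; rewrite !mxE.
transitivity (c l (cdiff X (i + 1) (cdiff X i (v j)))).
  rewrite [RHS](c_sum (c l \o cdiff X (i + 1))).
  by apply: eq_bigr => k _; rewrite !mxE.
by rewrite cdiffK linear0.
Qed.

Lemma idem_idem_mx i : idem_mx i *m idem_mx i = idem_mx i.
Proof.
apply/matrixP=> j l; rewrite !mxE [RHS](c_sum (c l)).
by apply: eq_bigr => k _; rewrite !mxE.
Qed.

(* Vanishing of [H^(i + 1)(U (x) X)] for a submodule [U] of [M]: the elements
   of [U (x) X^i] are the row vectors over [U] fixed by [idem_mx i]. *)
Definition mexact (M : lmodType S^c) (U : M -> Prop) (i : int) : Prop :=
  forall m : 'I_(r (i + 1)) -> M, (forall k, U (m k)) ->
    mact (idem_mx (i + 1)) m =1 m ->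
    (forall l, mact (diff_mx (i + 1)) m l = 0) ->
  exists m' : 'I_(r i) -> M, (forall k, U (m' k)) /\ mact (diff_mx i) m' =1 m.

Definition whole (M : lmodType S^c) (x : M) : Prop := True.
Arguments whole : clear implicits.

(** Over [eRe] itself, here [S], a row vector fixed by [idem_mx] is the coordinate vector of an
    element of [X], and the matrix action is the differential. *)
Lemma mexact_regular i : cohomology_vanishes X i -> mexact (whole (S^c)^o) i.
Proof.
move=> vX m _ Em Dm; pose x : X (i + 1) := \sum_k (m k : S) *: v k.
have cx (M : lmodType S) (f : {linear X (i + 1) -> M}) :
    f x = \sum_k (m k : S) *: f (v k).
  by rewrite linear_sum; apply: eq_bigr => k _; rewrite linearZ.
have [|y dy] := vX x.
  rewrite [LHS](@vc (i + 1 + 1)) big1 // => l _.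
  have -> : (c l (cdiff X (i + 1) x) : S) = mact (diff_mx (i + 1)) m l.
    by rewrite [LHS](cx _ (c l \o cdiff X (i + 1))); apply: eq_bigr => k _;
      rewrite !mxE.
  by rewrite Dm scale0r.
exists (fun k => c k y); split=> // l.
rewrite -[RHS]Em.
transitivity (c l (cdiff X i y) : S).
  by rewrite [RHS](c_sum (c l \o cdiff X i)); apply: eq_bigr => k _;
    rewrite !mxE.
by rewrite dy cx; apply: eq_bigr => k _; rewrite !mxE.
Qed.

Lemma mexact_free (Q : lmodType S^c) i :
  mexact (whole (S^c)^o) i -> mexact (whole (free_mod Q)) i.
Proof.
move=> exS m _ Em Dm.
(* The equation is solved separately at each basis element [q]. Choosing [w = 0] where the data
   vanish keeps the solution finitely supported. *)
have ex_w q : exists w : 'I_(r i) -> (S^c)^o,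
    mact (diff_mx i) w =1 (fun k => free_eval q (m k)) /\
    ((forall k, free_eval q (m k) = 0) -> forall k, w k = 0).
  have [m0|mN0] := pselect (forall k, free_eval q (m k) = 0).
    by exists (fun _ => 0); split=> // l; rewrite m0 mact0.
  have [//||l|w [_ Hw]] := exS (fun k => free_eval q (m k)).
  - by move=> l; rewrite -[RHS](congr1 (free_eval q) (Em l)) mact_linear.
  - by rewrite -[LHS](mact_linear (free_eval q)) Dm linear0.
  by exists w.
pose w q := sval (cid (ex_w q)).
have wP q := svalP (cid (ex_w q)).
have ws k : fin_supp (fun q => w q k).
  have sm j : exists s : seq Q, forall q, q \notin s -> free_eval q (m j) = 0.
    by have [s Hs] := submodP (m j); exists s.
  have /choice [s Hs] := sm.
  exists (flatten [seq s j | j <- enum 'I_(r (i + 1))]) => q qs.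
  apply: (wP q).2 => j; apply: Hs; apply: contra qs => qs.
  by apply/flattenP; exists (s j) => //; apply: map_f; rewrite mem_enum.
exists (fun k => @to_submod S^c (Q -> (S^c)^o) _ (fin_supp_submodule Q) _ (ws
  k)).
split=> // l; apply: val_inj; apply: funext => q.
rewrite -[LHS]/(free_eval q _) mact_linear -[RHS]/(free_eval q (m l)).
by rewrite -[RHS](wP q).1.
Qed.

Lemma mexact_projective (Q : lmodType S^c) i :
  projective Q -> cohomology_vanishes X i -> mexact (whole Q) i.
Proof.
move=> pQ /mexact_regular /(@mexact_free Q) exF m _ Em Dm.
have [g gs] := @free_mod_cover _ Q.
have [h gh] := pQ _ _ g idfun gs.
have [//|l|l|m' [_ Hm']] := exF (h \o m).
- by rewrite -mact_linear Em.
- by rewrite -mact_linear Dm linear0.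
exists (g \o m'); split=> // l.
by rewrite -mact_linear Hm'; apply: gh.
Qed.

Definition ker (A B : lmodType S^c) (g : {linear A -> B}) x := g x = 0.
Definition im (A B : lmodType S^c) (g : {linear A -> B}) y := exists x, g x = y.

Lemma ker_submodule (A B : lmodType S^c) (g : {linear A -> B}) :
  submodule (ker g).
Proof.
split=> [|a x y gx gy]; first exact: linear0.
by rewrite /ker linearP gx gy scaler0 addr0.
Qed.

(** Dimension shift along the sequence from [ker g] through [Q] to [im g], which stays exact after
    tensoring with the projective terms of [X]. In the long exact sequence the cohomology of the
    image lies between that of [Q] in the same degree and that of the kernel one degree higher. *)
Lemma mexact_im (Q M : lmodType S^c) (g : {linear Q -> M}) i :
  mexact (ker g) (i + 1) -> mexact (whole Q) i -> mexact (im g) i.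
Proof.
move=> exK exQ m /choice [q0 Hq0] Em Dm.
pose q := mact (idem_mx (i + 1)) q0.
have gq l : g (q l) = m l.
  by rewrite mact_linear -[RHS]Em; apply: eq_mact.
have Eq : mact (idem_mx (i + 1)) q =1 q.
  by move=> l; rewrite mactA idem_idem_mx.
pose dq := mact (diff_mx (i + 1)) q.
(* The lift [q] of a cocycle need not be a cocycle; its differential is a cocycle over [ker g],
   hence bounds some [k0] there, and [q - k] is the corrected lift. *)
have [l|l|l|k0 [Uk0 Hk0]] := exK dq.
- by rewrite /ker mact_linear -[RHS](Dm l); apply: eq_mact.
- by rewrite mactA diff_idem_mx.
- by rewrite mactA diff_diff_mx mactm0.
pose k := mact (idem_mx (i + 1)) k0.
have Uk l : g (k l) = 0 by apply: (mact_submodule (U := ker g)) => //;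
  apply: ker_submodule.
have [//|l|l|q' [_ Hq']] := exQ (fun l => q l - k l).
- by rewrite mactB Eq [X in _ - X]mactA idem_idem_mx.
- by rewrite mactB [X in _ - X]mactA idem_diff_mx Hk0 subrr.
exists (g \o q'); split=> [l|l]; first by exists (q' l).
by rewrite -mact_linear Hq' linearB Uk gq subr0.
Qed.

Lemma mexact_eq (M : lmodType S^c) (U V : M -> Prop) i :
  (forall x, U x <-> V x) -> mexact U i -> mexact V i.
Proof.
move=> UV exU m Vm Em Dm; have [k|//|//|m' [Um' Hm']] := exU m.
  by apply/UV.
by exists m'; split=> // k; apply/UV.
Qed.

Lemma mexact_finite_pd (M : lmodType S^c) (N : int) :
    finite_projective_dimension M ->
    (forall i, i < N -> cohomology_vanishes X i) ->
  exists N', forall i, i < N' -> mexact (whole M) i.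
Proof.
move=> [P [n P0]] vX.
(* Here [k] bounds the number of steps left until the resolution becomes zero. Each step replaces an
   image by the next kernel and moves the bound on the degree down by one; the augmentation accounts
   for one further step. *)
have exP (k j : nat) : (n <= j + k)%N -> forall i, i < N - k%:Z ->
    mexact (im (res_diff P j)) i.
  elim: k j => [|k IHk] j le_n i lt_i.
    move=> m Um _ _; have m0 l : m l = 0.
      by have [x <-] := Um l; rewrite [x]P0 ?linear0 //; lia.
    exists (fun _ => 0); split=> [l|l]; last by rewrite m0 mact0.
    by exists 0; rewrite linear0.
  apply: mexact_im; last first.
    by apply: mexact_projective; [apply: res_projective|apply: vX; lia].
  apply: (mexact_eq (U := im (res_diff P j.+1))).
    by move=> x; split=> /res_exactS.
  by apply: IHk; lia.
exists (N - n%:Z - 1) => i lt_i.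
apply: (mexact_eq (U := im (res_aug P))) => [x|].
  by split=> // _; apply: res_aug_surj.
apply: mexact_im; last first.
  by apply: mexact_projective; [apply: res_projective|apply: vX; lia].
apply: (mexact_eq (U := im (res_diff P 0))).
  by move=> x; split=> /res_exact0.
by apply: (exP n); lia.
Qed.

End MatrixAction.

(** * The functor on complexes *)

Section IlamComplexes.
Variables (R : pzRingType) (e : R) (he : e * e = e).

Local Notation S := (corner he).
Local Notation Re := (left_corner he).

(** The coordinates [f i l] identify [tensor (X i)] with row vectors over [Re] fixed by the
    idempotent matrix, and [fmap] turns [tensor_map] into the matrix action, so the claim becomes
    [mexact] for [Re]. *)
Lemma ilam_vanishes (X : complex S) (N : int) :
    @finite_projective_dimension S^c (left_corner_right he) ->
    in_proj X -> (forall i, i < N -> cohomology_vanishes X i) ->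
  exists N', forall i, i < N' -> cohomology_vanishes (ilam X) i.
Proof.
move=> fpd pX vX.
have db i : exists n (v : 'I_n -> X i) c, dual_basis v c.
  by have [fX prX] := pX i; apply: dual_basis_exists.
pose r i := sval (cid (db i)).
pose v i : 'I_(r i) -> X i := sval (cid (svalP (cid (db i)))).
pose c i : 'I_(r i) -> {linear X i -> S^o} :=
  sval (cid (svalP (cid (svalP (cid (db i)))))).
have vc i : dual_basis (@v i) (@c i) :=
  svalP (cid (svalP (cid (svalP (cid (db i)))))).
have [N' exM] := mexact_finite_pd vc fpd vX.
have f_ex i l := tensor_coord_exists (@c i l).
pose f i l := sval (cid (f_ex i l)).
have fE i l a x : f i l (ptens a x) = Re_rscale a (c i l x) :=
  svalP (cid (f_ex i l)) a x.
have tE i t : t = \sum_l ptens (f i l t) (v i l).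
  elim/ptens_ind: t => [|a x t IH].
    rewrite big1 // => l _; rewrite linear0.
    by apply: (addrI (ptens 0 (v i l))); rewrite -ptensDl !addr0.
  rewrite {1}IH {1}(vc i x) ptens_sumr -big_split; apply: eq_bigr => l _ /=.
  by rewrite linearD ptensDl fE ptens_balanced.
have fmap i j (g : {linear X i -> X j}) (A : 'M[S]_(r i, r j)) t l :
    (forall k, A k l = c j l (g (v i k))) ->
    f j l (tensor_map g t) =
      mact A (fun k => f i k t : left_corner_right he) l.
  move=> HA; rewrite {1}[t]tE !linear_sum; apply: eq_bigr => k _.
  by rewrite /= tensor_map_pure fE -HA.
exists N' => i lt_i t dt.
have [//|l|l|m' [_ Hm']] := exM i lt_i (fun k => f (i + 1) k t).
- rewrite -(@fmap (i + 1) (i + 1) idfun) => [|k]; last by rewrite mxE.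
  by rewrite tensor_map_id.
- rewrite -(@fmap (i + 1) (i + 1 + 1) (cdiff X (i + 1))) => [|k];
  last by rewrite mxE.
  by rewrite [tensor_map _ t]dt linear0.
exists (\sum_k ptens (m' k : Re) (v i k)).
rewrite linear_sum [RHS]tE.
under eq_bigr => k _.
  rewrite /= tensor_map_pure [X in ptens _ X]vc ptens_sumr.
  under eq_bigr do rewrite -ptens_balanced.
  over.
rewrite exchange_big /=; apply: eq_bigr => l _; rewrite -ptens_suml.
congr (ptens _ _); rewrite -[RHS](Hm' l); apply: eq_bigr => k _.
by rewrite /diff_mx mxE.
Qed.

Lemma ilam_in_Kmb (X : complex S) :
  @finite_projective_dimension S^c (left_corner_right he) ->
  in_Kmb X -> in_Kmb (ilam X).
Proof.
move=> fpd [pX [k X0] [m [n vX]]].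
have X0' i : k < i -> zero_module (ilam X i).
  move=> ki; elim/ptens_ind=> [//|a x t ->].
  rewrite [x]X0 // addr0; apply: (addrI (ptens a 0)).
  by rewrite -ptensDr !addr0.
split.
- by move=> i; have [fX prX] := pX i; apply: tensor_fg_projective.
- by exists k.
have [i lt_im|N HN] := @ilam_vanishes X m fpd pX; first by apply: vX; left.
exists N, k => i [lt_iN|lt_ki]; first exact: HN.
by move=> t _; exists 0; rewrite linear0; apply/esym/X0'; lia.
Qed.

Lemma ilam_left_contractible (X : complex S) :
  left_contractible X -> left_contractible (ilam X).
Proof.
move=> [s [n Hs]].
exists (fun i => tensor_map (s i) : {linear tensor (X (i + 1)) -> tensor (X
  i)}), n.
move=> i t lt_in /=.
rewrite (@tensor_map_comp _ _ _ _ _ _ _ _ (cdiff X i \o s i)) //.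
rewrite (@tensor_map_comp _ _ _ _ _ _ _ _ (s (i + 1) \o cdiff X (i + 1))) //.
rewrite (@tensor_map_add _ _ _ _ _ _ _ (idfun : {linear X (i + 1) -> X (i +
  1)})).
  by rewrite tensor_map_id.
by move=> x /=; rewrite -Hs.
Qed.

(** A zigzag of quasi-isomorphisms through arbitrary complexes need not survive tensoring, whereas a
    contraction does. *)
Lemma ilam_perfect (X : complex S) :
  @finite_projective_dimension S^c (left_corner_right he) ->
  in_Kmb X -> perfect X -> perfect (ilam X).
Proof.
move=> fpd KX pX; have [pL bL _] := ilam_in_Kmb fpd KX.
by apply: left_contractible_perfect => //;
  apply/ilam_left_contractible/perfect_left_contractible.
Qed.

Program Definition germ_ilam (X Y : complex S) (f : germ X Y) :
    germ (ilam X) (ilam Y) :=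
  @Germ R (ilam X) (ilam Y) (fun i => tensor_map (f i)) _.
Next Obligation.
move=> X Y [f [n fC]]; exists n => i x lt_in /=.
rewrite (@tensor_map_comp _ _ _ _ _ _ _ _ (f (i + 1) \o cdiff X i)) //.
by rewrite (@tensor_map_comp _ _ _ _ _ _ _ _ (f (i + 1) \o cdiff X i)) // => y
  /=;
  rewrite fC.
Qed.

Lemma tensor_homotopyE (X Y : complex S) (f g : germ X Y)
    (s : forall i, {linear X (i + 1) -> Y i}) i :
  (forall x, f (i + 1) x - g (i + 1) x
      = cdiff Y i (s i x) + s (i + 1) (cdiff X (i + 1) x)) <->
  (forall t, germ_ilam f (i + 1) t - germ_ilam g (i + 1) t
      = cdiff (ilam Y) i (tensor_map (s i) t)
        + tensor_map (s (i + 1)) (cdiff (ilam X) (i + 1) t)).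
Proof.
pose A : {linear X (i + 1) -> Y (i + 1)} := f (i + 1) \- g (i + 1).
pose B : {linear X (i + 1) -> Y (i + 1)} :=
  (cdiff Y i \o s i) \+ (s (i + 1) \o cdiff X (i + 1)).
have EA t : germ_ilam f (i + 1) t - germ_ilam g (i + 1) t = tensor_map A t.
  apply/eqP; rewrite subr_eq; apply/eqP/esym.
  by apply: tensor_map_add => x; rewrite /= subrK.
have EB t : cdiff (ilam Y) i (tensor_map (s i) t)
    + tensor_map (s (i + 1)) (cdiff (ilam X) (i + 1) t) = tensor_map B t.
  rewrite /= (@tensor_map_comp _ _ _ _ _ _ _ _ (cdiff Y i \o s i)) //.
  rewrite (@tensor_map_comp _ _ _ _ _ _ _ _ (s (i + 1) \o cdiff X (i + 1))) //.
  exact: tensor_map_add.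
split=> H => [t|]; first by rewrite EA EB; apply: tensor_map_ext.
by apply: (@tensor_map_inj _ _ _ _ _ A B) => t; rewrite -EA -EB.
Qed.

Lemma germ_ilam_eq (X Y : complex S) (f g : germ X Y) :
  germ_eq f g <-> germ_eq (germ_ilam f) (germ_ilam g).
Proof.
split=> [[s [n Hs]]|[s [n Hs]]].
  exists (fun i => tensor_map (s i)), n => i t lt_in.
  by apply: (tensor_homotopyE f g s i).1 => x; apply: Hs.
have ex_s i : exists s' : {linear X (i + 1) -> Y i},
    forall t, tensor_map s' t = s i t by apply: tensor_map_full.
pose s' i := sval (cid (ex_s i)).
have Hs' i : forall t, tensor_map (s' i) t = s i t := svalP (cid (ex_s i)).
exists s', n => i x lt_in; apply: (tensor_homotopyE f g s' i).2 => t.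
by rewrite !Hs'; apply: Hs.
Qed.

Lemma germ_ilam_full (X Y : complex S) (f : germ (ilam X) (ilam Y)) :
  exists g : germ X Y, germ_eq (germ_ilam g) f.
Proof.
have ex_g i : exists g : {linear X i -> Y i}, forall t, tensor_map g t = f i t.
  exact: tensor_map_full.
pose g i := sval (cid (ex_g i)).
have Hg i : forall t, tensor_map (g i) t = f i t := svalP (cid (ex_g i)).
have gC : exists n, forall i x, i < n -> g (i + 1) (cdiff X i x) = cdiff Y i (g
  i x).
  have [n fC] := gmapC f; exists n => i x lt_in.
  move: x; apply: (@tensor_map_inj _ _ _ _ _ (g (i + 1) \o cdiff X i)
    (cdiff Y i \o g i)) => t.
  rewrite -(@tensor_map_comp _ _ _ _ _ _ (g (i + 1)) (cdiff X i)) // Hg.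
  rewrite -(@tensor_map_comp _ _ _ _ _ _ (cdiff Y i) (g i)) // Hg.
  exact: fC.
by exists (Germ gC); apply: (@germ_eq_ext _ _ _ _ _ 0) => i t _; apply: Hg.
Qed.

Program Definition Germs_ilam : functor (Germs S) (Germs R) :=
  @Functor (Germs S) (Germs R) (@ilam R e he) germ_ilam _ _ _.
Next Obligation. by move=> X Y f g /germ_ilam_eq. Qed.
Next Obligation.
by move=> X; apply: (@germ_eq_ext _ _ _ _ _ 0) => i t _; apply: tensor_map_id.
Qed.
Next Obligation.
move=> X Y Z g f; apply: (@germ_eq_ext _ _ _ _ _ 0) => i t _.
by apply/esym; apply: tensor_map_comp.
Qed.

Section Induced.
Hypothesis ilamK : forall X : complex S, in_Kmb X -> in_Kmb (ilam X).
Hypothesis ilamP : forall X : complex S,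
  in_Kmb X -> perfect X -> perfect (ilam X).

Local Notation F := (Dsg_ilam ilamK ilamP).

Lemma Dsg_germ_ilam (X Y : Dsg S) (f : mor X Y) :
  fhom (Dsg_germ R) (fhom F f) =h fhom Germs_ilam (fhom (Dsg_germ S) f).
Proof.
elim: f => {X Y} [X Y g|X Y g Sg|X Y Z g IHg f IHf].
- exact: (@germ_eq_ext _ _ _ _ _ 0).
(* The inverses on the two sides are chosen independently, so they are compared through uniqueness
   of inverses. *)
- set c := fhom (Dsg_germ S) (loc_inv Sg : @mor (Dsg S) Y X).
  set d := fhom (Dsg_germ R) _.
  have [cg gc] : germ_eq (germ_comp c (germ_of g)) (germ_id X) /\
    germ_eq (germ_comp (germ_of g) c) (germ_id Y).
    by rewrite /c /=; case: cid.
  have [dg gd] : germ_eq (germ_comp d (germ_of (ilam_map g))) (germ_id (ilam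
    X)) /\
    germ_eq (germ_comp (germ_of (ilam_map g)) d) (germ_id (ilam Y)).
    by rewrite /d /=; case: cid.
  apply: (@inverse_unique (Germs R) _ _ _ _ _ dg).
  apply: heq_trans (heq_sym (fhom_comp Germs_ilam (germ_of g) c)) _.
  exact: heq_trans (fhom_heq Germs_ilam gc) (fhom_id Germs_ilam _).
- apply: heq_trans (comp_heq (c := Germs R) IHg IHf) _.
  exact: heq_sym (fhom_comp Germs_ilam _ _).
Qed.

Lemma Dsg_ilam_faithful (X Y : Dsg S) (f g : mor X Y) :
  fhom F f =h fhom F g -> f =h g.
Proof.
move=> /(fhom_heq (Dsg_germ R)) fg.
apply: Dsg_germ_faithful; apply/germ_ilam_eq.
apply: germ_eq_trans (germ_eq_sym (Dsg_germ_ilam f)) _.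
exact: germ_eq_trans fg (Dsg_germ_ilam g).
Qed.

Lemma Dsg_ilam_full (X Y : Dsg S) (g : mor (F X) (F Y)) :
  exists f : mor X Y, fhom F f =h g.
Proof.
have [h Hh] := @germ_ilam_full (Dsg_germ S X) (Dsg_germ S Y) (fhom (Dsg_germ R)
  g).
have [f Hf] := @Dsg_germ_full S X Y h.
exists f; apply: Dsg_germ_faithful; apply: germ_eq_trans (Dsg_germ_ilam f) _.
apply: germ_eq_trans _ Hh.
exact: (fhom_heq Germs_ilam Hf).
Qed.

End Induced.
End IlamComplexes.

(** * Essential surjectivity *)

Section GermIsomorphisms.
Variable R : pzRingType.

Lemma germ_bijective_iso (X Y : complex R) (f : germ X Y) (n : int) :
  (forall i, i < n -> bijective (f i)) -> @isomorphism (Germs R) X Y f.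
Proof.
move=> bf.
have ex_g i : exists g : {linear Y i -> X i}, i < n -> cancel (f i) g /\ cancel
  g (f i).
  have [lt_in|_] := ltP i n; last by exists \0.
  by have [g Hg] := bijective_linear_inverse (bf i lt_in); exists g.
pose g i := sval (cid (ex_g i)).
have gP i : i < n -> cancel (f i) (g i) /\ cancel (g i) (f i) :=
  svalP (cid (ex_g i)).
have gC : exists k, forall i x, i < k -> g (i + 1) (cdiff Y i x) = cdiff X i (g
  i x).
  have [m fC] := gmapC f; exists (Num.min m (n - 1)) => i x lt_i.
  have [fg _] : cancel (f (i + 1)) (g (i + 1)) /\ cancel (g (i + 1)) (f (i +
    1)).
    by apply: gP; lia.
  have [_ gf] : cancel (f i) (g i) /\ cancel (g i) (f i) by apply: gP; lia.
  by apply: (can_inj fg); rewrite fC ?gf; [rewrite (gP _ _).2 //|]; lia.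
exists (Germ gC); split; apply: (@germ_eq_ext R _ _ _ _ n) => i x lt_in.
  exact: (gP i lt_in).1.
exact: (gP i lt_in).2.
Qed.

(** The last two conditions say that [g f] and [f g] differ from the identities by maps into
    cocycles, which is what [homotopy_down] needs in order to start in degree [N]. *)
Lemma germ_comparison (X Y : complex R) (N : int)
    (f : {linear X N -> Y N}) (g : {linear Y N -> X N}) :
    (forall i, i <= N -> projective (X i)) ->
    (forall i, i <= N -> projective (Y i)) ->
    (forall i, i < N -> cohomology_vanishes X i) ->
    (forall i, i < N -> cohomology_vanishes Y i) ->
    (forall x, cdiff X N x = 0 -> cdiff Y N (f x) = 0) ->
    (forall y, cdiff Y N y = 0 -> cdiff X N (g y) = 0) ->
    (forall x, cdiff X N (g (f x)) = cdiff X N x) ->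
    (forall y, cdiff Y N (f (g y)) = cdiff Y N y) ->
  exists phi : @mor (Germs R) X Y, isomorphism phi.
Proof.
move=> pX pY vX vY fC gC gf fg.
have pX' i : i < N -> projective (X i) by move=> /ltW; apply: pX.
have pY' i : i < N -> projective (Y i) by move=> /ltW; apply: pY.
have [phi [phiN Hphi]] := extend_down pX' vY fC.
have [psi [psiN Hpsi]] := extend_down pY' vX gC.
have Cphi : exists n, forall i x, i < n ->
    phi (i + 1) (cdiff X i x) = cdiff Y i (phi i x) by exists N.
have Cpsi : exists n, forall i x, i < n ->
    psi (i + 1) (cdiff Y i x) = cdiff X i (psi i x) by exists N.
have [||s Hs] := @homotopy_down R X X N
    (fun i => (psi i \o phi i) \- (idfun : {linear X i -> X i})) pX vX.
- by move=> i x lt_in; rewrite /= Hphi // Hpsi // linearB.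
- by move=> x; rewrite /= phiN psiN linearB gf subrr.
have [||t Ht] := @homotopy_down R Y Y N
    (fun i => (phi i \o psi i) \- (idfun : {linear Y i -> Y i})) pY vY.
- by move=> i x lt_in; rewrite /= Hpsi // Hphi // linearB.
- by move=> x; rewrite /= phiN psiN linearB fg subrr.
by exists (Germ Cphi), (Germ Cpsi); split; [exists s, N|exists t, N].
Qed.

End GermIsomorphisms.

(** * Augmented resolutions as cochain complexes *)

Section ResolutionComplex.
Variables (R : pzRingType) (M : lmodType R) (P : resolution M) (N : int).

Definition aug_term (j : nat) : lmodType R := if j is j'.+1 then P j' else M.

Definition aug_diff (j : nat) : {linear aug_term j.+1 -> aug_term j} :=
  if j is j'.+1 return {linear aug_term j.+1 -> aug_term j} then res_diff P j'
  else res_aug P.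

(* The differential of the augmented resolution, as a map between terms whose
   indices are only provably consecutive; zero for other pairs of indices. *)
Definition aug_map (a b : nat) : {linear aug_term a -> aug_term b} :=
  if a =P b.+1 is ReflectT eab
  then ecast j ({linear aug_term j -> aug_term b}) (esym eab) (aug_diff b)
  else \0.

Lemma aug_mapS b : aug_map b.+1 b = aug_diff b.
Proof. by rewrite /aug_map; case: eqP => // eb;
  rewrite (eq_irrelevance eb erefl). Qed.

Lemma aug_map0 a b x : a <> b.+1 -> aug_map a b x = 0.
Proof. by rewrite /aug_map; case: eqP. Qed.

Lemma aug_diff_exact b (x : aug_term b.+1) :
  aug_diff b x = 0 <-> exists y, aug_diff b.+1 y = x.
Proof. by case: b x => [|b] x; [apply: res_exact0|apply: res_exactS]. Qed.

Lemma aug_map_map a b c x : aug_map b c (aug_map a b x) = 0.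
Proof.
have [eab|nab] := eqVneq a b.+1;
  last by rewrite (aug_map0 _ (elimN eqP nab)) linear0.
have [ebc|nbc] := eqVneq b c.+1; last exact: aug_map0 (elimN eqP nbc).
by subst a; subst b; rewrite !aug_mapS; apply/aug_diff_exact; exists x.
Qed.

Lemma aug_map_exact a b c x : a = b.+1 -> b = c.+1 \/ b = 0%N ->
  aug_map b c x = 0 -> exists y, aug_map a b y = x.
Proof.
move=> -> [eb|eb]; subst b; rewrite !aug_mapS; first by move/aug_diff_exact.
by move=> _; apply: res_aug_surj.
Qed.

(** [M] sits in degree [N + 1] and [P j] in degree [N - j]. Above [N + 1] the absolute value repeats
    the terms with zero differentials, which is harmless since only germs at [-oo] are compared. *)
Program Definition res_complex : complex R :=
  @Complex R (fun i => aug_term (absz (N + 1 - i)%R))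
    (fun i => aug_map (absz (N + 1 - i)%R) (absz (N + 1 - (i + 1))%R)) _.
Next Obligation. by move=> i x; apply: aug_map_map. Qed.

Lemma res_complex_vanishes i : i <= N -> cohomology_vanishes res_complex i.
Proof. by move=> le_iN x; apply: aug_map_exact; lia. Qed.

Lemma res_complex_diff0 (x : res_complex (N + 1)) :
  cdiff res_complex (N + 1) x = 0.
Proof. by apply: aug_map0; lia. Qed.

Lemma res_complexP (Q : lmodType R -> Prop) i : i <= N ->
  Q (P (absz (N - i)%R)) -> Q (res_complex i).
Proof.
move=> le_iN; rewrite /=.
by have -> : absz (N + 1 - i)%R = (absz (N - i)%R).+1 by lia.
Qed.

(** The term in degree [N + 1] is [M] only up to a provable equality of indices; the inverse maps
    [mu] and [nu] hide the transport. *)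
Lemma res_complex_aug : exists (mu : {linear M -> res_complex (N + 1)})
  (nu : {linear res_complex (N + 1) -> M}), cancel mu nu /\ cancel nu mu.
Proof.
rewrite /=; have -> : absz (N + 1 - (N + 1))%R = 0%N by lia.
by exists idfun, idfun.
Qed.

End ResolutionComplex.

Section EssentiallySurjective.
Variables (R : pzRingType) (e : R) (he : e * e = e).

Local Notation S := (corner he).

Hypothesis add_res : forall M : lmodType R, finitely_generated M ->
  exists P : resolution M, (forall i, finitely_generated (P i)) /\
    exists n : nat, forall i, (n <= i)%N -> in_add_Re he (P i).

Lemma add_Re_germ (Z : complex R) : in_Kmb Z ->
  exists (C : complex R) (n : int) (phi : @mor (Germs R) C Z),
    [/\ isomorphism phi, forall i, i < n -> in_add_Re he (C i) &
        forall i, i < n -> cohomology_vanishes C i].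
Proof.
(* With [N = m - 1] the part of [Z] in degrees at most [N] is a projective resolution of the module
   [B] of coboundaries in degree [N + 1], which is finitely generated as a quotient of [Z N]. *)
move=> [pZ _ [m [m' vZ]]]; pose N := m - 1.
have vZN i : i <= N -> cohomology_vanishes Z i.
  by move=> le_iN; apply: vZ; left; rewrite /N in le_iN; lia.
pose B (z : Z (N + 1)) := exists y, cdiff Z N y = z.
have hB : submodule B.
  split=> [|a _ _ [y <-] [y' <-]]; first by exists 0; rewrite linear0.
  by exists (a *: y + y'); rewrite linearP.
have dB x : B (cdiff Z N x) by exists x.
pose d0 : {linear Z N -> submod hB} := corestrict hB dB.
have fgM : finitely_generated (submod hB).
  have [[k [v Hv]] _] := pZ N; exists k, (fun i => d0 (v i)) => z.
  have [y ey] := submodP z; have [c Hc] := Hv y; exists c.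
  have -> : z = d0 y by apply: val_inj; rewrite /= ey.
  by rewrite Hc linear_sum; apply: eq_bigr => i _; rewrite linearZ.
have [P [fgP [n addP]]] := add_res fgM.
pose C := res_complex P N.
have [mu [nu [muK nuK]]] := res_complex_aug P N.
have pC i : i <= N -> projective (C i).
  by move=> le_iN; apply: (res_complexP (Q := @projective R)) => //;
    apply: res_projective.
(* [f] and [g] lift the identity of [B] to the first terms of its two resolutions, in the two
   directions. *)
have [x|f Hf] := @proj_lift R _ _ _ (cdiff C N) (mu \o d0) (pZ N).2.
  by apply: res_complex_vanishes => //; apply: res_complex_diff0.
have [x|g Hg] := @proj_lift R _ _ _ (cdiff Z N) (val_lin hB \o (nu \o cdiff C
  N))
    (pC N (lexx N)).
  exact: (submodP (nu (cdiff C N x))).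
have d0g y : d0 (g y) = nu (cdiff C N y).
  by apply: val_inj; rewrite [LHS]Hg.
have [||||||||phi iphi] := @germ_comparison R C Z N g f.
- exact: pC.
- by move=> i _; have [] := pZ i.
- by move=> i /ltW; apply: res_complex_vanishes.
- by move=> i /ltW; apply: vZN.
- by move=> y dy; rewrite Hg /= dy !linear0.
- move=> x dx; rewrite Hf /=; have -> : d0 x = 0 by apply: val_inj.
  exact: linear0.
- by move=> y; rewrite Hf /= d0g nuK.
- by move=> x; rewrite Hg /= Hf muK.
exists C, (N - n%:Z), phi; split=> // i lt_i.
  by apply: (res_complexP (Q := @in_add_Re R e he)); [lia|apply: addP; lia].
by apply: res_complex_vanishes; lia.
Qed.

Lemma ilam_germ_dense (Z : complex R) : in_Kmb Z ->
  exists (W : complex S) (phi : @mor (Germs R) (ilam W) Z),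
    in_Kmb W /\ isomorphism phi.
Proof.
move=> /add_Re_germ [C [n [phi [iphi addC vC]]]].
(* The terms of [E] are known to be finitely generated projective only below [n], and [E] is not
   bounded above; cutting at [n - 1] mends both without changing the germ. *)
pose E := corner_complex he C; pose W := truncation E (n - 1).
exists W.
have KW : in_Kmb W.
  apply: in_Kmb_trunc => [i|]; last first.
    by exists n => i lt_in; apply: corner_complex_vanishes; apply: vC.
  have [lt_in|le_ni] := ltP i n.
    have [fE pE] := add_Re_corner_projective (addC i lt_in).
    have K := @of_truncK S E (n - 1) i.
    by split; [apply: retract_fg K fE|apply: retract_projective K pE].
  have W0 : zero_module (W i) by apply: truncation0; lia.
  by split; [apply: zero_fg|apply: zero_projective].
have cC : exists k, forall i x, i < k ->
    counit he (C (i + 1)) (cdiff (ilam E) i x) = cdiff C i (counit he (C i) x).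
  by exists 0 => i x _; apply: counit_natural.
pose ep : @mor (Germs R) (ilam E) C := Germ cC.
have iep : isomorphism ep.
  apply: (@germ_bijective_iso R _ _ _ n) => i lt_in.
  by apply: add_Re_counit_bijective; apply: addC.
pose tau : @mor (Germs S) E W := germ_of (trunc_map E (n - 1)).
have itau : isomorphism tau.
  apply: (@germ_bijective_iso S _ _ _ n) => i lt_in.
  exists (@of_trunc S E (n - 1) i) => x; last exact: of_truncK.
  by apply: trunc_proj_id; lia.
have [rho [rho_tau tau_rho]] := itau.
have irho : isomorphism rho by exists tau.
exists (phi \oh (ep \oh fhom (Germs_ilam he) rho)); split=> //.
by apply: iso_comp => //; apply: iso_comp => //;
  exact: (functor_iso (Germs_ilam he) irho).
Qed.

End EssentiallySurjective.

(** * Equivalences *)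

Section FullyFaithful.
Variables (C D : category) (F : functor C D).
Hypothesis faithfulF : forall (X Y : C) (f g : mor X Y),
  fhom F f =h fhom F g -> f =h g.
Hypothesis fullF : forall (X Y : C) (g : mor (F X) (F Y)),
  exists f : mor X Y, fhom F f =h g.

Lemma ff_reflects_iso (X Y : C) (f : mor X Y) :
  isomorphism (fhom F f) -> isomorphism f.
Proof.
move=> [g [gf fg]]; have [h Hh] := fullF g.
exists h; split; apply: faithfulF.
  apply: heq_trans (fhom_comp F _ _) _.
  apply: heq_trans (comp_heq Hh (heq_refl _)) _.
  exact: heq_trans gf (heq_sym (fhom_id F _)).
apply: heq_trans (fhom_comp F _ _) _.
apply: heq_trans (comp_heq (heq_refl _) Hh) _.
exact: heq_trans fg (heq_sym (fhom_id F _)).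
Qed.

Hypothesis denseF : forall Y : D,
  exists (X : C) (f : mor (F X) Y), isomorphism f.

Let qob (Y : D) : C := sval (cid (denseF Y)).
Let eps (Y : D) : mor (F (qob Y)) Y := sval (cid (svalP (cid (denseF Y)))).
Let eps_iso (Y : D) : isomorphism (eps Y) :=
  svalP (cid (svalP (cid (denseF Y)))).

Let ex_qhom (X Y : D) (h : mor X Y) :
  exists f : mor (qob X) (qob Y), eps Y \oh fhom F f =h h \oh eps X.
Proof.
have [d [de ed]] := eps_iso Y; have [f Hf] := fullF (d \oh (h \oh eps X)).
exists f; apply: heq_trans (comp_heq (heq_refl _) Hf) _.
apply: heq_trans (Defs.compA _ _ _) _.
exact: heq_trans (comp_heq ed (heq_refl _)) (comp1m _).
Qed.

Let qhom (X Y : D) (h : mor X Y) : mor (qob X) (qob Y) :=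
  sval (cid (ex_qhom h)).

Let qhomP (X Y : D) (h : mor X Y) : eps Y \oh fhom F (qhom h) =h h \oh eps X :=
  svalP (cid (ex_qhom h)).

Let qhom_unique (X Y : D) (h : mor X Y) (f : mor (qob X) (qob Y)) :
  eps Y \oh fhom F f =h h \oh eps X -> qhom h =h f.
Proof.
move=> Hf; apply: faithfulF; apply: (iso_cancel (eps_iso Y)).
exact: heq_trans (qhomP h) (heq_sym Hf).
Qed.

Program Definition quasi_inverse : functor D C :=
  @Functor D C qob qhom _ _ _.
Next Obligation.
move=> X Y f g fg; apply: qhom_unique; apply: heq_trans (qhomP g) _.
exact: comp_heq (heq_sym fg) (heq_refl _).
Qed.
Next Obligation.
move=> X; apply: qhom_unique.
apply: heq_trans (comp_heq (heq_refl _) (fhom_id F _)) _.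
exact: heq_trans (compm1 _) (heq_sym (comp1m _)).
Qed.
Next Obligation.
move=> X Y Z g f; apply: qhom_unique.
apply: heq_trans (comp_heq (heq_refl _) (fhom_comp F _ _)) _.
apply: heq_trans (Defs.compA _ _ _) _.
apply: heq_trans (comp_heq (qhomP g) (heq_refl _)) _.
apply: heq_trans (heq_sym (Defs.compA _ _ _)) _.
apply: heq_trans (comp_heq (heq_refl _) (qhomP f)) _.
exact: Defs.compA.
Qed.

Lemma fully_faithful_dense_equivalence : equivalence F.
Proof.
exists quasi_inverse; split.
  pose a (X : C) : mor (qob (F X)) X := sval (cid (fullF (eps (F X)))).
  have aP X : fhom F (a X) =h eps (F X) := svalP (cid (fullF (eps (F X)))).
  exists a; split=> [X Y f|X]; last first.
    apply: ff_reflects_iso; have [d [de ed]] := eps_iso (F X); exists d; split.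
      exact: heq_trans (comp_heq (heq_refl _) (aP X)) de.
    exact: heq_trans (comp_heq (aP X) (heq_refl _)) ed.
  apply: faithfulF; apply: heq_trans (fhom_comp F _ _) _.
  apply: heq_trans (comp_heq (aP Y) (heq_refl _)) _.
  apply: heq_trans (qhomP (fhom F f)) _.
  apply: heq_trans (comp_heq (heq_refl _) (heq_sym (aP X))) _.
  exact: heq_sym (fhom_comp F f (a X)).
exists eps; split; last exact: eps_iso.
by move=> X Y h; apply: qhomP.
Qed.

End FullyFaithful.

(** Naturality squares of composites are pasted, and that of an inverse is obtained by inverting the
    square of the morphism, since [G] and [H] send it to isomorphisms. *)
Lemma natural_localization (C D : category)
    (S : forall X Y : C, mor X Y -> Prop) (G H : functor (localization S) D)
    (a : forall X, mor (G X) (H X)) :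
    (forall (X Y : C) (f : mor X Y),
       a Y \oh fhom G (loc_mor S f : @mor (localization S) X Y)
         =h fhom H (loc_mor S f : @mor (localization S) X Y) \oh a X) ->
  natural a.
Proof.
move=> aC X Y f; elim: f => {X Y} [X Y g|X Y g Sg|X Y Z g IHg f IHf].
- exact: aC.
- pose m : @mor (localization S) X Y := loc_mor S g.
  pose w : @mor (localization S) Y X := loc_inv Sg.
  have miso : isomorphism m by exact: loc_mor_iso.
  apply: (iso_cancel (functor_iso H miso)).
  apply: heq_trans (Defs.compA _ _ _) _.
  apply: heq_trans (comp_heq (heq_sym (aC X Y g)) (heq_refl _)) _.
  have Gmw : fhom G m \oh fhom G w =h idm (G Y).
    apply: heq_trans (heq_sym (fhom_comp G m w)) _.
    exact: heq_trans (fhom_heq G (loc_mor_inv Sg)) (fhom_id G _).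
  have Hmw : fhom H m \oh fhom H w =h idm (H Y).
    apply: heq_trans (heq_sym (fhom_comp H m w)) _.
    exact: heq_trans (fhom_heq H (loc_mor_inv Sg)) (fhom_id H _).
  apply: heq_trans (heq_sym (Defs.compA _ _ _)) _.
  apply: heq_trans (comp_heq (heq_refl _) Gmw) _.
  apply: heq_trans (compm1 _) _; apply: heq_sym.
  apply: heq_trans (Defs.compA _ _ _) _.
  exact: heq_trans (comp_heq Hmw (heq_refl _)) (comp1m _).
- pose g' : @mor (localization S) Y Z := g;
  pose f' : @mor (localization S) X Y := f.
  apply: heq_trans (comp_heq (heq_refl _) (fhom_comp G g' f')) _.
  apply: heq_trans (Defs.compA _ _ _) _.
  apply: heq_trans (comp_heq IHg (heq_refl _)) _.
  apply: heq_trans (heq_sym (Defs.compA _ _ _)) _.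
  apply: heq_trans (comp_heq (heq_refl _) IHf) _.
  apply: heq_trans (Defs.compA _ _ _) _.
  exact: comp_heq (heq_sym (fhom_comp H g' f')) (heq_refl _).
Qed.

(** Germs reflect isomorphisms, so no perfection of a cone has to be checked. *)
Lemma dmor_bijective_iso (R : pzRingType) (X Y : kmb_obj R) (f : chain_map X Y)
  :
  (forall i, bijective (f i)) -> isomorphism (dmor f).
Proof.
move=> bf; apply: (ff_reflects_iso (@Dsg_germ_faithful R) (@Dsg_germ_full R)).
by apply: (@germ_bijective_iso R _ _ _ 0) => i _; apply: bf.
Qed.

(** * Compatibility with suspension and distinguished triangles *)

Section Triangles.
Variables (R : pzRingType) (e : R) (he : e * e = e).

Local Notation S := (corner he).

Hypothesis ilamK : forall X : complex S, in_Kmb X -> in_Kmb (ilam X).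
Hypothesis ilamP : forall X : complex S,
  in_Kmb X -> perfect X -> perfect (ilam X).

Local Notation F := (Dsg_ilam ilamK ilamP).
Local Notation eta := (Dsg_ilam_shift ilamK ilamP).

Lemma cone_ilam_bijective (X Y : complex S) (f : chain_map X Y) i :
  bijective (cone_ilam_map f i).
Proof.
exists (fun u => tensor_map (@pair0l _ (X (i + 1)) (Y i)) u.1
  + tensor_map (@pair0r _ (X (i + 1)) (Y i)) u.2) => [t|[t u]] /=.
- rewrite (@tensor_map_comp _ _ _ _ _ _ _ _ (@pair0l _ (X (i + 1)) (Y i) \o
  fst)) //.
  rewrite (@tensor_map_comp _ _ _ _ _ _ _ _ (@pair0r _ (X (i + 1)) (Y i) \o
    snd)) //.
  rewrite (@tensor_map_add _ _ _ _ _ _ _ idfun) ?tensor_map_id // => -[x y] /=.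
  by congr (_, _); rewrite /= ?addr0 ?add0r.
- rewrite /pair_map !linearD; congr (_, _).
    transitivity (tensor_map (idfun : {linear X (i + 1) -> X (i + 1)}) t
                  + tensor_map (\0 : {linear Y i -> X (i + 1)}) u).
      by congr (_ + _); apply: tensor_map_comp.
    by rewrite tensor_map_id // tensor_map_zero // addr0.
  transitivity (tensor_map (\0 : {linear X (i + 1) -> Y i}) t
                + tensor_map (idfun : {linear Y i -> Y i}) u).
    by congr (_ + _); apply: tensor_map_comp.
  by rewrite tensor_map_id // tensor_map_zero // add0r.
Qed.

Lemma eta_natural_isomorphism : @natural_isomorphism (Dsg S) (Dsg R)
  (functor_comp F (susp (Dsg S))) (functor_comp (susp (Dsg R)) F) eta.
Proof.
split=> [|X].
  apply: natural_localization => X Y f.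
  apply: heq_trans (@dmor_comp R (kmb_ilam ilamK (kmb_shift X))
    (kmb_ilam ilamK (kmb_shift Y)) (kmb_shift (kmb_ilam ilamK Y))
    (ilam_shift Y) (ilam_map (shift_map f))) _.
  apply: heq_trans _ (heq_sym (@dmor_comp R (kmb_ilam ilamK (kmb_shift X))
    (kmb_shift (kmb_ilam ilamK X)) (kmb_shift (kmb_ilam ilamK Y))
    (shift_map (ilam_map f)) (ilam_shift X))).
  by apply: dmor_homotopic; apply: homotopic_ext.
by apply: (@dmor_bijective_iso R (kmb_ilam ilamK (kmb_shift X))
  (kmb_shift (kmb_ilam ilamK X)) (ilam_shift X)) => i; exists idfun.
Qed.

Lemma map_triangle_distinguished (t : triangle (susp (Dsg S))) :
  distinguished t -> @distinguished (Dsg R) (map_triangle eta t).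
Proof.
move=> [X [Y [f [a [b [c [[ia ib ic] [Ef Eg Eh]]]]]]]].
pose FX := kmb_ilam ilamK X; pose FY := kmb_ilam ilamK Y.
pose Ff : chain_map FX FY := ilam_map f.
(* The image of a standard triangle has third term [ilam (cone f)], not the cone of [ilam_map f];
   [th] is the termwise bijective comparison of the two. *)
pose th : @mor (Dsg R) (F (kmb_cone f)) (kmb_cone Ff) :=
  @dmor R (kmb_ilam ilamK (kmb_cone f)) (kmb_cone Ff) (cone_ilam_map f).
have ith : isomorphism th.
  by apply: dmor_bijective_iso => i; apply: cone_ilam_bijective.
exists FX, FY, Ff, (fhom F a), (fhom F b), (th \oh fhom F c); split.
  by split; [exact: functor_iso..|apply: iso_comp => //; exact: functor_iso].
split.
- apply: heq_trans (heq_sym (fhom_comp F _ _)) _.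
  exact: heq_trans (fhom_heq F Ef) (fhom_comp F _ _).
- apply: heq_trans (heq_sym (Defs.compA _ _ _)) _.
  apply: heq_trans (comp_heq (heq_refl _) (heq_sym (fhom_comp F _ _))) _.
  apply: heq_trans (comp_heq (heq_refl _) (fhom_heq F Eg)) _.
  apply: heq_trans (comp_heq (heq_refl _) (fhom_comp F _ _)) _.
  apply: heq_trans (Defs.compA _ _ _) _.
  apply: comp_heq _ (heq_refl _).
  apply: heq_trans (@dmor_comp R FY (kmb_ilam ilamK (kmb_cone f))
    (kmb_cone Ff) (cone_ilam_map f) (ilam_map (cone_in f))) _.
  apply: dmor_homotopic; apply: homotopic_ext => i y.
  rewrite /= /pair_map; congr (_, _).
    transitivity (tensor_map (\0 : {linear Y i -> X (i + 1)}) y).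
      by apply: tensor_map_comp.
    exact: tensor_map_zero.
  transitivity (tensor_map (idfun : {linear Y i -> Y i}) y).
    by apply: tensor_map_comp.
  exact: tensor_map_id.
have [eta_nat _] := eta_natural_isomorphism.
apply: heq_trans (Defs.compA _ _ _) _.
apply: heq_trans (comp_heq (heq_sym (eta_nat _ _ a)) (heq_refl _)) _.
apply: heq_trans (heq_sym (Defs.compA _ _ _)) _.
apply: heq_trans (comp_heq (heq_refl _) (heq_sym (fhom_comp F _ _))) _.
apply: heq_trans (comp_heq (heq_refl _) (fhom_heq F Eh)) _.
apply: heq_trans (comp_heq (heq_refl _) (fhom_comp F _ _)) _.
apply: heq_trans (Defs.compA _ _ _) _.
apply: heq_trans _ (heq_sym (Defs.compA _ _ _)).
apply: comp_heq _ (heq_refl _).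
apply: heq_trans (@dmor_comp R (kmb_ilam ilamK (kmb_cone f))
  (kmb_ilam ilamK (kmb_shift X)) (kmb_shift FX)
  (ilam_shift X) (ilam_map (cone_out f))) _.
apply: heq_trans _ (heq_sym (@dmor_comp R (kmb_ilam ilamK (kmb_cone f))
  (kmb_cone Ff) (kmb_shift FX) (cone_out Ff) (cone_ilam_map f))).
by apply: dmor_homotopic; apply: homotopic_ext.
Qed.

End Triangles.

Theorem theorem1 (R : pzRingType) (e : R) (he : e * e = e)
  (hR : left_noetherian R)
  (h1 : @finite_projective_dimension (corner he)^c (left_corner_right he))
  (h2 : forall M : lmodType R, finitely_generated M ->
     exists P : resolution M,
       (forall i, finitely_generated (P i)) /\
       exists n : nat, forall i, (n <= i)%N -> in_add_Re he (P i)) :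
  exists (ilamK : forall X : complex (corner he),
            in_Kmb X -> in_Kmb (ilam X))
         (ilamP : forall X : complex (corner he),
            in_Kmb X -> perfect X -> perfect (ilam X)),
    @triangle_equivalence (Dsg (corner he)) (Dsg R)
      (Dsg_ilam ilamK ilamP) (Dsg_ilam_shift ilamK ilamP).
Proof.
pose ilamK (X : complex (corner he)) := @ilam_in_Kmb R e he X h1.
pose ilamP (X : complex (corner he)) := @ilam_perfect R e he X h1.
exists ilamK, ilamP; split.
  split; first exact: eta_natural_isomorphism.
  by move=> t; apply: map_triangle_distinguished.
apply: fully_faithful_dense_equivalence.
- by move=> X Y f g; apply: Dsg_ilam_faithful.
- by move=> X Y g; apply: Dsg_ilam_full.
move=> Z; have [W [phi [KW iphi]]] := ilam_germ_dense h2 (kmb_in Z).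
pose X : Dsg (corner he) := KmbObj KW.
(* Density is known for germs; fullness lifts the isomorphism of germs to [Dsg R], where it is again
   an isomorphism because a fully faithful functor reflects these. *)
have [f Hf] := @Dsg_germ_full R (Dsg_ilam ilamK ilamP X) Z phi.
exists X, f; apply: (ff_reflects_iso (@Dsg_germ_faithful R) (@Dsg_germ_full R)).
have [psi [pq qp]] := iphi; exists psi; split.
  exact: heq_trans (comp_heq (heq_refl psi) Hf) pq.
exact: heq_trans (comp_heq Hf (heq_refl psi)) qp.
Qed.
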